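(* Let $C>0$. Suppose that there exist $a_1\ge 1$ and $a_2>0$ such that for all $\xi\in\Gamma_0$ $$\sum_{x\in\xi}\int_{\Gamma_0}\bigl|K^{-1}d(x,\cdot\cup\xi\setminus x)\bigr|(\eta)\,C^{|\eta|}\,d\lambda(\eta)\le a_1 D(\xi),$$ $$\sum_{x\in\xi}\int_{\Gamma_0}\bigl|K^{-1}b(x,\cdot\cup\xi\setminus x)\bigr|(\eta)\,C^{|\eta|}\,d\lambda(\eta)\le a_2 D(\xi),$$ and, moreover, $$a_1+\frac{a_2}{C}<\frac32 .$$ Then $(\widehat L,\mathcal D)$ is the generator of a holomorphic semigroup $\widehat T(t)$ on $\mathcal L_C$.
   Context: Configurations. $\Gamma$ is the set of all locally finite subsets of $\mathbb R^d$ and $\Gamma_0=\bigsqcup_{n\ge0}\Gamma^{(n)}$ is the set of all finite subsets, where $\Gamma^{(n)}$ is the set of $n$-point subsets (identified with the symmetrization of $\{(x_1,\dots,x_n): x_i\ne x_j\}$, with the corresponding Borel $\sigma$-algebra; $\Gamma^{(0)}=\{\emptyset\}$). $|\eta|$ is the cardinality. Braces of one-point sets are omitted: $\eta\setminus x$, $\eta\cup x$; and $\cdot\cup\xi\setminus x$ means $\cdot\cup(\xi\setminus x)$. The Lebesgue–Poisson measure $\lambda$ on $\Gamma_0$ is given by $\int_{\Gamma_0}G\,d\lambda=G(\emptyset)+\sum_{n\ge1}\frac1{n!}\int_{(\mathbb R^d)^n}G(\{x_1,\dots,x_n\})\,dx_1\cdots dx_n$. A set $M\in\mathcal B(\Gamma_0)$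 is bounded if $M\subset\bigsqcup_{n=0}^N\{\eta\subset\Lambda:|\eta|=n\}$ for some $N\in\mathbb N$ and some bounded Borel $\Lambda\subset\mathbb R^d$. For a function $F$ finite on $\Gamma_0$, $(K^{-1}F)(\eta)=\sum_{\xi\subset\eta}(-1)^{|\eta\setminus\xi|}F(\xi)$, and $|K^{-1}F|(\eta)$ denotes $|(K^{-1}F)(\eta)|$. Rates. $d,b:\mathbb R^d\times\Gamma\to[0,+\infty]$ are measurable (death and birth rates) and satisfy the standing assumptions: $d(x,\eta),b(x,\eta)>0$ for $\eta\in\Gamma_0\setminus\{\emptyset\}$, $x\in\mathbb R^d\setminus\eta$; $d(x,\eta),b(x,\eta)<\infty$ for $\eta\in\Gamma_0$, $x\in\mathbb R^d\setminus\eta$; $\int_M(d(x,\eta)+b(x,\eta))\,d\lambda(\eta)<\infty$ for every bounded $M\in\mathcal B(\Gamma_0)$ and a.a. $x\in\mathbb R^d$; $\int_\Lambda(d(x,\eta)+b(x,\eta))\,dx<\infty$ for every $\eta\in\Gamma_0$ and bounded Borel $\Lambda$. Spaces and operators. $D(\eta)=\sum_{x\in\eta}d(x,\eta\setminus x)$ for $\eta\in\Gamma_0$. $\mathcal L_C=L^1(\Gamma_0,C^{|\cdot|}d\lambda)$ (complexified where needed), with norm $\|G\|_C=\int_{\Gamma_0}|G(\eta)|C^{|\eta|}d\lambda(\eta)$. $\mathcal D=\{G\in\mathcal L_C: D(\cdot)G\in\mathcal L_C\}$. For $G\in\mathcal D$ and $\lambda$-a.a. $\eta$, $$(\widehat LG)(\eta)=-\sum_{\xi\subset\eta}G(\xi)\sum_{x\in\xi}\bigl(K^{-1}d(x,\cdot\cup\xi\setminus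 x)\bigr)(\eta\setminus\xi)+\sum_{\xi\subset\eta}\int_{\mathbb R^d}G(\xi\cup x)\bigl(K^{-1}b(x,\cdot\cup\xi)\bigr)(\eta\setminus\xi)\,dx.$$ A holomorphic semigroup means a strongly continuous semigroup extending analytically to a sector around the positive half-line. *)

(* Defs.v *)
From HB Require Import structures.
From mathcomp Require Import all_boot all_order all_algebra.
From mathcomp Require Import finmap complex.
From mathcomp Require Import all_classical all_reals all_analysis.
From mathcomp Require Import measurable_realfun.

Set Implicit Arguments.
Unset Strict Implicit.
Unset Printing Implicit Defensive.

Import Order.TTheory GRing.Theory Num.Theory.
Import numFieldNormedType.Exports.

Local Open Scope classical_set_scope.
Local Open Scope ring_scope.

Section tuple_measure.
Context d (T : measurableType d) (R : realType).
Variable mu : {sigma_finite_measure set T -> \bar R}.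

Definition tuple_cons n (p : T * n.-tuple T) : n.+1.-tuple T :=
  [the n.+1.-tuple T of p.1 :: p.2].

Lemma measurable_tuple_cons n : measurable_fun setT (@tuple_cons n).
Proof. exact: measurable_cons. Qed.

Section cons_measure.
Variables (n : nat) (nu : {sigma_finite_measure set (n.-tuple T) -> \bar R}).

Definition cons_measure : set (n.+1.-tuple T) -> \bar R :=
  pushforward (mu \x nu)%E (@tuple_cons n).

Let cons_measure_preimage A : measurable A ->
  measurable (@tuple_cons n @^-1` A).
Proof.
by move=> mA; rewrite -[X in measurable X]setTI; exact: measurable_tuple_cons.
Qed.

Let cons_measure0 : cons_measure set0 = 0%E.
Proof. by rewrite /cons_measure /pushforward preimage_set0 measure0. Qed.

Let cons_measure_ge0 A : (0 <= cons_measure A)%E.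
Proof. by rewrite /cons_measure /pushforward measure_ge0. Qed.

Let cons_measure_sigma_additive : semi_sigma_additive cons_measure.
Proof.
move=> F mF tF mUF; rewrite /cons_measure /pushforward preimage_bigcup.
apply: measure_semi_sigma_additive.
- by move=> k; exact: cons_measure_preimage.
- apply/trivIsetP => /= i j _ _ ij; rewrite -preimage_setI.
  by move/trivIsetP : tF => /(_ _ _ _ _ ij) ->//; rewrite preimage_set0.
- by rewrite -preimage_bigcup; exact: cons_measure_preimage.
Qed.

HB.instance Definition _ := isMeasure.Build _ _ _
  cons_measure cons_measure0 cons_measure_ge0 cons_measure_sigma_additive.

Let cons_measure_sigma_finite : sigma_finite setT cons_measure.
Proof.
have /sigma_finiteP[F [FT ndF Foo]] := sigma_finiteT mu.
have /sigma_finiteP[G [GT ndG Goo]] := sigma_finiteT nu.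
pose u (t : n.+1.-tuple T) : T * n.-tuple T := (thead t, [tuple of behead t]).
have Ku : cancel (@tuple_cons n) u.
  by case=> x t; congr (_, _); apply: val_inj.
have mu' : measurable_fun setT u.
  apply/measurable_fun_pair => /=.
  - exact: (@measurable_tnth _ T n.+1 ord0).
  - exact: measurable_behead.
have FGT : \bigcup_k (F k `*` G k) = setT.
  rewrite -setXTT FT GT predeqE => -[x y]; split.
    by move=> [k _ []/= ? ?]; split; exists k.
  move=> [/= [k _ Fkx] [l _ Gly]]; exists (maxn k l) => //; split.
  - by move: x Fkx; exact/subsetPset/ndF/leq_maxl.
  - by move: y Gly; exact/subsetPset/ndG/leq_maxr.
exists (fun k => u @^-1` (F k `*` G k)).
  by rewrite -preimage_bigcup FGT preimage_setT.
move=> k; have [mF Fkoo] := Foo k; have [mG Gkoo] := Goo k; split.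
  by rewrite -[X in measurable X]setTI; apply: mu' => //; exact: measurableX.
rewrite /cons_measure /pushforward -comp_preimage.
rewrite (_ : u \o _ = id); last by apply/funext => x /=; exact: Ku.
by rewrite preimage_id product_measure1E// lte_mul_pinfty// ge0_fin_numE.
Qed.

HB.instance Definition _ := Measure_isSigmaFinite.Build _ _ _
  cons_measure cons_measure_sigma_finite.

End cons_measure.

(* the n-fold product of [mu], on the product sigma-algebra of [n.-tuple T] *)
Fixpoint tuple_measure n : {sigma_finite_measure set (n.-tuple T) -> \bar R} :=
  if n is k.+1 then
    [the {sigma_finite_measure set _ -> \bar R} of cons_measure (tuple_measure k)]
  else [the {sigma_finite_measure set _ -> \bar R} of \d_([tuple] : 0.-tuple T)].

End tuple_measure.

Section lebR.
Context (R : realType).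

(* [lebesgue_measure] is attached to the alias [measurableTypeR R] of [R];
   [lebR] is the same set function attached to the canonical sigma-algebra
   of [R] *)
Definition lebR : set R -> \bar R := @lebesgue_measure R.

Let lebR0 : lebR set0 = 0%E.
Proof. exact: (measure0 (@lebesgue_measure R)). Qed.

Let lebR_ge0 A : (0 <= lebR A)%E.
Proof. exact: (measure_ge0 (@lebesgue_measure R)). Qed.

Let lebR_sigma_additive : semi_sigma_additive lebR.
Proof. exact: (@measure_semi_sigma_additive _ _ _ (@lebesgue_measure R)). Qed.

HB.instance Definition _ :=
  isMeasure.Build _ _ _ lebR lebR0 lebR_ge0 lebR_sigma_additive.

Let lebR_sigma_finite : sigma_finite setT lebR.
Proof. exact: (sigma_finiteT (@lebesgue_measure R)). Qed.

HB.instance Definition _ :=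
  Measure_isSigmaFinite.Build _ _ _ lebR lebR_sigma_finite.

End lebR.

Section configurations.
Context (R : realType) (dim : nat).
Local Notation Rd := (dim.-tuple R).

Definition leb : {sigma_finite_measure set Rd -> \bar R} :=
  tuple_measure [the {sigma_finite_measure set R -> \bar R} of @lebR R] dim.

Definition bounded_Rd (L : set Rd) : Prop :=
  exists r : R, forall x, L x -> forall i, `|tnth x i| <= r.

Definition locally_finite (g : set Rd) : Prop :=
  forall L, bounded_Rd L -> finite_set (g `&` L).

Definition Gamma : Type := {g : set Rd | locally_finite g}.

Lemma locally_finite0 : locally_finite set0.
Proof. by move=> L _; rewrite set0I; exact: finite_set0. Qed.

HB.instance Definition _ := gen_eqMixin Gamma.
HB.instance Definition _ := gen_choiceMixin Gamma.
HB.instance Definition _ := isPointed.Build Gamma (exist _ set0 locally_finite0).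

(* the sigma-algebra on Gamma generated by the counting maps
   g |-> #(g `&` L), for L bounded Borel *)
Definition Gamma_cylinders : set (set Gamma) :=
  [set A | exists L k, [/\ measurable L, bounded_Rd L &
     A = [set g : Gamma | (sval g `&` L #= `I_k)%card]]].

HB.instance Definition _ := @isMeasurable.Build default_measure_display Gamma
  <<s Gamma_cylinders >> (@sigma_algebra0 _ setT Gamma_cylinders)
  (@sigma_algebraC _ Gamma_cylinders)
  (@sigma_algebra_bigcup _ setT Gamma_cylinders).

Definition Gamma0 : Type := {fset Rd}.

HB.instance Definition _ := Choice.on Gamma0.
HB.instance Definition _ := isPointed.Build Gamma0 (fset0 : {fset Rd}).

Lemma locally_finite_fset (eta : {fset Rd}) : locally_finite [set` eta].
Proof. by move=> L _; exact/finite_setIl/finite_fset. Qed.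

Definition Gamma_of_Gamma0 (eta : Gamma0) : Gamma :=
  exist _ [set` (eta : {fset Rd})] (@locally_finite_fset eta).

(* the n-point configurations are the images of the pairwise distinct n-tuples *)
Definition config n (t : n.-tuple Rd) : Gamma0 := [fset x in val t]%fset.

Definition distinct n (A : set Gamma0) : set (n.-tuple Rd) :=
  [set t : n.-tuple Rd | uniq t /\ A (config t)].

Lemma measurable_uniq n : measurable [set t : n.-tuple Rd | uniq t].
Proof.
have -> : [set t : n.-tuple Rd | uniq t] =
    \bigcap_(p in [set: 'I_n * 'I_n]) \bigcap_(_ in [set _ : unit | p.1 != p.2])
      ~` (\bigcap_(k in [set: 'I_dim])
        [set t : n.-tuple Rd | tnth (tnth t p.1) k = tnth (tnth t p.2) k]).
  apply/seteqP; split => t /=.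
    move=> /tuple_uniqP tinj [i j] _ _ /= ij h.
    move/eqP: ij; apply; apply: tinj; apply: eq_from_tnth => k.
    exact: h.
  move=> h; apply/tuple_uniqP => i j tij; apply/eqP/negPn/negP => ij.
  by apply: (h (i, j) I tt) => //= k _; rewrite /= tij.
apply: fin_bigcap_measurable => // p _; apply: fin_bigcap_measurable => // _ _.
apply: measurableC; apply: fin_bigcap_measurable => // k _.
rewrite [X in measurable X](_ : _ = setT `&`
  (fun t : n.-tuple Rd => tnth (tnth t p.1) k == tnth (tnth t p.2) k)
    @^-1` [set true]); last first.
  by rewrite setTI; apply/seteqP; split => t /= /eqP.
have mk i : measurable_fun setT (fun t : n.-tuple Rd => tnth (tnth t i) k).
  apply: (measurableT_comp (@measurable_tnth _ _ dim k)).
  exact: measurable_tnth.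
exact: measurable_fun_eqr.
Qed.

Lemma distinctE n A : @distinct n A = [set t : n.-tuple Rd | uniq t] `&` (@config n @^-1` A).
Proof. by []. Qed.

Definition Gamma0_measurable : set (set Gamma0) :=
  [set A | forall n, measurable (@distinct n A)].

Let Gamma0_measurable0 : Gamma0_measurable set0.
Proof. by move=> n; rewrite distinctE preimage_set0 setI0. Qed.

Let Gamma0_measurableC A : Gamma0_measurable A -> Gamma0_measurable (~` A).
Proof.
move=> mA n; have := measurableD (@measurable_uniq n) (mA n).
congr (measurable _); rewrite !distinctE; apply/seteqP; split => t /=.
  by case=> ut /not_andP[|]//.
by case=> ut nAt; split => // -[].
Qed.

Let Gamma0_measurable_bigcup (F : (set Gamma0)^nat) :
  (forall i, Gamma0_measurable (F i)) -> Gamma0_measurable (\bigcup_i F i).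
Proof.
move=> mF n; rewrite distinctE preimage_bigcup setI_bigcupr.
by apply: bigcupT_measurable => i; exact: mF.
Qed.

HB.instance Definition _ := @isMeasurable.Build default_measure_display Gamma0
  Gamma0_measurable Gamma0_measurable0 Gamma0_measurableC
  Gamma0_measurable_bigcup.

Lemma measurable_Gamma0P (A : set Gamma0) :
  measurable A <-> forall n, measurable (@distinct n A).
Proof. by []. Qed.

(* the Lebesgue measure, in (R^dim)^n, of the set of pairwise distinct tuples
   representing [A]; for [0 < dim] the omitted diagonals are null *)
Definition n_point_measure n (A : set Gamma0) : \bar R :=
  tuple_measure leb n (@distinct n A).

Let n_point_measure0 n : n_point_measure n set0 = 0%E.
Proof. by rewrite /n_point_measure distinctE preimage_set0 setI0 measure0. Qed.

Let n_point_measure_ge0 n A : (0 <= n_point_measure n A)%E.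
Proof. by rewrite /n_point_measure measure_ge0. Qed.

Let n_point_measure_sigma_additive n : semi_sigma_additive (n_point_measure n).
Proof.
move=> F mF tF mUF; rewrite /n_point_measure distinctE preimage_bigcup setI_bigcupr.
apply: measure_semi_sigma_additive.
- by move=> k; exact: mF.
- by move=> i j _ _ [t [[_ Fit] [_ Fjt]]]; apply: tF => //; exists (config t).
- by rewrite -setI_bigcupr -preimage_bigcup; exact: mUF.
Qed.

HB.instance Definition _ n := isMeasure.Build _ _ _ (n_point_measure n)
  (n_point_measure0 n) (n_point_measure_ge0 n)
  (@n_point_measure_sigma_additive n).

Definition lebesgue_poisson : {measure set Gamma0 -> \bar R} :=
  mseries (fun n => mscale (n`!%:R^-1 : R)%:nng (n_point_measure n)) 0.

End configurations.

Section complex_valued.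
Context d (T : measurableType d) (R : realType).

Definition cmeasurable (f : T -> R[i]) : Prop :=
  measurable_fun setT (fun x => complex.Re (f x)) /\
  measurable_fun setT (fun x => complex.Im (f x)).

Definition Cintegral (mu : {measure set T -> \bar R}) (f : T -> R[i]) : R[i] :=
  Complex (\int[mu]_x complex.Re (f x))%R (\int[mu]_x complex.Im (f x))%R.

Lemma cmeasurableZD (a : R[i]) (f g : T -> R[i]) :
  cmeasurable f -> cmeasurable g -> cmeasurable (fun x => a * f x + g x).
Proof.
case: a => a b [mRf mIf] [mRg mIg]; split.
- rewrite (_ : (fun x => _) = (fun x => a * complex.Re (f x)
    - b * complex.Im (f x) + complex.Re (g x))).
    apply: measurable_funD => //; apply: measurable_funB;
      apply: measurable_funM => //; exact: measurable_cst.
  by apply/funext => x; case: (f x) (g x) => [? ?] [? ?].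
- rewrite (_ : (fun x => _) = (fun x => a * complex.Im (f x)
    + b * complex.Re (f x) + complex.Im (g x))).
    apply: measurable_funD => //; apply: measurable_funD;
      apply: measurable_funM => //; exact: measurable_cst.
  by apply/funext => x; case: (f x) (g x) => [? ?] [? ?].
Qed.

Lemma measurable_normc (f : T -> R[i]) : cmeasurable f ->
  measurable_fun setT (fun x => ComplexField.Normc.normc (f x)).
Proof.
move=> [mR mI]; rewrite (_ : (fun x => _) = Num.sqrt \o (fun x =>
   complex.Re (f x) ^+ 2 + complex.Im (f x) ^+ 2)); last first.
  by apply/funext => x /=; case: (f x).
apply: measurableT_comp.
  by apply: continuous_measurable_fun; exact: sqrt_continuous.
by apply: measurable_funD; exact: measurable_funX.
Qed.

End complex_valued.

Section weighted_L1.
Context (R : realType) (dim : nat) (C : {posnum R}).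
Local Notation Gamma0 := (Gamma0 R dim).
Local Notation normc := ComplexField.Normc.normc.
Implicit Types G : Gamma0 -> R[i].

Definition LC_norm G : \bar R :=
  \int[@lebesgue_poisson R dim]_eta (normc (G eta) * C%:num ^+ #|` eta|)%:E.

Lemma measurable_weight :
  measurable_fun setT (fun eta : Gamma0 => C%:num ^+ #|` eta| : R).
Proof.
move=> _ B mB; rewrite setTI; apply/measurable_Gamma0P => n; rewrite distinctE.
have [Cn|Cn] := pselect (B (C%:num ^+ n)).
  rewrite (_ : _ `&` _ = [set t : n.-tuple _ | uniq t]).
    exact: measurable_uniq.
  apply/seteqP; split => [t []//|t ut]; split => //=.
  by rewrite /config card_fseq undup_id// size_tuple.
rewrite (_ : _ `&` _ = set0) // -subset0 => t [/= ut].
by rewrite /config card_fseq undup_id// size_tuple.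
Qed.

Lemma measurable_LC_integrand G : cmeasurable G ->
  measurable_fun setT (fun eta => (normc (G eta) * C%:num ^+ #|` eta|)%:E).
Proof.
move=> mG; apply/measurable_EFinP; apply: measurable_funM.
  exact: measurable_normc.
exact: measurable_weight.
Qed.

Let integrand_ge0 G eta : (0 <= (normc (G eta) * C%:num ^+ #|` eta|)%:E)%E.
Proof.
by rewrite lee_fin mulr_ge0 ?exprn_ge0//; case: (G eta) => ? ?; exact: sqrtr_ge0.
Qed.

Lemma LC_norm_ge0 G : (0 <= LC_norm G)%E.
Proof. by apply: integral_ge0 => eta _; exact: integrand_ge0. Qed.

Lemma LC_normD G H : cmeasurable G -> cmeasurable H ->
  (LC_norm (G + H)%R <= LC_norm G + LC_norm H)%E.
Proof.
move=> mG mH; rewrite /LC_norm -ge0_integralD//;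
  try by [exact: measurable_LC_integrand | move=> ? _; exact: integrand_ge0].
apply: ge0_le_integral => //; try by [move=> ? _; exact: integrand_ge0].
- apply: measurable_LC_integrand.
  rewrite (_ : G + H = fun x => 1 * G x + H x); first exact: cmeasurableZD.
  by apply/funext => x; rewrite mul1r.
- by apply: emeasurable_funD; exact: measurable_LC_integrand.
- move=> eta _; rewrite -EFinD lee_fin -mulrDl ler_wpM2r ?exprn_ge0//.
  exact: le_normcD.
Qed.

Lemma LC_normZ a G : cmeasurable G ->
  LC_norm (a *: G) = ((normc a)%:E * LC_norm G)%E.
Proof.
move=> mG; rewrite /LC_norm -ge0_integralZl//.
- apply: eq_integral => eta _; rewrite -EFinM mulrA; congr (_ * _)%:E.
  exact: ComplexField.Normc.normcM.
- exact: measurable_LC_integrand.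
- by rewrite lee_fin; case: a => ? ?; exact: sqrtr_ge0.
Qed.

Definition in_LC : {pred Gamma0 -> R[i]} :=
  fun G => `[< cmeasurable G /\ (LC_norm G < +oo)%E >].

Lemma in_LCP G : reflect (cmeasurable G /\ (LC_norm G < +oo)%E) (G \in in_LC).
Proof. exact: asboolP. Qed.

Lemma cmeasurable0 : cmeasurable (0 : Gamma0 -> R[i]).
Proof. by split; exact: measurable_cst. Qed.

Lemma LC_norm0 : LC_norm 0 = 0%E.
Proof.
rewrite /LC_norm; under eq_integral do rewrite ComplexField.Normc.normc0 mul0r.
exact: integral0.
Qed.

Lemma in_LC_submod : submod_closed in_LC.
Proof.
split; first by apply/in_LCP; split; [exact: cmeasurable0|rewrite LC_norm0 ltry].
move=> a G H /in_LCP[mG Goo] /in_LCP[mH Hoo]; apply/in_LCP.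
split; first exact: cmeasurableZD.
have maG : cmeasurable (a *: G).
  rewrite (_ : a *: G = fun x => a * G x + 0).
    exact: (cmeasurableZD a mG cmeasurable0).
  by apply/funext => x; rewrite addr0.
apply: le_lt_trans (LC_normD maG mH) _; rewrite lte_add_pinfty// LC_normZ//.
by rewrite lte_mul_pinfty// lee_fin; case: a {maG} => ? ?; exact: sqrtr_ge0.
Qed.

HB.instance Definition _ :=
  GRing.isSubmodClosed.Build R[i] (Gamma0 -> R[i]) in_LC in_LC_submod.

Record preLC := PreLC { preLC_fun :> Gamma0 -> R[i] ; _ : preLC_fun \in in_LC }.

HB.instance Definition _ := [isSub for preLC_fun].
HB.instance Definition _ := [Choice of preLC by <:].
HB.instance Definition _ := [SubChoice_isSubLmodule of preLC by <:].

Definition LC_null : {pred preLC} :=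
  fun G : preLC => `[< {ae @lebesgue_poisson R dim, forall eta, G eta = 0} >].

Lemma LC_nullP (G : preLC) :
  reflect {ae @lebesgue_poisson R dim, forall eta, G eta = 0} (G \in LC_null).
Proof. exact: asboolP. Qed.

Lemma LC_null_submod : submod_closed LC_null.
Proof.
split; first by apply/LC_nullP; exact: aeW.
move=> a G H /LC_nullP G0 /LC_nullP H0; apply/LC_nullP.
apply: filterS2 G0 H0 => eta /= Ge He.
by change (a * G eta + H eta = 0); rewrite Ge He mulr0 addr0.
Qed.

HB.instance Definition _ :=
  GRing.isSubmodClosed.Build R[i] preLC LC_null LC_null_submod.

(* complex L^1(Gamma0, C^|.| lambda), modulo lambda-a.e. equality *)
Definition LC : Type := Quotient.quot [the zmodClosed preLC of LC_null].

HB.instance Definition _ := GRing.Zmodule.on LC.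
HB.instance Definition _ := EqQuotient.on LC.

Definition LC_class (G : preLC) : LC := (\pi_LC G)%qT.

(* an arbitrary representative; see [LC_class_eq] and [LC_fun_class] *)
Definition LC_fun (g : LC) : preLC := repr g.

Lemma LC_funK : cancel LC_fun LC_class.
Proof. exact: reprK. Qed.

Lemma LC_class_eq (G H : preLC) : LC_class G = LC_class H <->
  {ae @lebesgue_poisson R dim, forall eta, G eta = H eta}.
Proof.
have -> : LC_class G = LC_class H <-> G - H \in LC_null.
  by rewrite Quotient.idealrBE; split=> [GH|/eqP]; [exact/eqP|].
split=> [/LC_nullP|] GH; [|apply/LC_nullP]; apply: filterS GH => eta /=.
  by move/eqP; rewrite -[X in X == 0]/(G eta - H eta) subr_eq0 => /eqP.
by move=> GH; rewrite -[LHS]/(G eta - H eta) GH subrr.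
Qed.

Lemma LC_classD (G H : preLC) : LC_class (G + H) = LC_class G + LC_class H.
Proof. by rewrite /LC_class !piE. Qed.

Definition LC_scale (a : R[i]) (g : LC) : LC := LC_class (a *: LC_fun g).

Lemma LC_fun_class (G : preLC) :
  {ae @lebesgue_poisson R dim, forall eta, LC_fun (LC_class G) eta = G eta}.
Proof. by apply/LC_class_eq; rewrite LC_funK. Qed.

Lemma LC_scale_class a (G : preLC) : LC_scale a (LC_class G) = LC_class (a *: G).
Proof.
apply/LC_class_eq; apply: filterS (LC_fun_class G) => eta /= GE.
by rewrite -[LHS]/(a * LC_fun (LC_class G) eta) GE.
Qed.

Let LC_scaleA a b g : LC_scale a (LC_scale b g) = LC_scale (a * b) g.
Proof. by rewrite -[g]LC_funK !LC_scale_class scalerA. Qed.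

Let LC_scale1 : left_id 1 LC_scale.
Proof. by move=> g; rewrite -[g]LC_funK LC_scale_class scale1r. Qed.

Let LC_scaleDr : right_distributive LC_scale +%R.
Proof.
move=> a g h; rewrite -[g]LC_funK -[h]LC_funK -LC_classD !LC_scale_class.
by rewrite scalerDr LC_classD.
Qed.

Let LC_scaleDl g : {morph LC_scale^~ g : a b / a + b}.
Proof.
by move=> a b; rewrite -[g]LC_funK !LC_scale_class scalerDl LC_classD.
Qed.

HB.instance Definition _ := GRing.Zmodule_isLmodule.Build R[i] LC
  LC_scaleA LC_scale1 LC_scaleDr LC_scaleDl.

Definition LC_normc (g : LC) : R[i] := ((fine (LC_norm (LC_fun g)))%:C)%C.

Lemma preLCP (G : preLC) : cmeasurable G /\ (LC_norm G < +oo)%E.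
Proof. by case: G => G GP; exact/in_LCP. Qed.

Lemma LC_norm_class (G : preLC) : LC_norm (LC_fun (LC_class G)) = LC_norm G.
Proof.
apply: ae_eq_integral => //.
- exact: measurable_LC_integrand (preLCP _).1.
- exact: measurable_LC_integrand (preLCP _).1.
- by apply: filterS (LC_fun_class G) => eta /= -> _.
Qed.

Lemma LC_norm_fin (G : preLC) : LC_norm G \is a fin_num.
Proof. by rewrite ge0_fin_numE ?LC_norm_ge0//; exact: (preLCP G).2. Qed.

Lemma LC_normcE (G : preLC) : LC_normc (LC_class G) = ((fine (LC_norm G))%:C)%C.
Proof. by rewrite /LC_normc LC_norm_class. Qed.

Let fine_leD (a b c : \bar R) : a \is a fin_num -> b \is a fin_num ->
  c \is a fin_num -> (a <= b + c)%E -> fine a <= fine b + fine c.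
Proof. by move: a b c => [a| |] [b| |] [c| |]. Qed.

Let LC_normcD g h : LC_normc (g + h) <= LC_normc g + LC_normc h.
Proof.
rewrite -[g]LC_funK -[h]LC_funK -LC_classD !LC_normcE -rmorphD/= lecR.
apply: (fine_leD (LC_norm_fin (LC_fun g + LC_fun h)) (LC_norm_fin (LC_fun g))
  (LC_norm_fin (LC_fun h))).
exact: (@LC_normD (LC_fun g) (LC_fun h) (preLCP _).1 (preLCP _).1).
Qed.

Let LC_normcZ a g : LC_normc (a *: g) = `|a| * LC_normc g.
Proof.
rewrite -[g]LC_funK -[a *: _]/(LC_scale a _) LC_scale_class !LC_normcE.
have -> : LC_norm (a *: LC_fun g) = ((normc a)%:E * LC_norm (LC_fun g))%E.
  exact: (@LC_normZ a (LC_fun g) (preLCP _).1).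
by rewrite fineM ?LC_norm_fin//= rmorphM/=; case: a.
Qed.

Let LC_normc_eq0 g : LC_normc g = 0 -> g = 0.
Proof.
rewrite -[g]LC_funK LC_normcE => -[] G0.
have {}G0 : LC_norm (LC_fun g) = 0%E by rewrite -[LHS]fineK ?LC_norm_fin// G0.
have -> : 0 = LC_class 0 by rewrite /LC_class !piE.
apply/LC_class_eq.
have mG := measurable_LC_integrand (preLCP (LC_fun g)).1.
have : (\int[@lebesgue_poisson R dim]_eta
    `|(normc (LC_fun g eta) * C%:num ^+ #|` eta|)%:E| = 0)%E.
  by rewrite -[RHS]G0; apply: eq_integral => eta _; rewrite gee0_abs.
move/(ae_eq_integral_abs _ measurableT mG); apply: filterS => eta /= /(_ I).
move=> [] /eqP; rewrite mulf_eq0 expf_eq0 (gt_eqF (gt0 C)) andbF orbF => /eqP.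
exact: ComplexField.Normc.eq0_normc.
Qed.

HB.instance Definition _ :=
  Lmodule_isNormed.Build R[i] LC LC_normcD LC_normcZ LC_normc_eq0.

End weighted_L1.


Section semigroups.
Context (R : realType) (X : normedModType R[i]).
Implicit Types (T : R -> X -> X) (S : R[i] -> X -> X).

Definition bounded_operator (A : X -> X) : Prop :=
  linear A /\ exists M : R, forall x, `|A x| <= (M%:C)%C * `|x|.

Definition C0_semigroup T : Prop :=
  [/\ forall t, 0 <= t -> bounded_operator (T t),
      T 0 = id,
      forall s t, 0 <= s -> 0 <= t -> T (s + t) = T s \o T t
    & forall x, T t x @[t --> (0 : R)^'+] --> x].

Definition diff_quotient T (x : X) (t : R) : X := ((t^-1)%:C)%C *: (T t x - x).

Definition generator_dom T : set X :=
  [set x | cvg (diff_quotient T x t @[t --> (0 : R)^'+])].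

Definition generator T (x : X) : X :=
  lim (diff_quotient T x t @[t --> (0 : R)^'+]).

(* the open sector { z != 0 | |arg z| < theta } *)
Definition sector (theta : R) : set R[i] :=
  [set z | exists r phi : R,
     [/\ 0 < r, `|phi| < theta & z = Complex (r * cos phi) (r * sin phi)]].

(* complex differentiability at [z] for the operator norm *)
Definition op_differentiable S (z : R[i]) : Prop :=
  exists2 A : X -> X, bounded_operator A &
    forall e : R, 0 < e -> \forall h \near (0 : R[i]^o)^',
      forall x, `|h^-1 *: (S (z + h) x - S z x) - A x| <= (e%:C)%C * `|x|.

Definition holomorphic_semigroup T : Prop :=
  C0_semigroup T /\
  exists theta S,
    [/\ 0 < theta <= pi / 2,
        forall t, 0 < t -> S (t%:C)%C = T t,
        forall z, sector theta z -> bounded_operator (S z),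
        forall z w, sector theta z -> sector theta w ->
          S (z + w) = S z \o S w &
        (forall z, sector theta z -> op_differentiable S z) /\
        (forall theta', 0 < theta' < theta -> forall x,
           S z x @[z --> within (sector theta') (nbhs (0 : R[i]^o))] --> x)].

End semigroups.

Section birth_and_death.
Context (R : realType) (dim : nat).
Local Notation Rd := (dim.-tuple R).
Local Notation Gamma := (Gamma R dim).
Local Notation Gamma0 := (Gamma0 R dim).
Local Notation lambda := (@lebesgue_poisson R dim).
Local Notation leb := (@leb R dim).

Definition rate : Type := Rd -> Gamma -> \bar R.

Definition rate0 (r : rate) (x : Rd) (eta : Gamma0) : \bar R :=
  r x (Gamma_of_Gamma0 eta).

Definition bounded_Gamma0 (M : set Gamma0) : Prop :=
  measurable M /\
  exists (N : nat) (L : set Rd), [/\ measurable L, bounded_Rd L &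
    forall eta, M eta -> (#|` eta| <= N)%N /\ forall x, x \in eta -> L x].

Record admissible_rates (d b : rate) : Prop := {
  death_measurable : measurable_fun setT (fun p : Rd * Gamma => d p.1 p.2) ;
  birth_measurable : measurable_fun setT (fun p : Rd * Gamma => b p.1 p.2) ;
  death_ge0 : forall x gamma, (0 <= d x gamma)%E ;
  birth_ge0 : forall x gamma, (0 <= b x gamma)%E ;
  rates_gt0 : forall (eta : Gamma0) x, eta != fset0 -> x \notin eta ->
    (0 < rate0 d x eta)%E /\ (0 < rate0 b x eta)%E ;
  rates_finite : forall (eta : Gamma0) x, x \notin eta ->
    (rate0 d x eta < +oo)%E /\ (rate0 b x eta < +oo)%E ;
  rates_integrable_config : forall M, bounded_Gamma0 M ->
    {ae leb, forall x,
      (\int[lambda]_(eta in M) (rate0 d x eta + rate0 b x eta) < +oo)%E} ;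
  rates_integrable_space : forall (eta : Gamma0) (L : set Rd),
    measurable L -> bounded_Rd L ->
    (\int[leb]_(x in L) (rate0 d x eta + rate0 b x eta) < +oo)%E }.

(* [fine] is harmless below: the arguments of the rates are such that the
   values used are finite, up to null sets *)
Definition Kinv (F : Gamma0 -> \bar R) (eta : Gamma0) : R :=
  \sum_(xi <- fpowerset eta) (-1) ^+ #|` (eta `\` xi)%fset| * fine (F xi).

(* D(eta) *)
Definition death_total (d : rate) (eta : Gamma0) : R :=
  \sum_(x <- eta) fine (rate0 d x (eta `\ x)%fset).

(* K^{-1} r(x, . u xi) *)
Definition Kinv_rate (r : rate) (x : Rd) (xi : Gamma0) : Gamma0 -> R :=
  Kinv (fun alpha : Gamma0 => rate0 r x (alpha `|` xi)%fset).

(* sum_(x in xi) int |K^{-1} r(x, . u xi \ x)|(eta) C^|eta| dlambda(eta) *)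
Definition Kinv_total (r : rate) (C : R) (xi : Gamma0) : \bar R :=
  (\sum_(x <- xi) \int[lambda]_eta
     (`|Kinv_rate r x (xi `\ x)%fset eta| * C ^+ #|` eta|)%:E)%E.

Definition Lhat (d b : rate) (G : Gamma0 -> R[i]) (eta : Gamma0) : R[i] :=
  - (\sum_(xi <- fpowerset eta) G xi *
       ((\sum_(x <- xi) Kinv_rate d x (xi `\ x)%fset (eta `\` xi)%fset)%:C)%C)
  + \sum_(xi <- fpowerset eta) Cintegral leb (fun x : Rd =>
       G (x |` xi)%fset * ((Kinv_rate b x xi (eta `\` xi)%fset)%:C)%C).

Definition Lhat_dom (d : rate) (C : {posnum R}) : set (LC dim C) :=
  [set g | (fun eta => ((death_total d eta)%:C)%C * LC_fun g eta)
             \in @in_LC R dim C].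

End birth_and_death.

(* Main.v *)
(* Write A = B - D, where D is the multiplication by the total death rate. The
   Minlos and Mecke identities for the Lebesgue-Poisson measure turn the two
   kernel bounds into |B g| <= w |D g| with w = a1 - 1 + a2 / C < 1/2. On the cone
   |z| <= 2 Re z one has |1 + z D| >= 1 + |z| D / 2 pointwise, and the L^1 norm
   is additive, so that |g - z A g| >= |g| + kappa |z| |A g| with
   kappa = (1/2 - w) / (1 + w), and 1 - z A is onto by a contraction argument. The
   resolvents J(z) = (1 - z A)^-1 are therefore commuting contractions on the
   cone, and T(z) is the limit of J(z / 2^k)^(2^k). Summing the dissipation
   estimate over n successive resolvent steps gives
   n kappa |z| |A J(z)^n x| <= |x|, hence kappa |z| |A T(z) x| <= |x|; this
   smoothing bound yields complex differentiability of T in operator norm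
   without any contour integral. *)
Require Import Defs.
From HB Require Import structures.
From mathcomp Require Import all_boot all_order all_algebra.
From mathcomp Require Import finmap complex.
From mathcomp Require Import all_classical all_reals all_analysis.
From mathcomp Require Import measurable_realfun.
From mathcomp Require Import ring lra.

Set Implicit Arguments.
Unset Strict Implicit.
Unset Printing Implicit Defensive.

Import Order.TTheory GRing.Theory Num.Theory.
Import numFieldNormedType.Exports.

Local Open Scope classical_set_scope.
Local Open Scope ring_scope.

(** * Sequences and contractions in complex normed spaces *)

Section real_norm.
Context (R : realType) (X : normedModType R[i]).
Local Notation normc := ComplexField.Normc.normc.

(** The cone is the closed sector of half-angle pi/3, where Re z is at least |z| / 2; so the 3/2 of
    the hypothesis is 1 + cos(pi/3), and w < 1/2 is exactly what keeps kappa positive.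
    Differentiability is claimed on the sector of half-angle pi/4: its points are interior to the
    cone, which leaves room for z / 2 + h. Two obstacles shape the concrete part. [Lhat] acts on
    functions while the semigroup acts on classes modulo null sets, and a change of G on a null set
    enters [Lhat] through integrals in the added point; that the class is unaffected is read off
    from the norm bound itself, applied to a null difference. And a finite set has no canonical
    order, so sums over subsets are rewritten as sums over the splits of a list: these are defined
    by recursion, which turns measurability and Fubini arguments into inductions on the number of
    points. Step counts are powers of two so that consecutive approximants differ by replacing each
    step with two half steps, a single product of two resolvents. *)

Definition rnorm (x : X) : R := complex.Re `|x|.

(** The norm over [R[i]] takes values in [R[i]]; being nonnegative it is real, so its real part
    loses nothing and every estimate can be carried out in [R]. *)
Lemma rnormE x : `|x| = ((rnorm x)%:C)%C.
Proof. by rewrite /rnorm RRe_real//; exact/ger0_real/normr_ge0. Qed.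

Lemma rnorm_ge0 x : 0 <= rnorm x.
Proof. by rewrite -lecR -rnormE; exact: normr_ge0. Qed.

Lemma rnorm0 : rnorm 0 = 0.
Proof. by rewrite /rnorm normr0. Qed.

Lemma rnorm0_eq0 x : rnorm x = 0 -> x = 0.
Proof. by move=> x0; apply/normr0_eq0; rewrite rnormE x0. Qed.

Lemma ler_rnormD x y : rnorm (x + y) <= rnorm x + rnorm y.
Proof. by rewrite -lecR rmorphD/= -!rnormE ler_normD. Qed.

Lemma rnormZ a x : rnorm (a *: x) = normc a * rnorm x.
Proof.
apply: (@complexI R); rewrite -rnormE normrZ rmorphM/= -rnormE.
by [].
Qed.

Lemma rnormN x : rnorm (- x) = rnorm x.
Proof. by rewrite /rnorm normrN. Qed.

Lemma rnormB x y : rnorm (x - y) = rnorm (y - x).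
Proof. by rewrite -rnormN opprB. Qed.

Lemma ler_rnormB x y : rnorm (x - y) <= rnorm x + rnorm y.
Proof. by rewrite -(rnormN y) ler_rnormD. Qed.

Lemma ler_rnorm_dist y x z : rnorm (x - z) <= rnorm (x - y) + rnorm (y - z).
Proof. by rewrite -[x - z](subrKA y) ler_rnormD. Qed.

Lemma normc_ge0 (z : R[i]) : 0 <= normc z.
Proof. by case: z => a b; exact: sqrtr_ge0. Qed.

Lemma normc_real (r : R) : normc (r%:C)%C = `|r|.
Proof. by rewrite /= expr0n/= addr0 sqrtr_sqr. Qed.

Lemma ler_Re_normc (z : R[i]) : complex.Re z <= normc z.
Proof.
case: z => a b /=; apply: (le_trans (ler_norm _)).
by rewrite -sqrtr_sqr ler_wsqrtr// lerDl sqr_ge0.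
Qed.

Lemma cvg_rnormP {T : Type} (F : set_system T) {FF : Filter F} (f : T -> X) l :
  f x @[x --> F] --> l <->
  forall e : R, 0 < e -> \forall x \near F, rnorm (f x - l) <= e.
Proof.
split => [/cvgrPdist_le fl e e0|fl].
  have /fl : 0 < ((e%:C)%C : R[i]) by rewrite ltcR.
  by apply: filterS => x; rewrite rnormE lecR rnormB.
apply/cvgrPdist_le => e e0.
have eE : e = ((complex.Re e)%:C)%C by rewrite RRe_real// gtr0_real.
have /fl : 0 < complex.Re e by rewrite -ltcR -eE.
by apply: filterS => x; rewrite rnormE eE lecR rnormB.
Qed.

Lemma exp2_small (c e : R) : 0 < e ->
  exists N, forall n, (N <= n)%N -> c * 2^-1 ^+ n <= e.
Proof.
move=> e0; have h1 : `|2^-1 : R| < 1 by rewrite gtr0_norm// invf_lt1// ltr1n.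
have /cvgrPdist_le/(_ _ e0)[N _ hN] := @cvg_geometric R c _ h1.
exists N => n /hN /=; rewrite sub0r normrN; exact/le_trans/ler_norm.
Qed.

Definition seqlim (u : nat -> X) l :=
  forall e : R, 0 < e -> exists N, forall n, (N <= n)%N -> rnorm (u n - l) <= e.

Lemma seqlim_uniq u l l' : seqlim u l -> seqlim u l' -> l = l'.
Proof.
move=> ul ul'; apply/eqP; rewrite -subr_eq0; apply/eqP/rnorm0_eq0/eqP.
rewrite eq_le rnorm_ge0 andbT; apply/ler_addgt0Pr => e e0; rewrite add0r.
have e2 : 0 < e / 2 by rewrite divr_gt0.
have [N hN] := ul _ e2; have [N' hN'] := ul' _ e2.
have := hN (N + N')%N (leq_addr _ _); have := hN' (N + N')%N (leq_addl _ _).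
have := ler_rnorm_dist (u (N + N')%N) l l'.
rewrite [rnorm (l - u _)]rnormB; lra.
Qed.

Lemma seqlim_cst l : seqlim (fun=> l) l.
Proof. by move=> e e0; exists 0%N => n _; rewrite subrr rnorm0 ltW. Qed.

Lemma seqlim_le (u v : nat -> X) l m (c : R) : 0 <= c ->
  (forall n, rnorm (u n - l) <= c * rnorm (v n - m)) -> seqlim v m -> seqlim u l.
Proof.
move=> c0 uv vm e e0; have c1 : 0 < 1 + c by rewrite ltr_wpDr.
have [|N hN] := vm (e / (1 + c)); first by rewrite divr_gt0.
exists N => n /hN h; apply: (le_trans (uv n)).
apply: (le_trans (ler_wpM2l c0 h)).
rewrite mulrCA ler_piMr ?ltW//.
by rewrite ltr_pdivrMr// mul1r ltrDr.
Qed.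

Lemma seqlimD u v l m : seqlim u l -> seqlim v m ->
  seqlim (fun n => u n + v n) (l + m).
Proof.
move=> ul vm e e0; have e2 : 0 < e / 2 by rewrite divr_gt0.
have [N hN] := ul _ e2; have [N' hN'] := vm _ e2.
exists (maxn N N') => n; rewrite geq_max => /andP[/hN h1 /hN' h2].
rewrite opprD addrACA; apply: (le_trans (ler_rnormD _ _)); lra.
Qed.

Lemma seqlimZ a u l : seqlim u l -> seqlim (fun n => a *: u n) (a *: l).
Proof.
apply: seqlim_le (normc_ge0 a) _ => n.
by rewrite -scalerBr rnormZ.
Qed.

Lemma seqlimB u v l m : seqlim u l -> seqlim v m ->
  seqlim (fun n => u n - v n) (l - m).
Proof.
move=> ul vm; apply: seqlimD => //.
by apply: (seqlim_le ler01 _ vm) => n; rewrite mul1r -opprD rnormN.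
Qed.

(** The error [d * 2^-1 ^+ n] vanishes in the limit; it will absorb the discretisation error of the
    Euler scheme. *)
Lemma seqlim_norm_le u l (c d : R) : seqlim u l ->
  (forall n, rnorm (u n) <= c + d * 2^-1 ^+ n) -> rnorm l <= c.
Proof.
move=> ul uc; apply/ler_addgt0Pr => e e0.
have e2 : 0 < e / 2 by rewrite divr_gt0.
have [N hN] := ul _ e2; have [N' hN'] := exp2_small d e2.
have := hN (N + N')%N (leq_addr _ _); have := hN' (N + N')%N (leq_addl _ _).
have := uc (N + N')%N; have := ler_rnorm_dist (u (N + N')%N) l 0.
rewrite !subr0 [rnorm (l - u _)]rnormB; lra.
Qed.

Lemma seqlim_norm_lec u l (c : R) : seqlim u l ->
  (forall n, rnorm (u n) <= c) -> rnorm l <= c.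
Proof.
by move=> ul uc; apply: (seqlim_norm_le (d := 0) ul) => n; rewrite mul0r addr0.
Qed.

Lemma seqlim_exp2 u l (c : R) : (forall n, rnorm (u n - l) <= c * 2^-1 ^+ n) ->
  seqlim u l.
Proof.
move=> uc e e0; have [N hN] := exp2_small c e0.
by exists N => n /hN; exact: le_trans.
Qed.

(** Comparison with the single term [u N] is equivalent to the two-index condition, at the price of
    a factor 2 in [e]. *)
Definition seqcauchy (u : nat -> X) := forall e : R, 0 < e ->
  exists N, forall n, (N <= n)%N -> rnorm (u n - u N) <= e.

Definition seqcomplete := forall u, seqcauchy u -> exists l, seqlim u l.

Lemma seqcauchy_geo u (c q : R) : 0 <= q < 1 ->
  (forall n, rnorm (u n.+1 - u n) <= c * q ^+ n) -> seqcauchy u.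
Proof.
move=> /andP[q0 q1] uc e e0; have q10 : 0 < 1 - q by rewrite subr_gt0.
have c0 : 0 <= c.
  by have := uc 0%N; rewrite expr0 mulr1; apply: le_trans; exact: rnorm_ge0.
have qn : `|q| < 1 by rewrite ger0_norm.
have /cvgrPdist_le/(_ _ e0)[N _ hN] := @cvg_geometric R (c / (1 - q)) _ qn.
exists N => n Nn; apply: le_trans (hN N (leqnn _)).
rewrite sub0r normrN; apply: le_trans (ler_norm _) => /=.
(* The geometric sum is kept exact, with the subtracted term [q ^+ (N + k)], so that the majorants
   match with equality in the induction step. *)
have H k : rnorm (u (N + k)%N - u N) <=
    c / (1 - q) * q ^+ N - c / (1 - q) * q ^+ (N + k).
  elim: k => [|k ih]; first by rewrite addn0 !subrr rnorm0.
  rewrite addnS; apply: (le_trans (ler_rnorm_dist (u (N + k)%N) _ _)).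
  apply: (le_trans (lerD (uc _) ih)).
  rewrite le_eqVlt; apply/orP; left; apply/eqP.
  rewrite exprS; field; lra.
rewrite -(subnKC Nn); apply: (le_trans (H _)).
by rewrite gerBl mulr_ge0 ?exprn_ge0// divr_ge0// ltW.
Qed.

End real_norm.

(** * Iterates of commuting linear contractions *)

Section linear_maps.
Context (R : realType) (X : normedModType R[i]).
Local Notation normc := ComplexField.Normc.normc.
Implicit Types P Q : X -> X.

Lemma linear_fun0 P : linear P -> P 0 = 0.
Proof. by move=> /(_ (-1) 0 0); rewrite scaleN1r oppr0 addr0 scaleN1r addNr. Qed.

Lemma linear_funD P x y : linear P -> P (x + y) = P x + P y.
Proof. by move=> /(_ 1 x y); rewrite !scale1r. Qed.

Lemma linear_funZ P a x : linear P -> P (a *: x) = a *: P x.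
Proof. by move=> lP; have := lP a x 0; rewrite !addr0 linear_fun0// addr0. Qed.

Lemma linear_funB P x y : linear P -> P (x - y) = P x - P y.
Proof.
by move=> lP; rewrite linear_funD// -scaleN1r linear_funZ// scaleN1r.
Qed.

Lemma iter_linear P n : linear P -> linear (iter n P).
Proof. by move=> lP; elim: n => // n ih a x y /=; rewrite ih lP. Qed.

Lemma iter_contr P n x : (forall x, rnorm (P x) <= rnorm x) ->
  rnorm (iter n P x) <= rnorm x.
Proof. by move=> cP; elim: n => //= n; apply: le_trans. Qed.

Lemma iter_comm P Q n x : (forall x, P (Q x) = Q (P x)) ->
  iter n P (Q x) = Q (iter n P x).
Proof. by move=> PQ; elim: n => //= n ->; rewrite PQ. Qed.

Lemma iter_comp P Q n x : (forall x, P (Q x) = Q (P x)) ->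
  iter n (P \o Q) x = iter n P (iter n Q x).
Proof.
by move=> PQ; elim: n => //= n ->; rewrite (iter_comm _ _ PQ).
Qed.

(** Telescoping: the difference is a sum of [n] terms of the form P^i Q^j (P x - Q x), thanks to
    commutation, and each is at most [rnorm (P x - Q x)] since both maps are contractions. *)
Lemma iter_dist P Q n x :
  linear P -> linear Q ->
  (forall x, rnorm (P x) <= rnorm x) -> (forall x, rnorm (Q x) <= rnorm x) ->
  (forall x, P (Q x) = Q (P x)) ->
  rnorm (iter n P x - iter n Q x) <= n%:R * rnorm (P x - Q x).
Proof.
move=> lP lQ cP cQ PQ; elim: n x => [|n ih] x; first by rewrite subrr rnorm0 mul0r.
rewrite !iterSr; apply: (le_trans (ler_rnorm_dist (iter n P (Q x)) _ _)).
rewrite -natr1 mulrDl mul1r addrC lerD//.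
  apply: (le_trans (ih _)); rewrite PQ -linear_funB//.
  by apply: ler_wpM2l => //; exact: cQ.
by rewrite -linear_funB; [exact: iter_contr|exact: iter_linear].
Qed.

End linear_maps.

(** * Dissipative operators on a sector *)

Lemma subrACA (V : zmodType) (x y z t : V) : (x - y) - (z - t) = (x - z) - (y - t).
Proof. by rewrite opprB [t - z]addrC addrACA opprB [t - y]addrC. Qed.

Section dissipative_cone.
Context (R : realType) (X : normedModType R[i]).
Local Notation normc := ComplexField.Normc.normc.
Variables (Dom : set X) (A : X -> X) (kappa : R).

(** The closed sector |arg z| <= pi/3, vertex included, as cos(pi/3) = 1/2; a convex cone. *)
Definition cone (z : R[i]) := normc z <= 2 * complex.Re z.

Lemma cone0 : cone 0.
Proof. by rewrite /cone ComplexField.Normc.normc0 mulr0. Qed.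

Lemma coneD z w : cone z -> cone w -> cone (z + w).
Proof.
rewrite /cone raddfD/= mulrDr => hz hw.
by apply: (le_trans (le_normcD _ _)); exact: lerD.
Qed.

Lemma coneZ (r : R) z : 0 <= r -> cone z -> cone ((r%:C)%C * z).
Proof.
move=> r0; rewrite /cone ComplexField.Normc.normcM normc_real ger0_norm//.
have -> : complex.Re ((r%:C)%C * z) = r * complex.Re z.
  by case: z => a b /=; rewrite mul0r subr0.
by rewrite mulrCA; exact: ler_wpM2l.
Qed.

Lemma cone_real (r : R) : 0 <= r -> cone (r%:C)%C.
Proof. by move=> r0; rewrite /cone normc_real ger0_norm//= ler_peMl// ler1n. Qed.

Hypothesis complX : seqcomplete X.
Hypothesis kappa_gt0 : 0 < kappa.
Hypothesis Dom0 : Dom 0.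
Hypothesis DomL : forall a x y, Dom x -> Dom y -> Dom (a *: x + y).
Hypothesis AL : forall a x y, Dom x -> Dom y -> A (a *: x + y) = a *: A x + A y.
Hypothesis Dom_dense : forall x (e : R), 0 < e -> exists2 y, Dom y & rnorm (y - x) <= e.
Hypothesis A_surj : forall z f, cone z -> z != 0 -> exists2 x, Dom x & x - z *: A x = f.
Hypothesis A_diss : forall z x, cone z -> Dom x ->
  rnorm x + kappa * normc z * rnorm (A x) <= rnorm (x - z *: A x).

Lemma dom_scale a x : Dom x -> Dom (a *: x).
Proof. by move=> Dx; rewrite -[_ *: _]addr0; exact: DomL. Qed.

Lemma op0 : A 0 = 0.
Proof. by have := AL (-1) Dom0 Dom0; rewrite scaler0 addr0 scaleN1r addNr. Qed.

Lemma op_scale a x : Dom x -> A (a *: x) = a *: A x.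
Proof.
by move=> Dx; have := AL a Dx Dom0; rewrite !addr0 op0 addr0.
Qed.

Lemma dom_sub x y : Dom x -> Dom y -> Dom (x - y).
Proof. by move=> Dx Dy; rewrite addrC -scaleN1r; exact: DomL. Qed.

Lemma op_sub x y : Dom x -> Dom y -> A (x - y) = A x - A y.
Proof. by move=> Dx Dy; rewrite addrC -scaleN1r AL// scaleN1r addrC. Qed.

(** The inverse of 1 - z A. The default [f] of [xget] makes [J 0] the identity, also off [Dom], so
    that the facts below hold at the vertex of the cone too. *)
Definition resolvent z f := xget f [set x | Dom x /\ x - z *: A x = f].
Local Notation J := resolvent.

Lemma resolvent0 x : J 0 x = x.
Proof.
rewrite /J; case: xgetP => [y _ /= [_]|//].
by rewrite scale0r subr0.
Qed.

Lemma resolvent_dom z x : cone z -> z != 0 -> Dom (J z x).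
Proof.
move=> Kz z0; rewrite /J; case: xgetP => [y _ [] //|].
by have [y Dy yx] := A_surj x Kz z0; move=> /(_ y) [].
Qed.

Lemma resolventE z x : cone z -> J z x - z *: A (J z x) = x.
Proof.
move=> Kz; have [->|z0] := eqVneq z 0; first by rewrite resolvent0 scale0r subr0.
rewrite /J; case: xgetP => [y _ [] //|].
by have [y Dy yx] := A_surj x Kz z0; move=> /(_ y) [].
Qed.

Lemma resolvent_stable z x : cone z -> Dom x -> Dom (J z x).
Proof.
move=> Kz Dx; have [->|z0] := eqVneq z 0; first by rewrite resolvent0.
exact: resolvent_dom.
Qed.

Lemma op_inj z x : cone z -> Dom x -> x - z *: A x = 0 -> x = 0.
Proof.
move=> Kz Dx x0; apply/rnorm0_eq0/eqP; rewrite eq_le rnorm_ge0 andbT.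
have := A_diss Kz Dx; rewrite x0 rnorm0; apply: le_trans.
by rewrite lerDl !mulr_ge0 ?rnorm_ge0 ?normc_ge0// ltW.
Qed.

Lemma resolvent_uniq z x y : cone z -> Dom x -> x - z *: A x = y -> J z y = x.
Proof.
move=> Kz Dx xy; have [z0|z0] := eqVneq z 0.
  by move: xy; rewrite z0 resolvent0 scale0r subr0.
have DJ := resolvent_dom y Kz z0; have JE := resolventE y Kz.
apply/eqP; rewrite -subr_eq0; apply/eqP/(op_inj Kz); first exact: dom_sub.
by rewrite op_sub// scalerBr subrACA JE xy subrr.
Qed.

Lemma resolvent_linear z : cone z -> linear (J z).
Proof.
move=> Kz a x y; have [->|z0] := eqVneq z 0; first by rewrite !resolvent0.
have [Dx Dy] := (resolvent_dom x Kz z0, resolvent_dom y Kz z0).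
apply: resolvent_uniq => //; first exact: DomL.
rewrite AL// scalerDr opprD addrACA resolventE// scalerA mulrC -scalerA -scalerBr.
by rewrite resolventE.
Qed.

Lemma resolvent_dissip z x : cone z ->
  rnorm (J z x) + kappa * normc z * rnorm (A (J z x)) <= rnorm x.
Proof.
move=> Kz; have [->|z0] := eqVneq z 0.
  by rewrite ComplexField.Normc.normc0 mulr0 mul0r addr0 resolvent0.
rewrite -[in leRHS](resolventE x Kz); apply: A_diss => //.
exact: resolvent_dom.
Qed.

Lemma resolvent_contr z x : cone z -> rnorm (J z x) <= rnorm x.
Proof.
move=> Kz; apply: le_trans (resolvent_dissip x Kz).
by rewrite lerDl !mulr_ge0 ?rnorm_ge0 ?normc_ge0// ltW.
Qed.

Lemma resolvent_op z x : cone z -> z *: A (J z x) = J z x - x.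
Proof.
by move=> Kz; rewrite -[X in _ - X](resolventE x Kz) opprB addrCA subrr addr0.
Qed.

Lemma resolvent_opC z x : cone z -> Dom x -> A (J z x) = J z (A x).
Proof.
move=> Kz Dx; have [->|z0] := eqVneq z 0; first by rewrite !resolvent0.
have DJ := resolvent_dom x Kz z0.
have zAE := resolvent_op x Kz.
(* [A (J z x)] equals [z^-1] times [J z x - x], a difference of two elements of [Dom]. *)
have DA : Dom (A (J z x)).
  rewrite -[A _]scale1r -(mulVf z0) -scalerA zAE.
  by apply: dom_scale; exact: dom_sub.
apply/esym/resolvent_uniq => //.
by rewrite -op_scale// -op_sub//; [rewrite resolventE|exact: dom_scale].
Qed.

(** On [Dom] the operator [A] commutes with [J z]; hence [J z (J w x)] solves the equation that
    characterises [J w (J z x)]. *)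
Lemma resolvent_comm z w x : cone z -> cone w -> J z (J w x) = J w (J z x).
Proof.
move=> Kz Kw; have [->|z0] := eqVneq z 0; first by rewrite !resolvent0.
have [->|w0] := eqVneq w 0; first by rewrite !resolvent0.
have Dv := resolvent_dom x Kw w0.
apply/esym/resolvent_uniq => //; first exact: resolvent_stable.
have lz := resolvent_linear Kz.
by rewrite resolvent_opC// -linear_funZ// -linear_funB// resolventE.
Qed.

Lemma resolvent_lip z x : cone z -> Dom x ->
  rnorm (J z x - x) <= normc z * rnorm (A x).
Proof.
move=> Kz Dx; rewrite -resolvent_op// rnormZ ler_wpM2l ?normc_ge0//.
by rewrite resolvent_opC// resolvent_contr.
Qed.

(** The resolvent identity, written on [Dom] without dividing by the parameters, so that [u = 0] is
    covered. *)
Lemma resolvent_diff u h y : cone u -> cone (u + h) -> Dom y ->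
  J (u + h) y - J u y = h *: J (u + h) (J u (A y)).
Proof.
move=> Ku Kuh Dy; have Dv := resolvent_stable Ku Dy.
have lin := resolvent_linear Kuh.
have -> : J u y = J (u + h) (y - h *: J u (A y)).
  apply/esym/resolvent_uniq => //.
  by rewrite scalerDl opprD addrA resolventE// resolvent_opC.
by rewrite linear_funB// opprB addrCA subrr addr0 linear_funZ.
Qed.

Definition dom2 x := Dom x /\ Dom (A x).

(** From (1 - a A)(1 - b A) = 1 - (a + b) A + a b A^2, the vector [y = J a (J b x)] solves the
    equation of [J (a + b)] with right-hand side x - a b A^2 y; the resolvents commute with A^2 and
    are contractions. *)
Lemma resolvent_mul a b x : cone a -> cone b -> dom2 x ->
  rnorm (J a (J b x) - J (a + b) x) <= normc a * normc b * rnorm (A (A x)).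
Proof.
move=> Ka Kb [Dx DAx]; set y := J a (J b x); have Kab := coneD Ka Kb.
have [Db Db'] := (resolvent_stable Kb Dx, resolvent_stable Kb DAx).
have [Dy Dy'] := (resolvent_stable Ka Db, resolvent_stable Ka Db').
have Ay : A y = J a (J b (A x)) by rewrite /y !resolvent_opC.
have AAy : A (A y) = J a (J b (A (A x))) by rewrite Ay !resolvent_opC.
have lin := resolvent_linear Kab.
have -> : y = J (a + b) (x - (a * b) *: A (A y)).
  apply/esym/resolvent_uniq => //.
  have h1 : y - a *: A y = J b x by exact: resolventE.
  have := resolventE x Kb; rewrite -h1 op_sub//; last first.
    by apply: dom_scale; rewrite Ay.
  rewrite op_scale ?Ay// -Ay => /esym ->.
  rewrite scalerBr scalerA [b * a]mulrC opprB addrA [RHS]addrAC addrK.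
  by rewrite scalerDl opprD addrA.
rewrite linear_funB// addrAC subrr add0r rnormN linear_funZ// rnormZ.
rewrite ComplexField.Normc.normcM ler_wpM2l ?mulr_ge0 ?normc_ge0//.
apply: (le_trans (resolvent_contr _ Kab)); rewrite AAy.
by do 2 apply: (le_trans (resolvent_contr _ _)) => //.
Qed.

(** * Backward Euler approximations with dyadic step sizes *)

Definition dyadic k (z : R[i]) : R[i] := ((2^-1 ^+ k)%:C)%C * z.

Lemma cone_dyadic k z : cone z -> cone (dyadic k z).
Proof. by apply: coneZ; rewrite exprn_ge0. Qed.

Lemma normc_dyadic k z : normc (dyadic k z) = 2^-1 ^+ k * normc z.
Proof. by rewrite ComplexField.Normc.normcM normc_real ger0_norm// exprn_ge0. Qed.

Lemma dyadicD k z w : dyadic k (z + w) = dyadic k z + dyadic k w.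
Proof. exact: mulrDr. Qed.

Lemma dyadicS k z : dyadic k z = dyadic k.+1 z + dyadic k.+1 z.
Proof.
rewrite /dyadic -mulrDl -rmorphD/= exprS -mulrDl.
by congr ((_ %:C)%C * _); field.
Qed.

Lemma exp2_dyadic k : (2 ^ k)%:R * 2^-1 ^+ k = 1 :> R.
Proof. by rewrite natrX -exprMn mulfV ?expr1n// pnatr_eq0. Qed.

(** The backward Euler approximation of exp(z A) with [2 ^ k] equal steps. *)
Definition euler k z : X -> X := iter (2 ^ k) (J (dyadic k z)).
Local Notation E := euler.

Lemma euler_linear k z : cone z -> linear (E k z).
Proof. by move=> Kz; apply/iter_linear/resolvent_linear/cone_dyadic. Qed.

Lemma euler_contr k z x : cone z -> rnorm (E k z x) <= rnorm x.
Proof.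
by move=> Kz; apply: iter_contr => y; exact/resolvent_contr/cone_dyadic.
Qed.

Lemma iter_resolvent_stable n z x : cone z -> Dom x -> Dom (iter n (J z) x).
Proof. by move=> Kz Dx; elim: n => //= n; exact: resolvent_stable. Qed.

Lemma iter_resolvent_opC n z x : cone z -> Dom x ->
  A (iter n (J z) x) = iter n (J z) (A x).
Proof.
move=> Kz Dx; elim: n => //= n ih.
by rewrite resolvent_opC// ?ih//; exact: iter_resolvent_stable.
Qed.

(** The norm of [A] along the iterates decreases, since [A] commutes with the contraction [J z]. So
    each of the [n] gains given by the dissipation estimate is at least the last one, and together
    they cost at most [rnorm x]. The induction carries the remaining norm of the iterate along. *)
Lemma iter_resolvent_smoothing n z x : cone z -> Dom x ->
  n%:R * (kappa * normc z) * rnorm (A (iter n (J z) x)) <= rnorm x.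
Proof.
move=> Kz Dx; have k0 : 0 <= kappa * normc z by rewrite mulr_ge0 ?normc_ge0// ltW.
suff: rnorm (iter n (J z) x) +
    n%:R * (kappa * normc z) * rnorm (A (iter n (J z) x)) <= rnorm x.
  by apply: le_trans; rewrite lerDr rnorm_ge0.
elim: n => [|n ih]; first by rewrite !mul0r addr0.
apply: le_trans ih; rewrite iterS; set y := iter n _ _.
have Dy : Dom y by exact: iter_resolvent_stable.
have h1 := resolvent_dissip y Kz.
have h2 : rnorm (A (J z y)) <= rnorm (A y).
  by rewrite resolvent_opC//; exact: resolvent_contr.
have h3 : n%:R * (kappa * normc z) * rnorm (A (J z y)) <=
    n%:R * (kappa * normc z) * rnorm (A y) by apply: ler_wpM2l => //; rewrite mulr_ge0.
by rewrite -natr1 2!mulrDl mul1r addrCA addrC; apply: lerD.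
Qed.

(** The [2 ^ k] steps compensate the step size [2^-1 ^+ k], so the bound does not depend on [k] and
    survives in the limit. *)
Lemma euler_smoothing k z x : cone z -> Dom x ->
  kappa * normc z * rnorm (E k z (A x)) <= rnorm x.
Proof.
move=> Kz Dx; have Kk := cone_dyadic k Kz.
have := iter_resolvent_smoothing (2 ^ k) Kk Dx.
rewrite normc_dyadic iter_resolvent_opC// -/(E k z _); have := exp2_dyadic k.
set N := _%:R; set q := _ ^+ k => Nq; set r := rnorm _.
have -> : N * (kappa * (q * normc z)) * r = N * q * (kappa * normc z * r) by ring.
by rewrite Nq mul1r.
Qed.

(** Each of the [2 ^ k] steps costs |z| |w| 4^-k by [resolvent_mul], hence a total of order 2^-k:
    the scheme becomes multiplicative in the limit. *)
Lemma euler_mul k z w x : cone z -> cone w -> dom2 x ->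
  rnorm (E k z (E k w x) - E k (z + w) x) <=
  normc z * normc w * rnorm (A (A x)) * 2^-1 ^+ k.
Proof.
move=> Kz Kw Dx; have [Kzk Kwk] := (cone_dyadic k Kz, cone_dyadic k Kw).
have cJ y := resolvent_comm y Kzk Kwk.
have Kzwk := coneD Kzk Kwk.
rewrite /euler dyadicD -(iter_comp _ _ cJ).
apply: (le_trans (iter_dist _ _ _ _ _ _ _)) => /=.
- by move=> a y1 y2 /=; rewrite !resolvent_linear.
- exact: resolvent_linear.
- by move=> y; do 2 apply: (le_trans (resolvent_contr _ _)) => //.
- by move=> y; exact: resolvent_contr.
- by move=> y; rewrite (resolvent_comm y Kwk Kzwk) (resolvent_comm _ Kzk Kzwk).
apply: (le_trans (ler_wpM2l _ (resolvent_mul Kzk Kwk Dx))) => //.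
rewrite !normc_dyadic le_eqVlt; apply/orP; left; apply/eqP.
have := exp2_dyadic k; set N := _%:R; set q := _ ^+ k => Nq.
by transitivity (N * q * (normc z * normc w * rnorm (A (A x)) * q)); [ring|rewrite Nq mul1r].
Qed.

(** Two steps of size z / 2^(k+1) are compared with one step of size z / 2^k. The bound is summable
    in [k], so the approximants are Cauchy on [dom2]. *)
Lemma eulerS_dist k z x : cone z -> dom2 x ->
  rnorm (E k.+1 z x - E k z x) <= normc z ^+ 2 * rnorm (A (A x)) * 2^-1 ^+ k.
Proof.
move=> Kz Dx; have Kzk := cone_dyadic k.+1 Kz; have Kzk' := cone_dyadic k Kz.
have cJ y := resolvent_comm y Kzk Kzk.
have EE : E k.+1 z x = iter (2 ^ k) (J (dyadic k.+1 z) \o J (dyadic k.+1 z)) x.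
  by rewrite (iter_comp _ _ cJ) -iterD addnn -mul2n -expnS.
rewrite EE; apply: (le_trans (iter_dist _ _ _ _ _ _ _)) => /=.
- by move=> a y1 y2 /=; rewrite !resolvent_linear.
- exact: resolvent_linear.
- by move=> y; do 2 apply: (le_trans (resolvent_contr _ _)) => //.
- by move=> y; exact: resolvent_contr.
- by move=> y; rewrite (resolvent_comm y Kzk Kzk') (resolvent_comm _ Kzk Kzk').
rewrite (dyadicS k).
apply: (le_trans (ler_wpM2l _ (resolvent_mul Kzk Kzk Dx))) => //.
rewrite !normc_dyadic.
have := exp2_dyadic k; rewrite exprS; set N := _%:R; set q := _ ^+ k => Nq.
have -> : N * (2^-1 * q * normc z * (2^-1 * q * normc z) * rnorm (A (A x))) =
  2^-1 * 2^-1 * (N * q) * (normc z ^+ 2 * rnorm (A (A x)) * q) by ring.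
rewrite Nq mulr1; apply: ler_piMl; last lra.
by rewrite !mulr_ge0 ?rnorm_ge0 ?exprn_ge0 ?normc_ge0.
Qed.

Lemma resolvent_cvg x e : 0 < e -> exists s : R, [/\ 0 < s, cone (s%:C)%C &
  rnorm (J (s%:C)%C x - x) <= e].
Proof.
move=> e0; have e3 : 0 < e / 3 by rewrite divr_gt0.
have [y Dy yx] := Dom_dense x e3.
have Ay : 0 < rnorm (A y) + 1 by rewrite ltr_wpDl// rnorm_ge0.
(* The added 1 keeps the denominator positive when [A y] vanishes. *)
pose s := e / 3 / (rnorm (A y) + 1); have s0 : 0 < s by rewrite divr_gt0.
have Ks : cone (s%:C)%C by apply: cone_real; exact: ltW.
exists s; split => //.
have h1 := resolvent_lip Ks Dy; rewrite normc_real gtr0_norm// in h1.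
have h2 : s * rnorm (A y) <= e / 3.
  by rewrite mulrAC ler_pdivrMr// ler_wpM2l ?lerDl ?(ltW e3)//.
have h3 := resolvent_contr (y - x) Ks.
rewrite linear_funB in h3; last exact: resolvent_linear.
have h4 := ler_rnorm_dist (J (s%:C)%C y) (J (s%:C)%C x) x.
have h5 := ler_rnorm_dist y (J (s%:C)%C y) x.
have h6 := rnormB (J (s%:C)%C x) (J (s%:C)%C y); lra.
Qed.

Lemma dom2_resolvent s x : cone (s%:C)%C -> 0 < s -> Dom x ->
  dom2 (J (s%:C)%C x).
Proof.
move=> Ks s0 Dx; have s1 : (s%:C)%C != 0 :> R[i] by rewrite (fmorph_eq0 (real_complex R)) gt_eqF.
split; first exact: resolvent_dom.
by rewrite resolvent_opC//; exact: resolvent_dom.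
Qed.

(** A resolvent maps [Dom] into [dom2] and, for a small real parameter, moves a given vector very
    little. *)
Lemma dom2_dense x e : 0 < e -> exists2 y, dom2 y & rnorm (y - x) <= e.
Proof.
move=> e0; have e2 : 0 < e / 2 by rewrite divr_gt0.
have [y Dy yx] := Dom_dense x e2.
have [s [s0 Ks sy]] := resolvent_cvg y e2.
exists (J (s%:C)%C y); first exact: dom2_resolvent.
have := ler_rnorm_dist y (J (s%:C)%C y) x; lra.
Qed.

Lemma seqlim_dense (u : nat -> X -> X) (D : set X) :
  (forall x e, 0 < e -> exists2 y, D y & rnorm (y - x) <= e) ->
  (forall n x y, rnorm (u n x - u n y) <= rnorm (x - y)) ->
  (forall y, D y -> seqcauchy (u ^~ y)) ->
  forall x, seqcauchy (u ^~ x).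
Proof.
move=> dD cu uD x e e0; have e3 : 0 < e / 3 by rewrite divr_gt0.
have [y Dy yx] := dD x _ e3; have [N hN] := uD y Dy _ e3.
exists N => n /hN h; have h1 := cu n x y; have h2 := cu N y x.
have h3 := ler_rnorm_dist (u n y) (u n x) (u N x).
have h4 := ler_rnorm_dist (u N y) (u n y) (u N x).
rewrite (rnormB x y) in h1; lra.
Qed.

Lemma euler_cauchy z x : cone z -> seqcauchy (fun k => E k z x).
Proof.
move=> Kz; move: x.
apply: (@seqlim_dense (fun k => E k z) dom2); first exact: dom2_dense.
  move=> n x y; rewrite -linear_funB; last exact: euler_linear.
  exact: euler_contr.
move=> y Dy; apply: seqcauchy_geo (fun k => eulerS_dist k Kz Dy).
by rewrite invr_ge0 ler0n invf_lt1// ltr1n.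
Qed.

(** * The limit family: semigroup law, smoothing and Taylor estimate *)

Definition eulerlim z x := xget x [set l | seqlim (fun k => E k z x) l].
Local Notation T := eulerlim.

Lemma eulerlimP z x : cone z -> seqlim (fun k => E k z x) (T z x).
Proof.
move=> Kz; rewrite /T; case: xgetP => [l _ //|].
have [l hl] := complX (euler_cauchy x Kz).
by move=> /(_ l).
Qed.

Lemma eulerlimE z x l : cone z -> seqlim (fun k => E k z x) l -> T z x = l.
Proof. by move=> Kz; apply: seqlim_uniq; exact: eulerlimP. Qed.

Lemma eulerlim_linear z : cone z -> linear (T z).
Proof.
move=> Kz a x y; apply: eulerlimE => //.
have -> : (fun k => E k z (a *: x + y)) = (fun k => a *: E k z x + E k z y).
  by apply/funext => k; exact: euler_linear.
by apply: seqlimD; [apply: seqlimZ|]; exact: eulerlimP.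
Qed.

Lemma eulerlim_contr z x : cone z -> rnorm (T z x) <= rnorm x.
Proof.
move=> Kz; apply: (seqlim_norm_lec (eulerlimP x Kz)) => n.
exact: euler_contr.
Qed.

Lemma eulerlim_dist z x y : cone z -> rnorm (T z x - T z y) <= rnorm (x - y).
Proof.
move=> Kz; rewrite -linear_funB; last exact: eulerlim_linear.
exact: eulerlim_contr.
Qed.

Lemma eulerlim0 x : T 0 x = x.
Proof.
apply: eulerlimE; first exact: cone0.
have -> : (fun k => E k 0 x) = fun=> x; last exact: seqlim_cst.
apply/funext => k; rewrite /euler /dyadic mulr0.
by elim: (2 ^ k)%N => //= n ->; rewrite resolvent0.
Qed.

(** The relation [u n = J 1 (u n - v n)] passes to the limit because [J 1] is a contraction, and the
    range of [J 1] lies in [Dom]. *)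
Lemma op_closed u v x y : (forall n, Dom (u n)) -> (forall n, A (u n) = v n) ->
  seqlim u x -> seqlim v y -> Dom x /\ A x = y.
Proof.
move=> Du Au ux vy; have K1 : cone (1%:C)%C by apply: cone_real.
have i1 : (1%:C)%C != 0 :> R[i] by rewrite oner_eq0.
have xE : x = J (1%:C)%C (x - y).
  apply: (seqlim_uniq ux).
  apply: (seqlim_le ler01 _ (seqlimB ux vy)) => n; rewrite mul1r.
  rewrite -{1}[u n](resolvent_uniq (y := u n - v n) K1) ?Au ?scale1r//.
  rewrite -linear_funB; first exact: resolvent_contr.
  exact: resolvent_linear.
have Dx : Dom x by rewrite xE; exact: resolvent_dom.
split => //; have := resolventE (x - y) K1.
by rewrite -xE scale1r => /addrI/oppr_inj.
Qed.

Lemma eulerlim_opC z x : cone z -> Dom x -> Dom (T z x) /\ A (T z x) = T z (A x).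
Proof.
move=> Kz Dx; have Kk n := cone_dyadic n Kz.
apply: (op_closed (u := fun k => E k z x) (v := fun k => E k z (A x))).
- by move=> n; exact: iter_resolvent_stable.
- by move=> n; exact: iter_resolvent_opC.
- exact: eulerlimP.
- exact: eulerlimP.
Qed.

Lemma dense_seq x : exists2 u : nat -> X, (forall n, Dom (u n)) & seqlim u x.
Proof.
have e0 n : 0 < 2^-1 ^+ n :> R by rewrite exprn_gt0.
have /choice[u hu] n : exists y, Dom y /\ rnorm (y - x) <= 2^-1 ^+ n.
  by have [y ? ?] := Dom_dense x (e0 n); exists y.
exists u => [n|]; first by have [] := hu n.
by apply: (@seqlim_exp2 _ _ _ _ 1) => n; rewrite mul1r; have [] := hu n.
Qed.

(** For [y] in [Dom] the uniform bound on the approximants controls [T z (A y)], which is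
    [A (T z y)]. A general [x] is a limit of such [y]; the images under [A] are then Cauchy, and
    closedness of [A] puts [T z x] in [Dom] with the same bound. *)
Lemma eulerlim_smoothing z x : cone z -> z != 0 ->
  Dom (T z x) /\ kappa * normc z * rnorm (A (T z x)) <= rnorm x.
Proof.
move=> Kz z0.
have c0 : 0 < kappa * normc z.
  rewrite mulr_gt0// lt_neqAle normc_ge0 andbT eq_sym.
  by apply: contra_neq z0; exact: ComplexField.Normc.eq0_normc.
have H y : Dom y -> rnorm (T z (A y)) <= (kappa * normc z)^-1 * rnorm y.
  move=> Dy; apply: (seqlim_norm_lec (eulerlimP (A y) Kz)) => n.
  by rewrite mulrC ler_pdivlMr// mulrC; exact: euler_smoothing.
have lin := eulerlim_linear Kz.
have [u Du ux] := dense_seq x.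
have [y vy] : exists y, seqlim (fun n => T z (A (u n))) y.
  apply: complX => e e0.
  have e2 : 0 < e / 2 by rewrite divr_gt0.
  (* The tolerance is multiplied by [kappa * normc z], the inverse of the Lipschitz constant in
     [H]. *)
  have [N hN] := ux _ (mulr_gt0 e2 c0).
  exists N => n Nn; rewrite -linear_funB// -op_sub//.
  apply: (le_trans (H _ (dom_sub _ _))) => //.
  rewrite mulrC ler_pdivrMr//.
  have := ler_rnorm_dist x (u n) (u N); rewrite (rnormB x (u N)).
  have := hN _ Nn; have := hN N (leqnn _); lra.
have Tux : seqlim (fun n => T z (u n)) (T z x).
  by apply: (seqlim_le ler01 _ ux) => n; rewrite mul1r eulerlim_dist.
have [|//|DT AT] := op_closed _ _ Tux vy.
- by move=> n; have [] := eulerlim_opC Kz (Du n).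
- by move=> n; have [] := eulerlim_opC Kz (Du n).
split => //; rewrite AT mulrC -ler_pdivlMr// mulrC.
apply/ler_addgt0Pr => e e0; have e2 : 0 < e / 2 by rewrite divr_gt0.
have e3 := mulr_gt0 e2 c0.
have [N hN] := ux _ e3; have [N' hN'] := vy _ e2.
have := hN _ (leq_addr N' N); have := hN' _ (leq_addl N N').
move: (N + N')%N => n {hN hN'} h1 h2.
have h3 := H _ (Du n); have := ler_rnorm_dist (T z (A (u n))) y 0.
have := ler_rnorm_dist x (u n) 0; rewrite !subr0 => h4.
rewrite (rnormB y) => h5.
apply: (le_trans h5); apply: (le_trans (lerD h1 h3)).
have : (kappa * normc z)^-1 * rnorm (u n) <=
    (kappa * normc z)^-1 * (e / 2 * (kappa * normc z) + rnorm x).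
  by apply: ler_wpM2l; [rewrite invr_ge0 ltW|lra].
rewrite mulrDr.
have -> : (kappa * normc z)^-1 * (e / 2 * (kappa * normc z)) = e / 2.
  by rewrite mulrC mulfK// gt_eqF.
move=> h6; lra.
Qed.

Lemma eulerlim_extensionality (P Q : X -> X) :
  (forall x y, rnorm (P x - P y) <= rnorm (x - y)) ->
  (forall x y, rnorm (Q x - Q y) <= rnorm (x - y)) ->
  (forall x, dom2 x -> P x = Q x) -> P =1 Q.
Proof.
move=> cP cQ PQ x; apply/eqP; rewrite -subr_eq0; apply/eqP/rnorm0_eq0/eqP.
rewrite eq_le rnorm_ge0 andbT; apply/ler_addgt0Pr => e e0; rewrite add0r.
have e2 : 0 < e / 2 by rewrite divr_gt0.
have [y Dy yx] := dom2_dense x e2.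
have := ler_rnorm_dist (P y) (P x) (Q x); rewrite {2}(PQ _ Dy).
have := cP x y; have := cQ y x; rewrite (rnormB x y); lra.
Qed.

Lemma eulerlimD z w x : cone z -> cone w -> T (z + w) x = T z (T w x).
Proof.
move=> Kz Kw; have Kzw := coneD Kz Kw.
apply: (@eulerlim_extensionality (T (z + w)) (T z \o T w)).
- by move=> {}x y; exact: eulerlim_dist.
- by move=> {}x y /=; apply: (le_trans (eulerlim_dist _ _ Kz)); exact: eulerlim_dist.
move=> {}x Dx; apply: eulerlimE => //=.
have h1 : seqlim (fun k => E k z (E k w x)) (T z (T w x)).
  (* The operators [E k z] are contractions uniformly in [k], so the inner limit may be taken before
     the outer one. *)
  have h2 : seqlim (fun k => E k z (E k w x) - E k z (T w x)) 0.
    apply: (seqlim_le ler01 _ (eulerlimP x Kw)) => n; rewrite mul1r subr0.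
    rewrite -linear_funB; last exact: euler_linear.
    exact: euler_contr.
  have := seqlimD h2 (eulerlimP (T w x) Kz); rewrite add0r.
  by apply: (seqlim_le ler01) => n; rewrite mul1r subrK.
have h3 : seqlim (fun k => E k z (E k w x) - E k (z + w) x) 0.
  by apply: seqlim_exp2 => k; rewrite subr0; exact: euler_mul.
have := seqlimB h1 h3; rewrite subr0.
by apply: (seqlim_le ler01) => n; rewrite mul1r subKr.
Qed.

Lemma eulerlim_lip z x : cone z -> Dom x -> rnorm (T z x - x) <= normc z * rnorm (A x).
Proof.
move=> Kz Dx; apply: (seqlim_norm_lec (seqlimB (eulerlimP x Kz) (@seqlim_cst _ _ x))).
move=> k; have Kk := cone_dyadic k Kz.
(* Writing [x] as an iterate of the identity lets [iter_dist] compare the Euler scheme with no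
   motion at all; the [2 ^ k] steps then cost |z| |A x| in total. *)
have idE n : iter n id x = x :> X by elim: n.
rewrite -{2}(idE (2 ^ k)%N).
apply: (le_trans (iter_dist _ _ _ _ _ _ _)) => //.
- exact: resolvent_linear.
- by move=> y; exact: resolvent_contr.
apply: (le_trans (ler_wpM2l _ (resolvent_lip Kk Dx))) => //.
by rewrite normc_dyadic !mulrA exp2_dyadic mul1r.
Qed.

(** The exact derivative of the n-th power of [J u] carries one more factor [J u] than the linear
    term used here. Dropping that factor costs the part [normc h * normc u], and replacing
    [J (u + h)] by [J u] in the iterates costs the part quadratic in [h]. For [n = 2 ^ k] steps of
    size 2^-k the first part is of order 2^-k and only the second survives. *)
Lemma iter_resolvent_taylor n u h y : cone u -> cone (u + h) -> dom2 y ->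
  rnorm (iter n (J (u + h)) y - iter n (J u) y - (n%:R * h) *: iter n (J u) (A y))
  <= n%:R * (normc h * normc u + n%:R * normc h ^+ 2) * rnorm (A (A y)).
Proof.
move=> Ku Kuh; have [lP lQ] := (resolvent_linear Kuh, resolvent_linear Ku).
have PQ x := resolvent_comm x Kuh Ku.
have diff x : Dom x -> rnorm (J (u + h) x - J u x) <= normc h * rnorm (A x).
  move=> Dx; rewrite resolvent_diff// rnormZ ler_wpM2l ?normc_ge0//.
  by do 2 apply: (le_trans (resolvent_contr _ _)) => //.
elim: n y => [|n ih] y [Dy DAy].
  by rewrite /= !mul0r scale0r subr0 subrr rnorm0.
have [DQ DAQ] : dom2 (J u y).
  by rewrite /dom2 resolvent_opC//; split; exact: resolvent_stable.
set r := rnorm (A (A y)); have r0 : 0 <= r by exact: rnorm_ge0.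
have nh0 : 0 <= normc h by exact: normc_ge0.
have ih' := ih (J u y) (conj DQ DAQ).
have hr : rnorm (A (J u (A y))) <= r.
  by rewrite resolvent_opC//; exact: resolvent_contr.
rewrite resolvent_opC// in ih'.
have h1 : iter n (J (u + h)) (J (u + h) y) - iter n (J (u + h)) (J u y) =
    h *: iter n.+1 (J (u + h)) (J u (A y)).
  rewrite -linear_funB; last exact: iter_linear.
  by rewrite resolvent_diff// iterSr linear_funZ//; exact: iter_linear.
have h2 : rnorm (iter n.+1 (J (u + h)) (J u (A y)) - iter n.+1 (J u) (A y)) <=
    normc u * r + n.+1%:R * (normc h * r).
  apply: (le_trans (ler_rnorm_dist (iter n.+1 (J (u + h)) (A y)) _ _)).
  apply: lerD.
    rewrite -linear_funB; last exact: iter_linear.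
    apply: (le_trans (iter_contr _ _ _)) => [x|]; first exact: resolvent_contr.
    exact: resolvent_lip.
  apply: (le_trans (iter_dist _ _ _ _ _ _ _)) => //.
  - by move=> x; exact: resolvent_contr.
  - by move=> x; exact: resolvent_contr.
  by apply: ler_wpM2l => //; exact: diff.
have -> : iter n.+1 (J (u + h)) y - iter n.+1 (J u) y -
    (n.+1%:R * h) *: iter n.+1 (J u) (A y) =
    (iter n (J (u + h)) (J u y) - iter n (J u) (J u y)
      - (n%:R * h) *: iter n (J u) (J u (A y)))
    + h *: (iter n.+1 (J (u + h)) (J u (A y)) - iter n.+1 (J u) (A y)).
  rewrite scalerBr -h1 -natr1 mulrDl mul1r scalerDl !(iterSr n).
  by rewrite [RHS]addrC addrACA subrKA opprD [X in _ + X]addrC.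
apply: (le_trans (ler_rnormD _ _)); rewrite rnormZ.
apply: (le_trans (lerD ih' (ler_wpM2l nh0 h2))).
have h3 := ler_wpM2l (_ : 0 <= n%:R * (normc h * normc u + n%:R * normc h ^+ 2)) hr.
apply: (le_trans (lerD (h3 _) (lexx _))).
  by rewrite mulr_ge0// addr_ge0// mulr_ge0 ?normc_ge0 ?exprn_ge0.
rewrite -natr1; set N : R := n%:R; have N0 : 0 <= N by [].
rewrite -subr_ge0.
rewrite [X in 0 <= X](_ : _ = N * normc h ^+ 2 * r); last by ring.
by rewrite !mulr_ge0// exprn_ge0.
Qed.

(** The remainder involves [y] only through [A (A y)]; combined with smoothing it will give an
    estimate in operator norm. *)
Lemma eulerlim_taylor u h y : cone u -> cone (u + h) -> dom2 y ->
  rnorm (T (u + h) y - T u y - h *: T u (A y)) <= normc h ^+ 2 * rnorm (A (A y)).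
Proof.
move=> Ku Kuh Dy.
have L := seqlimB (seqlimB (eulerlimP y Kuh) (eulerlimP y Ku))
  (seqlimZ h (eulerlimP (A y) Ku)).
apply: (seqlim_norm_le (d := normc h * normc u * rnorm (A (A y))) L) => k.
have Kk := cone_dyadic k Ku; have Kk' := cone_dyadic k Kuh.
rewrite dyadicD in Kk'; have := iter_resolvent_taylor (2 ^ k) Kk Kk' Dy.
rewrite -dyadicD -!/(E k _ _) !normc_dyadic.
have -> : (2 ^ k)%:R * dyadic k h = h.
  by rewrite /dyadic mulrA -(rmorph_nat (real_complex R)) -rmorphM/= exp2_dyadic mul1r.
move=> /le_trans; apply.
have := exp2_dyadic k; set N : R := _%:R; set q : R := _ ^+ k => Nq.
rewrite [leLHS](_ : _ = (N * q) * (normc h * normc u * rnorm (A (A y)) * q) +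
  (N * q) ^+ 2 * (normc h ^+ 2 * rnorm (A (A y)))); last by ring.
by rewrite Nq expr1n !mul1r addrC.
Qed.

Lemma eulerlim_resolvent z w x : cone z -> cone w -> T z (J w x) = J w (T z x).
Proof.
move=> Kz Kw; apply: eulerlimE => //; have lw := resolvent_linear Kw.
apply: (seqlim_le ler01 _ (eulerlimP x Kz)) => k; rewrite mul1r.
rewrite [E _ _ _](iter_comm (Q := J w)) => [|y].
  by rewrite -linear_funB//; exact: resolvent_contr.
by apply: resolvent_comm => //; exact: cone_dyadic.
Qed.

Lemma eulerlim_small x e : 0 < e -> exists2 dl : R, 0 < dl &
  forall z, cone z -> normc z <= dl -> rnorm (T z x - x) <= e.
Proof.
move=> e0; have e3 : 0 < e / 3 by rewrite divr_gt0.
have [y Dy yx] := Dom_dense x e3.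
have Ay : 0 < rnorm (A y) + 1 by rewrite ltr_wpDl// rnorm_ge0.
exists (e / 3 / (rnorm (A y) + 1)); first by rewrite divr_gt0.
move=> z Kz; rewrite ler_pdivlMr// => h.
have h1 := eulerlim_lip Kz Dy.
have h2 := eulerlim_dist x y Kz; rewrite (rnormB x y) in h2.
have h4 := ler_rnorm_dist (T z y) (T z x) x.
have h5 := ler_rnorm_dist y (T z y) x.
have h6 := normc_ge0 z; lra.
Qed.

(** The Taylor estimate at 0 needs [dom2], so [x] is replaced by [y = J s x], which is close to [x]
    in graph norm because [A (J s x) = J s (A x)]. The difference [x - y] costs t |A (x - y)| twice,
    once in the Lipschitz bound and once in the linear term; the Taylor remainder of [y] gives the
    last third. *)
Lemma eulerlim_deriv0 x e : Dom x -> 0 < e -> exists2 dl : R, 0 < dl &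
  forall t : R, 0 < t <= dl ->
    rnorm (((t^-1)%:C)%C *: (T (t%:C)%C x - x) - A x) <= e.
Proof.
move=> Dx e0; have e3 : 0 < e / 3 by rewrite divr_gt0.
have [s [s0 Ks hs]] := resolvent_cvg (A x) e3.
set y := J (s%:C)%C x; have D2y : dom2 y by exact: dom2_resolvent.
have [Dy _] := D2y.
have AAy : 0 < rnorm (A (A y)) + 1 by rewrite ltr_wpDl// rnorm_ge0.
exists (e / 3 / (rnorm (A (A y)) + 1)); first by rewrite divr_gt0.
move=> t /andP[t0]; rewrite ler_pdivlMr// => ht.
have Kt : cone (t%:C)%C by apply: cone_real; exact: ltW.
have nt : normc (t%:C)%C = t by rewrite normc_real gtr0_norm.
have K0t : cone (0 + (t%:C)%C) by rewrite add0r.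
have h1 := eulerlim_taylor cone0 K0t D2y.
rewrite add0r !eulerlim0 nt in h1.
have Dxy := dom_sub Dx Dy.
have h2 := eulerlim_lip Kt Dxy.
have Axy : rnorm (A (x - y)) <= e / 3.
  by rewrite op_sub// /y resolvent_opC// rnormB.
rewrite nt in h2.
have h3 : rnorm (T (t%:C)%C x - x - (t%:C)%C *: A x) <= t * e.
  have -> : T (t%:C)%C x - x - (t%:C)%C *: A x =
      (T (t%:C)%C (x - y) - (x - y)) - (t%:C)%C *: A (x - y) +
      (T (t%:C)%C y - y - (t%:C)%C *: A y).
    rewrite op_sub// (linear_funB _ _ (eulerlim_linear Kt)).
    by rewrite scalerBr [X in _ = X - _ + _]subrACA [X in _ = X + _]subrACA subrK.
  apply: (le_trans (ler_rnormD _ _)).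
  have h4 := ler_rnormB (T (t%:C)%C (x - y) - (x - y)) ((t%:C)%C *: A (x - y)).
  rewrite rnormZ nt in h4.
  have h5 : t * rnorm (A (x - y)) <= t * (e / 3) by rewrite ler_wpM2l// ltW.
  have h6 : t ^+ 2 * rnorm (A (A y)) <= t * (e / 3).
    by rewrite expr2 -mulrA ler_wpM2l ?(ltW t0)//; lra.
  lra.
have -> : ((t^-1)%:C)%C *: (T (t%:C)%C x - x) - A x =
    ((t^-1)%:C)%C *: (T (t%:C)%C x - x - (t%:C)%C *: A x).
  rewrite [in RHS]scalerBr scalerA -rmorphM/= mulVf ?gt_eqF// ?scale1r//.
rewrite rnormZ normc_real gtr0_norm ?invr_gt0//.
by rewrite mulrC ler_pdivrMr// mulrC.
Qed.

(** * Generator, strong continuity and complex differentiability *)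

Definition eulerlim_real (t : R) := T (t%:C)%C.

Lemma near_at_right (P : R -> Prop) (dl : R) : 0 < dl ->
  (forall t, 0 < t <= dl -> P t) -> \forall t \near (0 : R)^'+, P t.
Proof.
move=> dl0 HP; near=> t; apply: HP; apply/andP; split.
  by near: t; exact: nbhs_right_gt.
by apply: ltW; near: t; exact: nbhs_right_lt.
Unshelve. all: by end_near. Qed.

Lemma eulerlim_generator_cvg x : Dom x ->
  diff_quotient eulerlim_real x t @[t --> (0 : R)^'+] --> A x.
Proof.
move=> Dx; apply/cvg_rnormP => e e0.
have [dl dl0 H] := eulerlim_deriv0 Dx e0.
exact: near_at_right dl0 H.
Qed.

Lemma eulerlim_generator x : Dom x -> generator eulerlim_real x = A x.
Proof. by move=> Dx; apply: cvg_lim => //; exact: eulerlim_generator_cvg. Qed.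

(** The generator has no larger domain: if the quotients at [x] tend to [y], applying [J 1] shows
    that [A (J 1 x) = J 1 y]. As [A (J 1 x)] is also [J 1 x - x], this gives [x = J 1 (x - y)], an
    element of [Dom]. *)
Lemma eulerlim_generator_dom : generator_dom eulerlim_real = Dom.
Proof.
apply/seteqP; split => x; last first.
  by move=> Dx; apply/cvg_ex; exists (A x); exact: eulerlim_generator_cvg.
move=> /cvg_ex[/= y xy].
have K1 : cone (1%:C)%C by apply: cone_real.
have i1 : (1%:C)%C != 0 :> R[i] by rewrite oner_eq0.
have l1 := resolvent_linear K1.
have D1 := resolvent_dom x K1 i1.
have q1 : diff_quotient eulerlim_real (J (1%:C)%C x) t @[t --> (0 : R)^'+]
    --> J (1%:C)%C y.
  apply/cvg_rnormP => e e0; move/cvg_rnormP/(_ _ e0): xy => xy.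
  near=> t; rewrite /diff_quotient /eulerlim_real.
  have t0 : 0 < t by near: t; exact: nbhs_right_gt.
  rewrite eulerlim_resolvent//; last by apply: cone_real; exact: ltW.
  rewrite -linear_funB// -linear_funZ// -linear_funB//.
  apply: (le_trans (resolvent_contr _ K1)).
  by near: t; exact: xy.
have := cvg_unique _ q1 (eulerlim_generator_cvg D1).
move=> /(_ (@norm_hausdorff _ X)).
rewrite -[A _]scale1r -[X in X *: _]/((1%:C)%C) resolvent_op// => E1.
suff -> : x = J (1%:C)%C (x - y) by exact: resolvent_dom.
by rewrite linear_funB// E1 subKr.
Unshelve. all: by end_near. Qed.

Lemma eulerlim_bounded z : cone z -> bounded_operator (T z).
Proof.
move=> Kz; split; first exact: eulerlim_linear.
by exists 1 => x; rewrite mul1r !rnormE lecR eulerlim_contr.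
Qed.

Lemma eulerlim_C0 : C0_semigroup eulerlim_real.
Proof.
split.
- by move=> t t0; exact/eulerlim_bounded/cone_real.
- by apply/funext => x; exact: eulerlim0.
- move=> s t s0 t0; apply/funext => x /=; rewrite /eulerlim_real rmorphD/=.
  by apply: eulerlimD; exact: cone_real.
- move=> x; apply/cvg_rnormP => e e0; have [dl dl0 H] := eulerlim_small x e0.
  apply: (near_at_right dl0) => t /andP[t0 tdl]; apply: H.
    by apply: cone_real; exact: ltW.
  by rewrite normc_real gtr0_norm.
Qed.

(** The half-angle pi/4 is smaller than pi/3, so the inequality of the cone is strict. The bound cos
    phi > 1/2 comes from cos(2 phi) > 0. *)
Lemma sector_pi4 (z : R[i]) : sector (pi / 4) z -> normc z < 2 * complex.Re z.
Proof.
move=> [r [phi [r0 hphi ->]]] /=.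
have -> : Num.sqrt ((r * cos phi) ^+ 2 + (r * sin phi) ^+ 2) = r.
  by rewrite !exprMn -mulrDr cos2Dsin2 mulr1 sqrtr_sqr gtr0_norm.
rewrite mulrCA ltr_pMr//.
move: hphi; rewrite ltr_norml => /andP[h1 h2]; have p0 : 0 < pi :> R := pi_gt0 R.
have c1 : 0 < cos phi by apply: cos_gt0_pihalf; apply/andP; split; lra.
have : 0 < cos (phi *+ 2).
  by apply: cos_gt0_pihalf; rewrite (mulr2n phi); apply/andP; split; lra.
rewrite cos_mulr2n mulr2n; nra.
Qed.

(** Half of [z] is spent on smoothing and half on the expansion:
    [T (z + h) = T (z / 2 + h) T (z / 2)], and [T (z / 2)], as a product of two copies of
    [T (z / 4)], maps every vector into [dom2] with norm of A^2 at most [c ^+ 2]. The Taylor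
    estimate at [z / 2] is then uniform on bounded sets of vectors. *)
Lemma eulerlim_differentiable z : normc z < 2 * complex.Re z ->
  op_differentiable T z.
Proof.
move=> Sz; have Kz : cone z by exact: ltW.
have z0 : z != 0.
  by apply: contraTneq Sz => ->; rewrite ComplexField.Normc.normc0 mulr0 ltxx.
have nz : 0 < normc z.
  rewrite lt_neqAle normc_ge0 andbT eq_sym.
  by apply: contra_neq z0; exact: ComplexField.Normc.eq0_normc.
have smooth := fun x => eulerlim_smoothing x Kz z0.
exists (fun x => A (T z x)).
  split.
    move=> a x y /=; have lz := eulerlim_linear Kz; rewrite lz.
    by rewrite AL//; exact: (smooth _).1.
  exists ((kappa * normc z)^-1) => x; rewrite !rnormE -rmorphM/= lecR.
  by rewrite mulrC ler_pdivlMr ?mulr_gt0// mulrC; exact: (smooth _).2.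
pose z2 := ((2^-1)%:C)%C * z; pose z4 := ((2^-1)%:C)%C * z2.
have [K2 K4] : cone z2 /\ cone z4 by rewrite /z4; split; do ?apply: coneZ.
have nz2 : normc z2 = normc z / 2.
  by rewrite ComplexField.Normc.normcM normc_real ger0_norm// mulrC.
have nz4 : normc z4 = normc z / 4.
  rewrite ComplexField.Normc.normcM normc_real ger0_norm// nz2; lra.
have z40 : z4 != 0.
  apply/eqP => z40; move: nz4; rewrite z40 ComplexField.Normc.normc0; lra.
have halfD w : w = ((2^-1)%:C)%C * w + ((2^-1)%:C)%C * w :> R[i].
  rewrite -mulrDl -rmorphD/= (_ : 2^-1 + 2^-1 = 1 :> R) ?mul1r//; lra.
pose c := (kappa * normc z4)^-1.
have c0 : 0 < c by rewrite invr_gt0 mulr_gt0// nz4; lra.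
have sm4 x : Dom (T z4 x) /\ rnorm (A (T z4 x)) <= c * rnorm x.
  have [D h] := eulerlim_smoothing x K4 z40; split=> //.
  by rewrite /c mulrC ler_pdivlMr; [rewrite mulrC|rewrite mulr_gt0// nz4; lra].
have sm x : dom2 (T z2 x) /\ rnorm (A (A (T z2 x))) <= c ^+ 2 * rnorm x.
  rewrite /dom2 [z2]halfD -/z4 eulerlimD//.
  have [D1 h1] := sm4 x; have [D2 h2] := sm4 (A (T z4 x)).
  have [D3 E3] := eulerlim_opC K4 D1.
  rewrite E3; split; first by [].
  apply: (le_trans h2); rewrite expr2 -mulrA; apply: ler_wpM2l => //; exact: ltW.
move=> e e0.
(* The first bound keeps [z2 + h] in the cone: |z|/2 + |h| <= 2 (Re z / 2 - |h|) as soon as 6 |h| <=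
   2 Re z - |z|. The second makes [normc h * c ^+ 2] at most [e]. *)
pose dl := Num.min ((2 * complex.Re z - normc z) / 6) (e / c ^+ 2).
have dl0 : 0 < dl.
  by rewrite lt_min; apply/andP; split; [lra|rewrite divr_gt0// exprn_gt0].
have dlC : 0 < ((dl%:C)%C : R[i]) by rewrite ltcR.
near=> h.
have h0 : h != 0 by near: h; exact: (@nbhs_dnbhs_neq R[i]^o 0).
have hdl : normc h < dl.
  rewrite -ltcR -[X in X < _]/`|h|; near: h.
  exact: (@dnbhs0_lt R[i] R[i]^o _ dlC).
move=> x.
have [h1 h2] : normc h <= (2 * complex.Re z - normc z) / 6 /\ normc h <= e / c ^+ 2.
  by have := ltW hdl; rewrite le_min => /andP[].
have K2h : cone (z2 + h).
  rewrite /cone raddfD/= -/(complex.Re _).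
  have -> : complex.Re z2 = complex.Re z / 2.
    by rewrite /z2; case: (z) => u v /=; rewrite mul0r subr0 mulrC.
  apply: (le_trans (le_normcD _ _)); rewrite nz2.
  have := ler_Re_normc (- h); rewrite normcN raddfN/= -/(complex.Re _); lra.
have [D2y hy] := sm x.
have -> : T (z + h) x = T (z2 + h) (T z2 x).
  by rewrite {1}[z]halfD -/z2 -addrA addrC -eulerlimD//.
have -> : T z x = T z2 (T z2 x) by rewrite {1}[z]halfD -/z2 eulerlimD.
have [_ ->] := eulerlim_opC K2 D2y.1.
have t1 := eulerlim_taylor K2 K2h D2y.
have -> : forall u v : X, h^-1 *: u - v = h^-1 *: (u - h *: v).
  by move=> u v; rewrite scalerBr scalerA mulVf// scale1r.
rewrite !rnormE -rmorphM/= lecR rnormZ ComplexField.Normc.normcV.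
have nh : 0 < normc h.
  rewrite lt_neqAle normc_ge0 andbT eq_sym.
  by apply: contra_neq h0; exact: ComplexField.Normc.eq0_normc.
rewrite mulrC ler_pdivrMr//; apply: (le_trans t1).
apply: (le_trans (ler_wpM2l (exprn_ge0 _ (ltW nh)) hy)).
rewrite ler_pdivlMr ?exprn_gt0// in h2.
have r0 := rnorm_ge0 x.
have -> : normc h ^+ 2 * (c ^+ 2 * rnorm x) =
  normc h * c ^+ 2 * (rnorm x * normc h) by ring.
by rewrite -[leRHS]mulrA; apply: ler_wpM2r => //; rewrite mulr_ge0// ltW.
Unshelve. all: by end_near. Qed.

Theorem dissipative_cone_holomorphic : exists S : R -> X -> X,
  [/\ holomorphic_semigroup S, generator_dom S = Dom &
      forall x, Dom x -> generator S x = A x].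
Proof.
exists eulerlim_real; split; last exact: eulerlim_generator.
  2: exact: eulerlim_generator_dom.
split; first exact: eulerlim_C0.
exists (pi / 4), T; split.
- by have p0 : 0 < pi :> R := pi_gt0 R; apply/andP; split; lra.
- by [].
- by move=> z /sector_pi4/ltW/eulerlim_bounded.
- move=> z w /sector_pi4/ltW Kz /sector_pi4/ltW Kw.
  by apply/funext => x; exact: eulerlimD.
split; first by move=> z /sector_pi4; exact: eulerlim_differentiable.
move=> th /andP[th0 thp] x; apply/cvg_rnormP => e e0.
have [dl dl0 H] := eulerlim_small x e0.
have dlC : 0 < ((dl%:C)%C : R[i]) by rewrite ltcR.
have Hth z : sector th z -> normc z < dl -> rnorm (T z x - x) <= e.
  move=> [r [phi [r0 hphi zE]]] zdl; apply: H; last exact: ltW.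
  apply/ltW/sector_pi4; exists r, phi; split => //.
  exact: lt_trans thp.
change (\forall z \near (0 : R[i]^o), sector th z -> rnorm (T z x - x) <= e).
near=> z => /Hth; apply.
rewrite -ltcR -[X in X < _]/`|z|; near: z.
exact: (@nbhs0_lt R[i] R[i]^o _ dlC).
Unshelve. all: by end_near. Qed.

End dissipative_cone.

(** * Relatively bounded perturbations of a dissipative operator *)

Section perturbation.
Context (R : realType) (X : normedModType R[i]).
Local Notation normc := ComplexField.Normc.normc.
Variables (Dom : set X) (M B : X -> X) (w : R).
Hypothesis complX : seqcomplete X.
Hypothesis w_bnd : 0 <= w < 1 / 2.
Hypothesis Dom0 : Dom 0.
Hypothesis DomL : forall a x y, Dom x -> Dom y -> Dom (a *: x + y).
Hypothesis ML : forall a x y, Dom x -> Dom y -> M (a *: x + y) = a *: M x + M y.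
Hypothesis BL : forall a x y, Dom x -> Dom y -> B (a *: x + y) = a *: B x + B y.
Hypothesis Dom_dense : forall x (e : R), 0 < e -> exists2 y, Dom y & rnorm (y - x) <= e.
Hypothesis M_surj : forall z f, cone z -> z != 0 -> exists2 x, Dom x & x + z *: M x = f.
Hypothesis M_diss : forall z x, cone z -> Dom x ->
  rnorm x + normc z / 2 * rnorm (M x) <= rnorm (x + z *: M x).
Hypothesis M_bnd : forall z x, cone z -> Dom x ->
  normc z * rnorm (M x) <= rnorm (x + z *: M x).
Hypothesis B_bnd : forall x, Dom x -> rnorm (B x) <= w * rnorm (M x).

Let Dsub x y : Dom x -> Dom y -> Dom (x - y).
Proof. by move=> Dx Dy; rewrite addrC -scaleN1r; exact: DomL. Qed.

Let Msub x y : Dom x -> Dom y -> M (x - y) = M x - M y.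
Proof. by move=> Dx Dy; rewrite addrC -scaleN1r ML// scaleN1r addrC. Qed.

Let Bsub x y : Dom x -> Dom y -> B (x - y) = B x - B y.
Proof. by move=> Dx Dy; rewrite addrC -scaleN1r BL// scaleN1r addrC. Qed.

(** The unknown is [g = x + z *: M x] rather than [x]: the equation becomes g = f + z B (1 + z M)^-1
    g. By [M_bnd] the norm of z M (1 + z M)^-1 is at most 1, so the right-hand side is a contraction
    with constant [w]. *)
Lemma perturbation_surj z f : cone z -> z != 0 ->
  exists2 x, Dom x & x - z *: (B x - M x) = f.
Proof.
move=> Kz z0; have [w0 w2] := andP w_bnd.
have /choice[r hr] g : exists x, Dom x /\ x + z *: M x = g.
  by have [x Dx xg] := M_surj g Kz z0; exists x.
pose Phi g := f + z *: B (r g).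
have Phi_lip g h : rnorm (Phi g - Phi h) <= w * rnorm (g - h).
  have [[Dg Eg] [Dh Eh]] := (hr g, hr h).
  rewrite /Phi opprD addrACA subrr add0r -scalerBr rnormZ -Bsub//.
  have -> : g - h = (r g - r h) + z *: M (r g - r h).
    by rewrite Msub// scalerBr addrACA -opprD Eg Eh.
  apply: le_trans (ler_wpM2l w0 (M_bnd Kz (Dsub Dg Dh))).
  by rewrite mulrCA; apply: ler_wpM2l; [exact: normc_ge0|exact: B_bnd (Dsub _ _)].
pose u n := iter n Phi f.
have [H uH] : exists H, seqlim u H.
  apply: complX; apply: (@seqcauchy_geo _ _ _ (rnorm (Phi f - f)) w).
    by rewrite w0/=; lra.
  elim=> [|n ih]; first by rewrite expr0 mulr1.
  apply: (le_trans (Phi_lip _ _)); rewrite exprS mulrCA.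
  exact: ler_wpM2l.
have HE : H = Phi H.
  have h1 : seqlim (fun n => u n.+1) (Phi H).
    by apply: (seqlim_le w0 _ uH) => n; exact: Phi_lip.
  apply: seqlim_uniq h1 => e /uH[N hN]; exists N => n Nn.
  by apply: hN; exact: leqW.
have [Dr Er] := hr H; exists (r H) => //.
by rewrite scalerBr opprB addrA Er {1}HE /Phi addrK.
Qed.

(** The perturbation takes at most w |z| |M x| from the gain |z| |M x| / 2. The denominator [1 + w]
    converts |M x| into |B x - M x|. *)
Lemma perturbation_diss z x : cone z -> Dom x ->
  rnorm x + (1 / 2 - w) / (1 + w) * normc z * rnorm (B x - M x) <=
  rnorm (x - z *: (B x - M x)).
Proof.
move=> Kz Dx; have [w0 w2] := andP w_bnd.
have h1 := M_diss Kz Dx; have h2 := B_bnd Dx.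
have h3 := ler_rnormB (B x) (M x).
have -> : x - z *: (B x - M x) = x + z *: M x - z *: B x.
  by rewrite scalerBr opprB addrA.
have h4 := ler_rnormB (x + z *: M x - z *: B x) (- (z *: B x)).
rewrite opprK subrK rnormN rnormZ in h4.
have nz := normc_ge0 z.
have h5 := ler_wpM2l nz h2.
have h6 : rnorm (B x - M x) <= (1 + w) * rnorm (M x) by lra.
have h7 : (1 / 2 - w) / (1 + w) * normc z * rnorm (B x - M x) <=
  (1 / 2 - w) / (1 + w) * normc z * ((1 + w) * rnorm (M x)).
  by apply: ler_wpM2l => //; rewrite mulr_ge0// divr_ge0//; lra.
have h8 : (1 / 2 - w) / (1 + w) * normc z * ((1 + w) * rnorm (M x)) =
  (1 / 2 - w) * normc z * rnorm (M x) by field; lra.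
lra.
Qed.

Theorem perturbation_holomorphic : exists S : R -> X -> X,
  [/\ holomorphic_semigroup S, generator_dom S = Dom &
      forall x, Dom x -> generator S x = B x - M x].
Proof.
have [w0 w2] := andP w_bnd.
apply: (dissipative_cone_holomorphic complX (kappa := (1 / 2 - w) / (1 + w))) => //.
- by rewrite divr_gt0; lra.
- move=> a x y Dx Dy; rewrite BL// ML// opprD scalerBr -!addrA; congr (_ + _).
  by rewrite addrCA.
- exact: perturbation_surj.
- exact: perturbation_diss.
Qed.

End perturbation.

(** * Completeness of the weighted L1 space *)

Section LC_space.
Context (R : realType) (dim : nat) (C : {posnum R}).
Local Notation Gamma0 := (Gamma0 R dim).
Local Notation lambda := (@lebesgue_poisson R dim).
Local Notation normc := ComplexField.Normc.normc.
Local Notation LC := (LC dim C).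
Local Notation preLC := (preLC dim C).

Lemma rnorm_LC (g : LC) : rnorm g = fine (LC_norm C (LC_fun g)).
Proof. by []. Qed.

Lemma rnorm_LC_class (G : preLC) : rnorm (LC_class G) = fine (LC_norm C G).
Proof. by rewrite rnorm_LC LC_norm_class. Qed.

Lemma rnorm_LC_classE (G : preLC) : (rnorm (LC_class G))%:E = LC_norm C G.
Proof. by rewrite rnorm_LC_class fineK// LC_norm_fin. Qed.

Lemma LC_classB (G H : preLC) : LC_class (G - H) = LC_class G - LC_class H.
Proof. by rewrite /LC_class !piE. Qed.

Lemma LC_classZ a (G : preLC) : LC_class (a *: G) = a *: LC_class G.
Proof. by rewrite -LC_scale_class. Qed.

Lemma cmeasurableB d (T : measurableType d) (f g : T -> R[i]) :
  cmeasurable f -> cmeasurable g -> cmeasurable (fun x => f x - g x).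
Proof.
move=> mf mg; rewrite (_ : (fun x => _) = fun x => -1 * g x + f x).
  exact: cmeasurableZD.
by apply/funext => x; rewrite mulN1r addrC.
Qed.

Lemma LC_norm_fun_sub (g h : LC) :
  LC_norm C (fun eta => LC_fun g eta - LC_fun h eta) = (rnorm (g - h))%:E.
Proof.
rewrite -{2}[g]LC_funK -{2}[h]LC_funK -LC_classB rnorm_LC_classE.
by congr (LC_norm C _).
Qed.

Lemma ge0_integral_lty_ae d (T : measurableType d) (mu : {measure set T -> \bar R})
    (f : T -> \bar R) : measurable_fun setT f -> (forall x, 0 <= f x)%E ->
  (\int[mu]_x f x < +oo)%E -> {ae mu, forall x, f x < +oo}%E.
Proof.
move=> mf f0 foo; have fi : mu.-integrable setT f.
  apply/integrableP; split => //; rewrite (eq_integral f)// => x _.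
  by rewrite gee0_abs.
have := integrable_ae measurableT fi.
by apply: filterS => x /= /(_ I); rewrite ge0_fin_numE.
Qed.

Lemma cauchy_subseq (X : normedModType R[i]) (u : nat -> X) : seqcauchy u ->
  exists phi : nat -> nat, forall k n, (phi k <= n)%N ->
    rnorm (u n - u (phi k)) <= 2^-1 ^+ k.
Proof.
move=> cu; have /choice[psi hpsi] k : exists N, forall n, (N <= n)%N ->
    rnorm (u n - u N) <= 2^-1 ^+ k.
  by apply: cu; rewrite exprn_gt0.
by exists psi => k n; exact: hpsi.
Qed.

Lemma ler_Re_norm (z : R[i]) : `|complex.Re z| <= normc z.
Proof. by case: z => a b /=; rewrite -sqrtr_sqr ler_wsqrtr// lerDl sqr_ge0. Qed.

Lemma ler_Im_norm (z : R[i]) : `|complex.Im z| <= normc z.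
Proof. by case: z => a b /=; rewrite -sqrtr_sqr ler_wsqrtr// lerDr sqr_ge0. Qed.

Lemma ler_normc_ReIm (z : R[i]) : normc z <= `|complex.Re z| + `|complex.Im z|.
Proof.
case: z => a b /=; rewrite -[leRHS]ger0_norm ?addr_ge0// -sqrtr_sqr ler_wsqrtr//.
by rewrite sqrrD !real_normK ?num_real// addrAC lerDl mulrn_wge0// mulr_ge0.
Qed.

Lemma cvgn_summable_steps (v h : R ^nat) : cvgn (series h) ->
  (forall k, `|v k.+1 - v k| <= h k) -> cvgn v.
Proof.
move=> ch vh; have -> : v = (fun n => v 0%N + series (telescope v) n).
  by apply/funext => n; exact: eq_sum_telescope.
apply: is_cvgD; first exact: is_cvg_cst.
apply: normed_cvg; apply: series_le_cvg ch => [n|n|n] /=; rewrite ?normr_ge0//.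
  exact: le_trans (vh n).
exact: vh.
Qed.

Lemma ge0_eseries_lty_cvg (h : R ^nat) : (forall n, 0 <= h n) ->
  (\sum_(n <oo) (h n)%:E < +oo)%E -> cvgn (series h).
Proof.
move=> h0 hoo; apply: nondecreasing_is_cvgn; first exact: nondecreasing_series.
exists (fine (\sum_(n <oo) (h n)%:E)%E) => _ [n _ <-].
rewrite -lee_fin fineK; last first.
  by rewrite ge0_fin_numE// nneseries_ge0// => k _ _; rewrite lee_fin.
rewrite /series/= -sumEFin; apply: nneseries_lim_ge => k _.
by rewrite lee_fin.
Qed.

Lemma eseries_geometric_lty (c : R) :
  (\sum_(n <oo) (c * 2^-1 ^+ n)%:E < +oo)%E.
Proof.
have h : `|2^-1 : R| < 1 by rewrite gtr0_norm// invf_lt1// ltr1n.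
rewrite (_ : limn _ = limn (EFin \o series (geometric c 2^-1))).
  by rewrite EFin_lim ?ltry//; exact: is_cvg_geometric_series.
by congr (limn _); apply/funext => n /=; rewrite -sumEFin.
Qed.

Lemma limn_einf_le (u : (\bar R)^nat) (c : \bar R) N :
  (forall n, (N <= n)%N -> u n <= c)%E -> (limn_einf u <= c)%E.
Proof.
move=> uc; rewrite limn_einf_lim; apply: lime_le; first exact: is_cvg_einfs.
near=> n; apply: le_trans (uc n _); last by near: n; exists N.
by apply: ereal_inf_lbound; exists n => /=.
Unshelve. all: by end_near. Qed.

(* Riesz-Fischer: along a subsequence with summable increments the functions
   converge almost everywhere, and Fatou's lemma turns this into norm convergence. *)
Lemma LC_complete : seqcomplete LC.
Proof.
move=> u cu; have [phi hphi] := cauchy_subseq cu.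
pose G k := LC_fun (u (phi k)).
have dG j k : (LC_norm C (fun eta => G j eta - G k eta)%R <=
    (2^-1 ^+ j + 2^-1 ^+ k)%:E)%E.
  rewrite LC_norm_fun_sub lee_fin.
  apply: (le_trans (ler_rnorm_dist (u (maxn (phi j) (phi k))) _ _)).
  by apply: lerD; [rewrite rnormB|]; apply: hphi; rewrite leq_max leqnn ?orbT.
have mG k : cmeasurable (G k) := (preLCP (G k)).1.
have mD j k := measurable_LC_integrand C (cmeasurableB (mG j) (mG k)).
pose f k eta := (normc (G k.+1 eta - G k eta) * C%:num ^+ #|` eta|)%:E.
have f0 k eta : (0 <= f k eta)%E by rewrite lee_fin mulr_ge0 ?exprn_ge0// normc_ge0.
have mf k : measurable_fun setT (f k) by exact: mD.
have sum_f : {ae lambda, forall eta, \sum_(k <oo) f k eta < +oo}%E.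
  apply: ge0_integral_lty_ae.
  - exact: ge0_emeasurable_sum.
  - by move=> eta; apply: nneseries_ge0.
  - rewrite integral_nneseries//.
    apply: le_lt_trans (eseries_geometric_lty 2).
    apply: lee_nneseries => [k _ _|k _]; first by apply: integral_ge0.
    apply: (le_trans (dG _ _)); rewrite lee_fin exprS.
    have := exprn_ge0 k (_ : 0 <= 2^-1 :> R); rewrite invr_ge0 ler0n => /(_ isT); lra.
(* Upper limits exist at every configuration and keep measurability; [fine] gives 0 where they are
   infinite, which happens only on the exceptional null set. *)
pose g eta := Complex (fine (limn_esup (fun k => (complex.Re (G k eta))%:E)))
  (fine (limn_esup (fun k => (complex.Im (G k eta))%:E))).
have mg : cmeasurable g.
  split; apply: measurableT_comp => //; apply: measurable_fun_limn_esup => k;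
    apply/measurable_EFinP; exact: (mG k).1 || exact: (mG k).2.
have cvg_fine (v : R ^nat) : cvgn v -> v @ \oo --> fine (limn_esup (EFin \o v)).
  move=> cv; have : EFin \o v @ \oo --> (limn v)%:E by apply/cvg_EFin; [exact: nearW|].
  by move=> /[dup] /cvgP/is_cvg_limn_esupE -> /cvg_lim ->.
have cvgG : {ae lambda, forall eta,
    (fun k => normc (g eta - G k eta)) @ \oo --> (0 : R)}.
  apply: filterS sum_f => eta sf.
  have C0 : 0 < C%:num ^+ #|` eta| by rewrite exprn_gt0.
  pose h k := normc (G k.+1 eta - G k eta).
  have ch : cvgn (series h).
    have /(is_cvg_seriesZ (k := (C%:num ^+ #|` eta|)^-1)) :
        cvgn (series (fun k => h k * C%:num ^+ #|` eta|)).
      apply: ge0_eseries_lty_cvg sf => n.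
      by rewrite mulr_ge0 ?exprn_ge0// normc_ge0.
    rewrite (_ : _ *: _ = h)//; apply/funext => k.
    by transitivity (h k * C%:num ^+ #|` eta| / C%:num ^+ #|` eta|);
      [exact: mulrC|rewrite mulfK// gt_eqF].
  have cR : cvgn (fun k => complex.Re (G k eta)).
    apply: cvgn_summable_steps ch _ => k.
    by rewrite -raddfB; exact: ler_Re_norm.
  have cI : cvgn (fun k => complex.Im (G k eta)).
    apply: cvgn_summable_steps ch _ => k.
    by rewrite -raddfB; exact: ler_Im_norm.
  have aux (v : R ^nat) l : v @ \oo --> l -> (fun k => `|l - v k|) @ \oo --> (0 : R).
    by move=> vl; rewrite -(normr0 R) -(subrr l); apply: cvg_norm; apply: cvgB => //; exact: cvg_cst.
  apply: (@squeeze_cvgr _ _ _ _ (fun=> 0) (fun k =>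
    `|fine (limn_esup (fun k => (complex.Re (G k eta))%:E)) - complex.Re (G k eta)| +
    `|fine (limn_esup (fun k => (complex.Im (G k eta))%:E)) - complex.Im (G k eta)|)).
  - apply: nearW => k; rewrite normc_ge0/=.
    by apply: le_trans (ler_normc_ReIm _) _; rewrite !raddfB.
  - exact: cvg_cst.
  - rewrite -[X in _ --> X]addr0; apply: cvgD; apply: aux; exact: cvg_fine.
have gG k : (LC_norm C (fun eta => g eta - G k eta)%R <= (2 * 2^-1 ^+ k)%:E)%E.
  rewrite /LC_norm; set F := (X in integral _ _ X).
  (* Almost everywhere the integrand is a limit, hence a lower limit, which is the form that Fatou's
     lemma takes. *)
  have -> : (\int[lambda]_eta F eta = \int[lambda]_eta
      limn_einf (fun j => (normc (G j eta - G k eta)%R * C%:num ^+ #|` eta|)%:E))%E.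
    apply: ae_eq_integral => //.
    - exact: measurable_LC_integrand (cmeasurableB _ _).
    - rewrite (_ : (fun eta => _) = (fun eta => - limn_esup (fun j =>
          - (normc (G j eta - G k eta)%R * C%:num ^+ #|` eta|)%:E))%E).
        apply: measurableT_comp => //; apply: measurable_fun_limn_esup => j.
        by apply: measurableT_comp => //; exact: mD.
      apply/funext => eta; rewrite -limn_einfN; congr limn_einf.
      by apply/funext => j; exact/esym/oppeK.
    - apply: filterS cvgG => eta cg _.
      have : (fun j => (normc (G j eta - G k eta) * C%:num ^+ #|` eta|)%:E) @ \oo -->
          (normc (g eta - G k eta) * C%:num ^+ #|` eta|)%:E.
        apply/cvg_EFin; first exact: nearW.
        apply: cvgMl; apply/cvgrPdist_le => e e0.
        move/cvgrPdist_le : cg => /(_ _ e0); apply: filterS => j.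
        rewrite sub0r normrN ger0_norm ?normc_ge0//; apply: le_trans.
        have h1 := le_normcD (g eta - G j eta) (G j eta - G k eta).
        have h2 := le_normcD (G j eta - g eta) (g eta - G k eta).
        rewrite subrKA in h1; rewrite subrKA -[G j eta - g eta]opprB normcN in h2.
        rewrite ler_norml; apply/andP; split; lra.
      by move=> /[dup] /cvgP/is_cvg_limn_einfE -> /cvg_lim ->.
  apply: le_trans (fatou _ measurableT _ _) _.
  + by move=> j; exact: mD.
  + by move=> j eta _; rewrite lee_fin mulr_ge0 ?exprn_ge0// normc_ge0.
  apply: (limn_einf_le (N := k)) => j kj; apply: (le_trans (dG j k)).
  rewrite lee_fin mulrDl mul1r lerD2r.
  by rewrite ler_wiXn2l// ?invr_ge0// invf_le1// ler1n.
have gG0 : (fun eta => g eta - G 0%N eta) \in in_LC C.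
  apply/in_LCP; split; first exact: cmeasurableB.
  by apply: le_lt_trans (gG 0%N) _; rewrite ltry.
have gin : g \in in_LC C.
  have -> : g = (fun eta => g eta - G 0%N eta) + G 0%N.
    by apply/funext => eta; rewrite fctE subrK.
  by apply: rpredD => //; exact: valP.
exists (LC_class (PreLC gin)) => e e0.
have e3 : 0 < e / 3 by rewrite divr_gt0.
have [k hk] := exp2_small 1 e3; have {}hk := hk k (leqnn _).
exists (phi k) => n /hphi h.
apply: (le_trans (ler_rnorm_dist (u (phi k)) _ _)).
rewrite [rnorm (_ - LC_class _)]rnormB.
have : rnorm (LC_class (PreLC gin) - u (phi k)) <= 2 * 2^-1 ^+ k.
  rewrite -[u (phi k)]LC_funK -LC_classB -lee_fin rnorm_LC_classE.
  exact: gG.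
lra.
Qed.

End LC_space.

(** * Splitting a finite configuration *)

Section splits.
Context {T : Type}.
Implicit Types (s u v : seq T).

(** List counterpart of the pairs (xi, eta \ xi) with xi a subset of eta. At each head the point
    goes left or right, which fits inductions on the number of points. *)
Fixpoint splits s : seq (seq T * seq T) :=
  if s is x :: s' then
    [seq (x :: p.1, p.2) | p <- splits s'] ++ [seq (p.1, x :: p.2) | p <- splits s']
  else [:: ([::], [::])].

(** List counterpart of the pairs (x, xi \ x) with x in xi. *)
Fixpoint picks s : seq (T * seq T) :=
  if s is x :: s' then (x, s') :: [seq (p.1, x :: p.2) | p <- picks s'] else [::].

End splits.

Section splits_fset.
Context {K : choiceType}.
Implicit Types (s u v : seq K).
Local Open Scope fset_scope.

Definition mkfset s : {fset K} := [fset x in s].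

Lemma in_mkfset s x : (x \in mkfset s) = (x \in s).
Proof. by rewrite !inE. Qed.

Lemma mkfset_nil : mkfset [::] = fset0.
Proof. by apply/fsetP => x; rewrite in_mkfset in_fset0. Qed.

Lemma mkfset_cons x s : mkfset (x :: s) = x |` mkfset s.
Proof. by apply/fsetP => y; rewrite in_fset1U !in_mkfset inE. Qed.

Lemma mkfset_cat s u : mkfset (s ++ u) = mkfset s `|` mkfset u.
Proof. by apply/fsetP => y; rewrite in_fsetU !in_mkfset mem_cat. Qed.

Lemma card_mkfset s : uniq s -> #|` mkfset s| = size s.
Proof. by move=> us; rewrite card_fseq undup_id. Qed.

Lemma perm_mkfset s u : perm_eq s u -> mkfset s = mkfset u.
Proof. by move=> /perm_mem su; apply/fsetP => x; rewrite !in_mkfset su. Qed.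

Lemma mem_splits_perm s p : p \in splits s -> perm_eq (p.1 ++ p.2) s.
Proof.
elim: s p => [|x s ih] p; first by rewrite inE => /eqP ->.
rewrite mem_cat => /orP[] /mapP[q /ih qs ->] /=; first by rewrite perm_cons.
by rewrite -cat1s perm_catCA /= perm_cons.
Qed.

Lemma mem_picks_perm s p : p \in picks s -> perm_eq (p.1 :: p.2) s.
Proof.
elim: s p => //= x s ih p; rewrite inE => /orP[/eqP -> //|/mapP[q /ih qs ->]] /=.
by rewrite -cat1s -[x :: q.2]cat1s perm_catCA /= perm_cons.
Qed.

Lemma uniq_splits s p : uniq s -> p \in splits s ->
  [/\ uniq p.1, uniq p.2 & mkfset s `\` mkfset p.1 = mkfset p.2].
Proof.
move=> us ps; have pp := mem_splits_perm ps.
have := us; rewrite -(perm_uniq pp) cat_uniq => /and3P[u1 /hasPn d u2]; split => //.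
rewrite -(perm_mkfset pp) mkfset_cat; apply/fsetP => x.
rewrite in_fsetD in_fsetU !in_mkfset; case: (boolP (x \in p.2)) => [/d ->|];
  by rewrite ?orbT// orbF; case: (x \in p.1).
Qed.

Lemma uniq_picks s p : uniq s -> p \in picks s ->
  [/\ p.1 \notin p.2, uniq p.2 & mkfset s `\ p.1 = mkfset p.2].
Proof.
move=> us ps; have pp := mem_picks_perm ps.
have := us; rewrite -(perm_uniq pp) => /andP[n1 u2]; split => //.
rewrite -(perm_mkfset pp) mkfset_cons fsetU1K// in_mkfset.
by [].
Qed.

Lemma perm_fpowerset_splits s : uniq s ->
  perm_eq (fpowerset (mkfset s)) [seq mkfset p.1 | p <- splits s].
Proof.
elim: s => [_|x s ih /= /andP[xs us]].
  rewrite mkfset_nil fpowerset0; apply: uniq_perm => //= y.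
  by rewrite !inE mkfset_nil.
have {}ih := ih us; rewrite map_cat -!map_comp.
have -> : [seq ((fun p => mkfset p.1) \o (fun p => (x :: p.1, p.2))) p | p <- splits s] =
    [seq x |` A | A <- [seq mkfset p.1 | p <- splits s]].
  by rewrite -map_comp; apply: eq_map => p /=; rewrite mkfset_cons.
rewrite (_ : map ((fun p => _) \o (fun p => (_, x :: _))) _ =
  [seq mkfset p.1 | p <- splits s])//.
apply: perm_trans (perm_cat (perm_map _ ih) ih).
have xA A : A \in fpowerset (mkfset s) -> x \notin A.
  by rewrite fpowersetE => /fsubsetP As; apply: contra xs => /As; rewrite in_mkfset.
apply: uniq_perm => //.
  rewrite cat_uniq map_inj_in_uniq ?fset_uniq//= ?andbT.
    by apply/hasPn => A /xA xA'; apply/mapP => -[B _ AB]; rewrite AB fset1U1 in xA'.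
  by move=> A B /xA hA /xA hB AB; rewrite -(fsetU1K hA) AB fsetU1K.
move=> A; rewrite mem_cat !fpowersetE mkfset_cons; apply/idP/orP.
  move=> Ax; have [xinA|xnA] := boolP (x \in A).
    left; apply/mapP; exists (A `\ x); last by rewrite fsetD1K.
    by rewrite fpowersetE fsubDset.
  right; apply/fsubsetP => y yA; move/fsubsetP/(_ y yA) : Ax.
  by rewrite in_fset1U => /predU1P[yx|//]; rewrite -yx yA in xnA.
case=> [/mapP[B]|/fsubset_trans]; last by apply; exact: fsubsetU1.
by rewrite fpowersetE => Bs ->; exact: fsetUS.
Qed.

Lemma perm_mkfset_picks s : uniq s -> perm_eq (mkfset s) [seq p.1 | p <- picks s].
Proof.
move=> us; rewrite (_ : [seq p.1 | p <- picks s] = s); last first.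
  by elim: s {us} => //= x s ih; rewrite -map_comp (@eq_map _ _ _ fst)// ih.
by apply: uniq_perm => //= x; rewrite in_mkfset.
Qed.

Lemma big_fpowerset_splits (R : Type) (idx : R) (op : Monoid.com_law idx)
    (F : {fset K} -> {fset K} -> R) s : uniq s ->
  \big[op/idx]_(A <- fpowerset (mkfset s)) F A (mkfset s `\` A) =
  \big[op/idx]_(p <- splits s) F (mkfset p.1) (mkfset p.2).
Proof.
move=> us; rewrite (perm_big _ (perm_fpowerset_splits us)) big_map /=.
rewrite big_seq [RHS]big_seq; apply: eq_bigr => p ps.
by have [_ _ ->] := uniq_splits us ps.
Qed.

Lemma big_mkfset_picks (R : Type) (idx : R) (op : Monoid.com_law idx)
    (F : K -> {fset K} -> R) s : uniq s ->
  \big[op/idx]_(x <- mkfset s) F x (mkfset s `\ x) =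
  \big[op/idx]_(p <- picks s) F p.1 (mkfset p.2).
Proof.
move=> us; rewrite (perm_big _ (perm_mkfset_picks us)) big_map /=.
rewrite big_seq [RHS]big_seq; apply: eq_bigr => p ps.
by have [_ _ ->] := uniq_picks us ps.
Qed.

End splits_fset.

Lemma big_splits_cons (T R : Type) (idx : R) (op : Monoid.com_law idx)
    (F : seq T -> seq T -> R) x s :
  \big[op/idx]_(p <- splits (x :: s)) F p.1 p.2 =
  op (\big[op/idx]_(p <- splits s) F (x :: p.1) p.2)
     (\big[op/idx]_(p <- splits s) F p.1 (x :: p.2)).
Proof. by rewrite /= big_cat !big_map. Qed.

Lemma big_picks_cons (T R : Type) (idx : R) (op : Monoid.com_law idx)
    (F : T -> seq T -> R) x s :
  \big[op/idx]_(p <- picks (x :: s)) F p.1 p.2 =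
  op (F x s) (\big[op/idx]_(p <- picks s) F p.1 (x :: p.2)).
Proof. by rewrite /= big_cons big_map. Qed.

(** * Measurability of functions of finite lists *)

Section list_measurability.
Context dT (T : measurableType dT).

(* [seq T] carries no sigma-algebra: measurability in a list argument is asked for
   on the tuples of each length. *)
Definition smeas1 dY (Y : measurableType dY) dZ (Z : measurableType dZ)
    (f : Y -> seq T -> Z) :=
  forall n, measurable_fun setT (fun p : Y * n.-tuple T => f p.1 p.2).

Definition smeas2 dY (Y : measurableType dY) dZ (Z : measurableType dZ)
    (f : Y -> seq T -> seq T -> Z) :=
  forall n, smeas1 (fun (p : Y * n.-tuple T) v => f p.1 p.2 v).

Context dY (Y : measurableType dY) dZ (Z : measurableType dZ).

Lemma smeas1_comp dW (W : measurableType dW) (f : Y -> seq T -> Z) (g : W -> Y) :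
  measurable_fun setT g -> smeas1 f -> smeas1 (fun w => f (g w)).
Proof.
move=> mg mf n; apply: (measurableT_comp (mf n) (g := fun p => (g p.1, p.2))).
apply/measurable_fun_pair => /=; last exact: measurable_snd.
by apply: measurableT_comp => //; exact: measurable_fst.
Qed.

Lemma smeas1_sect (f : Y -> seq T -> Z) n (g : Y -> n.-tuple T) :
  measurable_fun setT g -> smeas1 f -> measurable_fun setT (fun y => f y (g y)).
Proof.
move=> mg mf; apply: (measurableT_comp (mf n) (g := fun y => (y, g y))).
by apply/measurable_fun_pair.
Qed.

Lemma smeas1_nil (f : Y -> seq T -> Z) : measurable_fun setT (f ^~ [::]) ->
  measurable_fun setT (fun p : Y * 0.-tuple T => f p.1 p.2).
Proof.
move=> f0; rewrite (_ : (fun p => _) = (fun y => f y [::]) \o fst).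
  by apply: measurableT_comp => //; exact: measurable_fst.
by apply/funext => -[y t] /=; rewrite (tuple0 t).
Qed.

(** The head of the tuple moves into the parameter space; this is why the inductions on the length
    quantify over all [Y]. *)
Lemma smeas1_uncons n (f : Y -> seq T -> Z) :
  measurable_fun setT (fun p : (Y * T) * n.-tuple T => f p.1.1 (p.1.2 :: p.2)) ->
  measurable_fun setT (fun p : Y * n.+1.-tuple T => f p.1 p.2).
Proof.
move=> fS.
rewrite (_ : (fun p => _) = (fun p : (Y * T) * n.-tuple T => f p.1.1 (p.1.2 :: p.2)) \o
    (fun p : Y * n.+1.-tuple T => ((p.1, thead p.2), [tuple of behead p.2]))).
  apply: measurableT_comp => //; apply/measurable_fun_pair => /=.
    apply/measurable_fun_pair => /=; first exact: measurable_fst.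
    apply: (measurableT_comp (@measurable_tnth _ T n.+1 ord0)).
    exact: measurable_snd.
  by apply: (measurableT_comp (@measurable_behead _ _ _)); exact: measurable_snd.
apply/funext => -[y t] /=; congr (f y _).
by case/tupleP: t => x t.
Qed.

Lemma smeas2_nil (f : Y -> seq T -> seq T -> Z) : smeas2 f ->
  measurable_fun setT (fun y => f y [::] [::]).
Proof.
move=> mf; apply: (measurableT_comp (mf 0%N 0%N)
  (g := fun y => ((y, [tuple] : 0.-tuple T), [tuple] : 0.-tuple T))).
apply: measurable_fun_pair; last exact: measurable_cst.
apply: measurable_fun_pair; last exact: measurable_cst.
exact: measurable_id.
Qed.

Lemma smeas2_consl (f : Y -> seq T -> seq T -> Z) : smeas2 f ->
  smeas2 (fun (q : Y * T) u v => f q.1 (q.2 :: u) v).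
Proof.
move=> mf n m; apply: (measurableT_comp (mf n.+1 m)
  (g := fun p : Y * T * n.-tuple T * m.-tuple T =>
    ((p.1.1.1, [the n.+1.-tuple T of p.1.1.2 :: p.1.2]), p.2))).
apply: measurable_fun_pair; last exact: measurable_snd.
apply: (measurableT_comp (f := fun q : Y * T * n.-tuple T =>
  (q.1.1, [the n.+1.-tuple T of q.1.2 :: q.2]))); last exact: measurable_fst.
apply: measurable_fun_pair.
  by apply: (measurableT_comp measurable_fst measurable_fst).
apply: measurable_cons; last exact: measurable_snd.
by apply: (measurableT_comp measurable_snd measurable_fst).
Qed.

Lemma smeas2_consr (f : Y -> seq T -> seq T -> Z) : smeas2 f ->
  smeas2 (fun (q : Y * T) u v => f q.1 u (q.2 :: v)).
Proof.
move=> mf n m; apply: (measurableT_comp (mf n m.+1)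
  (g := fun p : Y * T * n.-tuple T * m.-tuple T =>
    ((p.1.1.1, p.1.2), [the m.+1.-tuple T of p.1.1.2 :: p.2]))).
have m11 : measurable_fun setT (fun p : Y * T * n.-tuple T * m.-tuple T => p.1.1).
  by apply: (measurableT_comp measurable_fst measurable_fst).
apply: measurable_fun_pair.
  apply: measurable_fun_pair; first exact: (measurableT_comp measurable_fst m11).
  by apply: (measurableT_comp measurable_snd measurable_fst).
apply: measurable_cons; last exact: measurable_snd.
exact: (measurableT_comp measurable_snd m11).
Qed.

End list_measurability.

Section list_sums.
Context dT (T : measurableType dT) (R : realType).

Lemma smeas1_splits n : forall dY (Y : measurableType dY)
    (f : Y -> seq T -> seq T -> \bar R), smeas2 f ->
  measurable_fun setT (fun p : Y * n.-tuple T =>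
    (\sum_(q <- splits p.2) f p.1 q.1 q.2)%E).
Proof.
elim: n => [|n ih] dY Y f mf.
  apply: (@smeas1_nil _ _ _ _ _ _ (fun y s => (\sum_(q <- splits s) f y q.1 q.2)%E)).
  under [X in measurable_fun _ X]funext do rewrite /= big_seq1.
  exact: smeas2_nil.
apply: (@smeas1_uncons _ _ _ _ _ _ _ (fun y s => (\sum_(q <- splits s) f y q.1 q.2)%E)).
under [X in measurable_fun _ X]funext do rewrite big_splits_cons.
apply: emeasurable_funD.
  exact: (ih _ _ _ (smeas2_consl mf)).
exact: (ih _ _ _ (smeas2_consr mf)).
Qed.

Lemma smeas1_picks n : forall dY (Y : measurableType dY)
    (f : Y -> T -> seq T -> \bar R), smeas1 (fun (q : Y * T) s => f q.1 q.2 s) ->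
  measurable_fun setT (fun p : Y * n.-tuple T =>
    (\sum_(q <- picks p.2) f p.1 q.1 q.2)%E).
Proof.
elim: n => [|n ih] dY Y f mf.
  apply: (@smeas1_nil _ _ _ _ _ _ (fun y s => (\sum_(q <- picks s) f y q.1 q.2)%E)).
  under [X in measurable_fun _ X]funext do rewrite /= big_nil.
  exact: measurable_cst.
apply: (@smeas1_uncons _ _ _ _ _ _ _ (fun y s => (\sum_(q <- picks s) f y q.1 q.2)%E)).
under [X in measurable_fun _ X]funext do rewrite big_picks_cons.
apply: emeasurable_funD; first exact: mf.
apply: (ih _ _ (fun (y : Y * T) x s => f y.1 x (y.2 :: s))) => m.
apply: (measurableT_comp (mf m.+1) (g := fun p : Y * T * T * m.-tuple T =>
  ((p.1.1.1, p.1.2), [the m.+1.-tuple T of p.1.1.2 :: p.2]))).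
have m11 : measurable_fun setT (fun p : Y * T * T * m.-tuple T => p.1.1).
  by apply: (measurableT_comp measurable_fst measurable_fst).
apply: measurable_fun_pair.
  apply: measurable_fun_pair; first exact: (measurableT_comp measurable_fst m11).
  by apply: (measurableT_comp measurable_snd measurable_fst).
apply: measurable_cons; last exact: measurable_snd.
exact: (measurableT_comp measurable_snd m11).
Qed.

Lemma smeas1_splitsr dY (Y : measurableType dY) (f : Y -> seq T -> seq T -> R) :
  smeas2 f -> smeas1 (fun y s => \sum_(q <- splits s) f y q.1 q.2).
Proof.
move=> mf n; apply/measurable_EFinP.
rewrite [X in measurable_fun _ X](_ : _ = fun p : Y * n.-tuple T =>
  (\sum_(q <- splits p.2) (f p.1 q.1 q.2)%:E)%E); last first.
  by apply/funext => p /=; rewrite sumEFin.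
apply: (@smeas1_splits n _ _ (fun y u v => (f y u v)%:E)) => m k.
by apply/measurable_EFinP; exact: mf.
Qed.

Lemma smeas1_picksr dY (Y : measurableType dY) (f : Y -> T -> seq T -> R) :
  smeas1 (fun (q : Y * T) s => f q.1 q.2 s) ->
  smeas1 (fun y s => \sum_(q <- picks s) f y q.1 q.2).
Proof.
move=> mf n; apply/measurable_EFinP.
rewrite [X in measurable_fun _ X](_ : _ = fun p : Y * n.-tuple T =>
  (\sum_(q <- picks p.2) (f p.1 q.1 q.2)%:E)%E); last first.
  by apply/funext => p /=; rewrite sumEFin.
apply: (@smeas1_picks n _ _ (fun y u v => (f y u v)%:E)) => m.
by apply/measurable_EFinP; exact: mf.
Qed.

End list_sums.

(** * Integration over tuples *)

Section tuple_integral.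
Context dT (T : measurableType dT) (R : realType).
Variable mu : {sigma_finite_measure set T -> \bar R}.
Local Open Scope ereal_scope.
Implicit Types (f g : seq T -> \bar R).

Definition smeas0 dZ (Z : measurableType dZ) (f : seq T -> Z) :=
  forall n, measurable_fun setT (fun t : n.-tuple T => f t).

Definition tint n f := \int[tuple_measure mu n]_t f t.

Lemma smeas1_fix dY (Y : measurableType dY) dZ (Z : measurableType dZ)
    (f : Y -> seq T -> Z) y : smeas1 f -> smeas0 (f y).
Proof.
move=> mf n; apply: (measurableT_comp (mf n) (g := fun t => (y, t))).
by apply: measurable_fun_pair; [exact: measurable_cst|exact: measurable_id].
Qed.

Lemma smeas0_cons dZ (Z : measurableType dZ) (f : seq T -> Z) : smeas0 f ->
  smeas1 (fun x s => f (x :: s)).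
Proof.
move=> mf n; apply: (measurableT_comp (mf n.+1)
  (g := fun p : T * n.-tuple T => [the n.+1.-tuple T of p.1 :: p.2])).
by apply: measurable_cons; [exact: measurable_fst|exact: measurable_snd].
Qed.

Lemma tint_ge0 n f : (forall s, 0 <= f s) -> 0 <= tint n f.
Proof. by move=> f0; apply: integral_ge0. Qed.

Lemma eq_tint n f g : (forall s, size s = n -> f s = g s) -> tint n f = tint n g.
Proof.
by move=> fg; apply: eq_integral => t _; apply: fg; rewrite size_tuple.
Qed.

Lemma le_tint n f g : smeas0 f -> smeas0 g -> (forall s, 0 <= f s) ->
  (forall s, 0 <= g s) -> (forall s, size s = n -> f s <= g s) -> tint n f <= tint n g.
Proof.
move=> mf mg f0 g0 fg; apply: ge0_le_integral => //.
- exact: mf.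
- exact: mg.
- by move=> t _; apply: fg; rewrite size_tuple.
Qed.

Lemma tintD n f g : smeas0 f -> smeas0 g -> (forall s, 0 <= f s) ->
  (forall s, 0 <= g s) -> tint n (fun s => f s + g s) = tint n f + tint n g.
Proof.
by move=> mf mg f0 g0; apply: ge0_integralD => //; [exact: mf|exact: mg].
Qed.

Lemma tintZl n f (k : R) : smeas0 f -> (forall s, 0 <= f s) -> (0 <= k)%R ->
  tint n (fun s => k%:E * f s) = k%:E * tint n f.
Proof. by move=> mf f0 k0; apply: ge0_integralZl => //; exact: mf. Qed.

Lemma tint0 f : tint 0 f = f [::].
Proof.
rewrite /tint /= (eq_integral (cst (f [::]))); last by move=> t _; rewrite (tuple0 t).
by rewrite integral_cst//= diracT mule1.
Qed.

Lemma tintS n f : smeas0 f -> (forall s, 0 <= f s) ->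
  tint n.+1 f = \int[mu]_x tint n (fun s => f (x :: s)).
Proof.
move=> mf f0; rewrite /tint /= /cons_measure.
have mc := @measurable_tuple_cons _ T n.
rewrite (@ge0_integral_pushforward _ _ _ _ _ _ mc _ setT)//; last exact: mf.
rewrite preimage_setT; apply: (@fubini_tonelli1 _ _ _ _ _ _ _
  (fun p : T * n.-tuple T => f (tuple_cons p))) => //.
exact: (measurableT_comp (mf n.+1) mc).
Qed.

Lemma measurable_tint dY (Y : measurableType dY) n (f : Y -> seq T -> \bar R) :
  smeas1 f -> (forall y s, 0 <= f y s) ->
  measurable_fun setT (fun y => tint n (f y)).
Proof.
move=> mf f0; apply: (@measurable_fun_fubini_tonelli_F _ _ _ _ _ _
  (fun p : Y * n.-tuple T => f p.1 p.2)) => //.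
exact: mf.
Qed.

Lemma smeas1_tint dY (Y : measurableType dY) n (f : Y -> seq T -> seq T -> \bar R) :
  smeas2 f -> (forall y u v, 0 <= f y u v) ->
  smeas1 (fun y u => tint n (f y u)).
Proof.
move=> mf f0 m.
exact: (@measurable_tint _ _ n (fun (q : Y * m.-tuple T) v => f q.1 q.2 v)).
Qed.

Lemma tint_exchange (n : nat) (f : T -> seq T -> \bar R) :
  smeas1 f -> (forall y s, 0 <= f y s) ->
  \int[mu]_x tint n (f x) = tint n (fun s => \int[mu]_x f x s).
Proof.
move=> mf f0; apply: (@fubini_tonelli _ _ _ _ _ _ _
  (fun p : T * n.-tuple T => f p.1 p.2)) => //.
exact: mf.
Qed.

Lemma smeas2_fix dY (Y : measurableType dY) dZ (Z : measurableType dZ)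
    (f : Y -> seq T -> seq T -> Z) y : smeas2 f -> smeas2 (fun _ : unit => f y).
Proof.
move=> mf n m; apply: (measurableT_comp (mf n m)
  (g := fun p : unit * n.-tuple T * m.-tuple T => ((y, p.1.2), p.2))).
apply: measurable_fun_pair; last exact: measurable_snd.
apply: measurable_fun_pair; first exact: measurable_cst.
by apply: (measurableT_comp measurable_snd measurable_fst).
Qed.

Lemma smeas2_unit dY (Y : measurableType dY) dZ (Z : measurableType dZ)
    (f : seq T -> seq T -> Z) :
  smeas2 (fun _ : unit => f) -> smeas2 (fun _ : Y => f).
Proof.
move=> mf n m; apply: (measurableT_comp (mf n m)
  (g := fun p : Y * n.-tuple T * m.-tuple T => ((tt, p.1.2), p.2))).
apply: measurable_fun_pair; last exact: measurable_snd.
apply: measurable_fun_pair; first exact: measurable_cst.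
by apply: (measurableT_comp measurable_snd measurable_fst).
Qed.

(* Peeling off the first point, which goes to one side of the split, needs no
   invariance of [f] under permutation of its list arguments. *)
Lemma tint_splits n (f : seq T -> seq T -> \bar R) :
  smeas2 (fun _ : unit => f) -> (forall u v, 0 <= f u v) ->
  tint n (fun s => \sum_(q <- splits s) f q.1 q.2) =
  \sum_(q <- splits (nseq n tt))
    tint (size q.1) (fun u => tint (size q.2) (fun v => f u v)).
Proof.
elim: n f => [|n ih] f mf f0; first by rewrite /= tint0 !big_seq1/= !tint0.
have mfT := smeas2_unit (Y := T) mf.
have mS dY (Y : measurableType dY) (g : Y -> seq T -> seq T -> \bar R) :
    smeas2 g -> smeas1 (fun y s => \sum_(q <- splits s) g y q.1 q.2).
  by move=> mg k; exact: smeas1_splits.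
have S0 (g : seq T -> seq T -> \bar R) : (forall u v, 0 <= g u v) ->
    forall s, 0 <= \sum_(q <- splits s) g q.1 q.2.
  by move=> g0 s; apply: sume_ge0 => q _; exact: g0.
have Sl x := S0 (fun u v => f (x :: u) v) (fun u v => f0 _ _).
have Sr x := S0 (fun u v => f u (x :: v)) (fun u v => f0 _ _).
have mr : smeas2 (fun x u v => f (x :: u) v).
  move=> i j; have := smeas2_consl mfT; move=> /(_ i j) h.
  apply: (measurableT_comp h (g := fun p : T * i.-tuple T * j.-tuple T =>
    (((p.1.1, p.1.1), p.1.2), p.2))).
  apply: measurable_fun_pair; last exact: measurable_snd.
  have m11 : measurable_fun setT (fun p : T * i.-tuple T * j.-tuple T => p.1.1).
    by apply: (measurableT_comp measurable_fst measurable_fst).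
  apply: measurable_fun_pair; first exact: measurable_fun_pair.
  by apply: (measurableT_comp measurable_snd measurable_fst).
have ml : smeas2 (fun x u v => f u (x :: v)).
  move=> i j; have := smeas2_consr mfT; move=> /(_ i j) h.
  apply: (measurableT_comp h (g := fun p : T * i.-tuple T * j.-tuple T =>
    (((p.1.1, p.1.1), p.1.2), p.2))).
  apply: measurable_fun_pair; last exact: measurable_snd.
  have m11 : measurable_fun setT (fun p : T * i.-tuple T * j.-tuple T => p.1.1).
    by apply: (measurableT_comp measurable_fst measurable_fst).
  apply: measurable_fun_pair; first exact: measurable_fun_pair.
  by apply: (measurableT_comp measurable_snd measurable_fst).
rewrite tintS; last 2 first.
- exact: (smeas1_fix tt (mS _ _ _ mf)).
- exact: S0.
transitivity (\int[mu]_x (tint n (fun s => \sum_(q <- splits s) f (x :: q.1) q.2) +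
    tint n (fun s => \sum_(q <- splits s) f q.1 (x :: q.2)))).
  apply: eq_integral => x _; rewrite -tintD.
  - by apply: eq_tint => s _; rewrite big_splits_cons.
  - exact: (smeas1_fix x (mS _ _ _ mr)).
  - exact: (smeas1_fix x (mS _ _ _ ml)).
  - exact: Sl.
  - exact: Sr.
rewrite ge0_integralD//; last 4 first.
- by move=> x _; exact: tint_ge0 (Sl x).
- apply: (@measurable_tint _ _ _ (fun x s => \sum_(q <- splits s) f (x :: q.1) q.2) _ Sl).
  exact: (mS _ _ _ mr).
- by move=> x _; exact: tint_ge0 (Sr x).
- apply: (@measurable_tint _ _ _ (fun x s => \sum_(q <- splits s) f q.1 (x :: q.2)) _ Sr).
  exact: (mS _ _ _ ml).
rewrite (big_splits_cons _ (fun u v => tint (size u) (fun s => tint (size v) (f s)))).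
have mtr k : smeas1 (fun x u => tint k (fun v => f (x :: u) v)).
  exact: smeas1_tint.
have mtl k : smeas1 (fun x u => tint k (fun v => f u (x :: v))).
  exact: smeas1_tint.
congr (_ + _).
- under eq_integral do rewrite (ih _ (smeas2_fix _ mr))//.
  rewrite ge0_integral_sum//; last 2 first.
  + by move=> q; apply: measurable_tint; [exact: mtr|move=> x u; exact: tint_ge0].
  + by move=> q x _; do 2 (apply: tint_ge0 => ?).
  apply: eq_bigr => q _ /=; rewrite tintS//.
  + apply: (smeas1_fix tt (f := fun _ u => tint (size q.2) (f u))).
    exact: smeas1_tint.
  + by move=> s; exact: tint_ge0.
- under eq_integral do rewrite (ih _ (smeas2_fix _ ml))//.
  rewrite ge0_integral_sum//; last 2 first.
  + by move=> q; apply: measurable_tint; [exact: mtl|move=> x u; exact: tint_ge0].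
  + by move=> q x _; do 2 (apply: tint_ge0 => ?).
  apply: eq_bigr => q _ /=; rewrite tint_exchange//; last first.
    by move=> x u; exact: tint_ge0.
  apply: eq_tint => u _; rewrite tintS//.
  exact: (smeas1_fix (tt, in_tuple u) (mf (size u))).
Qed.

(** The Mecke identity for a fixed number of points: each of the [n.+1] choices of the distinguished
    point contributes the same integral, by Fubini. The induction separates the case where the first
    point is the distinguished one. *)
Lemma tint_picks n (f : T -> seq T -> \bar R) : smeas1 f -> (forall x s, 0 <= f x s) ->
  tint n.+1 (fun s => \sum_(q <- picks s) f q.1 q.2) =
  n.+1%:R%:E * \int[mu]_x tint n (f x).
Proof.
elim: n f => [|n ih] f mf f0; have m1 : smeas1 (fun (q : unit * T) s => f q.2 s);
  do ?by apply: (smeas1_comp _ mf); exact: measurable_snd.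
  have mS : smeas1 (fun (_ : unit) s => \sum_(q <- picks s) f q.1 q.2).
    by move=> k; exact: (@smeas1_picks _ _ _ k _ _ (fun=> f)).
  rewrite tintS; last 2 first.
  - exact: (smeas1_fix tt mS).
  - by move=> s; apply: sume_ge0.
  rewrite mul1e; apply: eq_integral => x _.
  by rewrite !tint0/= big_seq1.
have mS : smeas1 (fun (_ : unit) s => \sum_(q <- picks s) f q.1 q.2).
  by move=> k; exact: (@smeas1_picks _ _ _ k _ _ (fun=> f)).
have mc : smeas1 (fun (q : T * T) s => f q.2 (q.1 :: s)).
  move=> k; apply: (measurableT_comp (mf k.+1) (g := fun p : T * T * k.-tuple T =>
    (p.1.2, [the k.+1.-tuple T of p.1.1 :: p.2]))).
  apply: measurable_fun_pair.
    by apply: (measurableT_comp measurable_snd measurable_fst).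
  apply: measurable_cons; last exact: measurable_snd.
  by apply: (measurableT_comp measurable_fst measurable_fst).
have mp : smeas1 (fun x s => \sum_(q <- picks s) f q.1 (x :: q.2)).
  by move=> k; exact: (@smeas1_picks _ _ _ k _ _ (fun x y s => f y (x :: s)) mc).
have p0 x s : 0 <= \sum_(q <- picks s) f q.1 (x :: q.2) by apply: sume_ge0.
rewrite tintS; last 2 first.
- exact: (smeas1_fix tt mS).
- by move=> s; apply: sume_ge0.
transitivity (\int[mu]_x (tint n.+1 (f x) +
    tint n.+1 (fun s => \sum_(q <- picks s) f q.1 (x :: q.2)))).
  apply: eq_integral => x _; rewrite -tintD//.
  - by apply: eq_tint => s _; rewrite big_picks_cons.
  - exact: (smeas1_fix x mf).
  - exact: (smeas1_fix x mp).
have mx x : smeas1 (fun y s => f y (x :: s)).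
  apply: (smeas1_comp (g := fun y => (x, y)) _ mc).
  by apply: measurable_fun_pair; [exact: measurable_cst|exact: measurable_id].
have mc' : measurable_fun setT (fun p : T * T => tint n (fun s => f p.2 (p.1 :: s))).
  exact: (@measurable_tint _ _ n (fun (p : T * T) s => f p.2 (p.1 :: s))).
rewrite ge0_integralD//; last 4 first.
- by move=> x _; exact: tint_ge0.
- exact: measurable_tint.
- by move=> x _; exact: tint_ge0.
- exact: measurable_tint.
rewrite [X in _ + X](_ : _ = \int[mu]_x (n.+1%:R%:E *
    \int[mu]_y tint n (fun s => f y (x :: s)))); last first.
  by apply: eq_integral => x _; exact: (ih (fun y s => f y (x :: s)) (mx x)).
have mF : measurable_fun setT (fun x => \int[mu]_y tint n (fun s => f y (x :: s))).
  apply: (@measurable_fun_fubini_tonelli_F _ _ _ _ _ _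
    (fun p : T * T => tint n (fun s => f p.2 (p.1 :: s)))) => // p.
  exact: tint_ge0.
rewrite ge0_integralZl ?lee_fin//; last first.
  by move=> x _; apply: integral_ge0 => y _; exact: tint_ge0.
(* Exchanging the peeled point [x] with the picked point [y] lets [x] rejoin the list as its
   head. *)
rewrite (@fubini_tonelli _ _ _ _ _ _ _
  (fun p : T * T => tint n (fun s => f p.2 (p.1 :: s))))//; last first.
  by move=> p; exact: tint_ge0.
rewrite (_ : \int[mu]_y _ = \int[mu]_y tint n.+1 (f y)); last first.
  by apply: eq_integral => y _; rewrite tintS//; exact: (smeas1_fix y mf).
by rewrite -[X in X + _]mul1e -ge0_muleDl ?lee_fin// -EFinD nat1r.
Qed.

(** After integration a split matters only through the two sizes, so [nseq n tt] stands for [n]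
    anonymous points. The induction on [n] is Pascal's rule. *)
Lemma big_splits_size (b : nat -> nat -> \bar R) n : (forall k m, 0 <= b k m) ->
  \sum_(q <- splits (nseq n tt)) b (size q.1) (size q.2) =
  \sum_(k < n.+1) ('C(n, k)%:R)%:E * b k (n - k)%N.
Proof.
elim: n b => [|n ih] b b0; first by rewrite /= big_seq1 big_ord1/= bin0 mul1e.
rewrite (big_splits_cons _ (fun u v : seq unit => b (size u) (size v))).
rewrite (ih (fun k m => b k.+1 m))// (ih (fun k m => b k m.+1))//.
rewrite [in RHS]big_ord_recl bin0 mul1e subn0.
rewrite [X in _ = _ + X](eq_bigr (fun k : 'I_n.+1 => ('C(n, k.+1)%:R)%:E * b k.+1 (n - k)%N +
    ('C(n, k)%:R)%:E * b k.+1 (n - k)%N)); last first.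
  move=> k _; rewrite lift0 binS natrD EFinD subSS.
  by rewrite ge0_muleDl ?lee_fin.
rewrite big_split/= addeA addeC; congr (_ + _).
rewrite [in LHS]big_ord_recl bin0 mul1e subn0; congr (_ + _).
rewrite [in RHS]big_ord_recr/= bin_small// mul0e adde0.
apply: eq_bigr => k _ /=; congr (_ * b _ _).
by rewrite /bump/= add1n subnSK.
Qed.

End tuple_integral.

(** * Integration over lists of all lengths with weights c^n / n! *)

Section weighted_tuple_integral.
Context dT (T : measurableType dT) (R : realType).
Variables (mu : {sigma_finite_measure set T -> \bar R}) (c : R).
Hypothesis c_gt0 : (0 < c)%R.
Local Open Scope ereal_scope.
Implicit Types (f g : seq T -> \bar R).

Definition wt n : R := (c ^+ n / n`!%:R)%R.

Lemma wt_ge0 n : (0 <= wt n)%R.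
Proof. by rewrite divr_ge0// exprn_ge0// ltW. Qed.

Lemma eseries_recl (u : nat -> \bar R) : (forall n, 0 <= u n) ->
  \sum_(n <oo) u n = u 0%N + \sum_(n <oo) u n.+1.
Proof.
move=> u0; rewrite nneseries_recl// -(nneseries_addn 1)//; congr (_ + _).
by apply: eq_eseriesr => n _; rewrite addn1.
Qed.

(** Integration against c^|eta| dlambda(eta) transported to lists. Tuples with repetitions are
    included, so a function of configurations is first extended by 0 to them. *)
Definition wtint f := \sum_(n <oo) (wt n)%:E * tint mu n f.

Let term_ge0 n f : (forall s, 0 <= f s) -> 0 <= (wt n)%:E * tint mu n f.
Proof. by move=> f0; rewrite mule_ge0 ?lee_fin ?wt_ge0// tint_ge0. Qed.

Lemma wtint_ge0 f : (forall s, 0 <= f s) -> 0 <= wtint f.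
Proof. by move=> f0; apply: nneseries_ge0 => n _ _; exact: term_ge0. Qed.

Lemma le_wtint f g : smeas0 f -> smeas0 g -> (forall s, 0 <= f s) ->
  (forall s, 0 <= g s) -> (forall s, f s <= g s) -> wtint f <= wtint g.
Proof.
move=> mf mg f0 g0 fg; apply: lee_nneseries => n *; first exact: term_ge0.
by rewrite lee_wpmul2l ?lee_fin ?wt_ge0// le_tint.
Qed.

Lemma eq_wtint f g : f =1 g -> wtint f = wtint g.
Proof. by move=> fg; apply: eq_eseriesr => n _; congr (_ * _); exact: eq_tint. Qed.

Lemma wtintD f g : smeas0 f -> smeas0 g -> (forall s, 0 <= f s) ->
  (forall s, 0 <= g s) -> wtint (fun s => f s + g s) = wtint f + wtint g.
Proof.
move=> mf mg f0 g0; rewrite /wtint -nneseriesD => [|n _ _|n _ _].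
- by apply: eq_eseriesr => n _; rewrite tintD// muleDr// ge0_adde_def// inE tint_ge0.
- exact: term_ge0.
- exact: term_ge0.
Qed.

Lemma wtint0 : wtint (fun=> 0) = 0.
Proof.
by rewrite /wtint eseries0// => n _ _; rewrite /tint integral0 mule0.
Qed.

Lemma smeas0_sum (I : Type) (r : seq I) (f : I -> seq T -> \bar R) :
  (forall i, smeas0 (f i)) -> smeas0 (fun s => \sum_(i <- r) f i s).
Proof. by move=> mf n; apply: emeasurable_sum => i; exact: mf. Qed.

Lemma wtint_sum (I : Type) (r : seq I) (f : I -> seq T -> \bar R) :
  (forall i, smeas0 (f i)) -> (forall i s, 0 <= f i s) ->
  wtint (fun s => \sum_(i <- r) f i s) = \sum_(i <- r) wtint (f i).
Proof.
move=> mf f0; elim: r => [|i r ih].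
  by rewrite big_nil -[RHS]wtint0; apply: eq_wtint => s; rewrite big_nil.
rewrite big_cons -ih -wtintD//.
- by apply: eq_wtint => s; rewrite big_cons.
- exact: smeas0_sum.
- by move=> s; exact: sume_ge0.
Qed.

Lemma wtintZl f (k : R) : smeas0 f -> (forall s, 0 <= f s) -> (0 <= k)%R ->
  wtint (fun s => k%:E * f s) = k%:E * wtint f.
Proof.
move=> mf f0 k0; rewrite /wtint -nneseriesZl//; last by move=> n _; exact: term_ge0.
by apply: eq_eseriesr => n _; rewrite tintZl// muleCA.
Qed.

Lemma measurable_wtint dY (Y : measurableType dY) (f : Y -> seq T -> \bar R) :
  smeas1 f -> (forall y s, 0 <= f y s) -> measurable_fun setT (fun y => wtint (f y)).
Proof.
move=> mf f0; apply: ge0_emeasurable_sum => [n y _ _|n _]; first exact: term_ge0.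
by apply: emeasurable_funM; [exact: measurable_cst|exact: measurable_tint].
Qed.

Lemma smeas1_wtint dY (Y : measurableType dY) (f : Y -> seq T -> seq T -> \bar R) :
  smeas2 f -> (forall y u v, 0 <= f y u v) -> smeas1 (fun y u => wtint (f y u)).
Proof.
move=> mf f0 m.
exact: (@measurable_wtint _ _ (fun (q : Y * m.-tuple T) v => f q.1 q.2 v)).
Qed.

(** The empty list has weight 1. Splitting it off is what later turns [a1] into [a1 - 1]. *)
Lemma wtint_split_nil f : (forall s, 0 <= f s) ->
  wtint f = f [::] + wtint (fun s => if s is [::] then 0 else f s).
Proof.
move=> f0; rewrite /wtint eseries_recl; last by move=> n; exact: term_ge0.
rewrite [in RHS]eseries_recl; last first.
  by move=> n; apply: term_ge0 => -[].
rewrite !tint0 /wt expr0 fact0 divr1 !mul1e add0e; congr (_ + _).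
by apply: eq_eseriesr => n _; congr (_ * _); apply: eq_tint => -[].
Qed.

(** Each partial sum on the left runs over the triangle k + m < N, which is part of the quadrant
    summed on the right. *)
Lemma eseries_triangle (B : nat -> nat -> \bar R) : (forall k m, 0 <= B k m) ->
  \sum_(n <oo) \sum_(k < n.+1) B k (n - k)%N <= \sum_(k <oo) \sum_(m <oo) B k m.
Proof.
move=> B0; have triE N : \sum_(0 <= n < N) \sum_(k < n.+1) B k (n - k)%N =
    \sum_(0 <= k < N) \sum_(0 <= m < N - k) B k m.
  elim: N => [|N ih]; first by rewrite !big_geq.
  rewrite big_nat_recr//= ih [RHS]big_nat_recr//= subSnn big_nat1.
  rewrite big_ord_recr/= subnn addeA; congr (_ + _).
  rewrite -(big_mkord xpredT (fun k => B k (N - k)%N)) -big_split/=.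
  apply: eq_big_nat => k /andP[_ kN].
  by rewrite subSn ?(ltnW kN)// big_nat_recr.
apply: lime_le.
  by apply: is_cvg_nneseries => n _ _; exact: sume_ge0.
apply: nearW => N; rewrite triE.
apply: le_trans (nneseries_lim_ge N _); last first.
  by move=> k _ _; apply: nneseries_ge0.
by apply: lee_sum => k _; apply: nneseries_lim_ge.
Qed.

(* The Minlos identity, as an inequality: splits with a common point are not
   discarded on the right. *)
Lemma wtint_splits_le (f : seq T -> seq T -> \bar R) :
  smeas2 (fun _ : unit => f) -> (forall u v, 0 <= f u v) ->
  wtint (fun s => \sum_(q <- splits s) f q.1 q.2) <=
  wtint (fun u => wtint (fun v => f u v)).
Proof.
move=> mf f0; pose b k m := tint mu k (fun u => tint mu m (fun v => f u v)).
have b0 k m : 0 <= b k m by do 2 (apply: tint_ge0 => ?).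
have mt m : smeas0 (fun u => tint mu m (fun v => f u v)).
  apply: (smeas1_fix tt (f := fun _ u => tint mu m (f u))).
  exact: smeas1_tint.
pose B k m := (wt k * wt m)%:E * b k m.
have B0 k m : 0 <= B k m by rewrite mule_ge0// lee_fin mulr_ge0// wt_ge0.
have -> : wtint (fun u => wtint (fun v => f u v)) = \sum_(k <oo) \sum_(m <oo) B k m.
  apply: eq_eseriesr => k _; rewrite /tint integral_nneseries//; last 2 first.
  - by move=> m; apply: emeasurable_funM; [exact: measurable_cst|exact: mt].
  - by move=> m u _; exact: term_ge0.
  rewrite -nneseriesZl; last first.
    by move=> m _; apply: integral_ge0 => u _; exact: term_ge0.
  apply: eq_eseriesr => m _; rewrite ge0_integralZl ?lee_fin ?wt_ge0//.
  - by rewrite muleA -EFinM.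
  - exact: mt.
  - by move=> u _; exact: tint_ge0.
apply: le_trans (eseries_triangle B0); rewrite le_eqVlt; apply/orP; left; apply/eqP.
apply: eq_eseriesr => n _; rewrite tint_splits// (@big_splits_size _ b)//.
rewrite ge0_sume_distrr; last by move=> k _; rewrite mule_ge0// lee_fin.
(* What remains is that [wt n] times the binomial coefficient is the product of [wt k] and
   [wt (n - k)]. *)
apply: eq_bigr => k _; rewrite muleA -EFinM; congr (_%:E * _).
have kn : (k <= n)%N by rewrite -ltnS.
rewrite /wt; have := bin_fact kn.
have fne m : (m`!%:R != 0 :> R)%R by rewrite pnatr_eq0 -lt0n fact_gt0.
have Cne : ('C(n, k)%:R != 0 :> R)%R by rewrite pnatr_eq0 -lt0n bin_gt0.
move=> /(congr1 (fun z => z%:R : R)%R); rewrite !natrM => bf.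
rewrite -{1}(subnKC kn) exprD -bf.
by field; rewrite !fne Cne.
Qed.

(** The Mecke identity: nothing can be picked from the empty list, and after the shift of the index
    (n + 1) [wt n.+1] is [c] times [wt n]. Read backwards it produces the divisor in a2 / C. *)
Lemma wtint_picks (f : T -> seq T -> \bar R) : smeas1 f -> (forall x s, 0 <= f x s) ->
  wtint (fun s => \sum_(q <- picks s) f q.1 q.2) =
  c%:E * wtint (fun s => \int[mu]_x f x s).
Proof.
move=> mf f0; rewrite /wtint eseries_recl; last first.
  by move=> n; apply: term_ge0 => s; exact: sume_ge0.
rewrite tint0/= big_nil mule0 add0e -nneseriesZl; last first.
  by move=> n _; apply: term_ge0 => s; exact: integral_ge0.
apply: eq_eseriesr => n _; rewrite tint_picks// tint_exchange// !muleA -!EFinM.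
congr (_%:E * _); rewrite /wt exprS factS natrM.
by field; rewrite nat1r !pnatr_eq0 -lt0n fact_gt0.
Qed.

End weighted_tuple_integral.

(** * The Lebesgue-Poisson measure *)

Section lebesgue_poisson_integral.
Context (R : realType) (dim : nat).
Local Notation Rd := (dim.-tuple R).
Local Notation Gamma0 := (Gamma0 R dim).
Local Notation lambda := (@lebesgue_poisson R dim).
Local Notation leb := (@leb R dim).

Definition Gamma0_of_seq (s : seq Rd) : Gamma0 := mkfset s.

(** A list with repetitions represents no point of the n-point space, so it receives the default
    [z]; the choice [z = 0] removes it from integrals. *)
Definition lift_Gamma0 {Z : Type} (z : Z) (f : Gamma0 -> Z) (s : seq Rd) : Z :=
  if uniq s then f (Gamma0_of_seq s) else z.

Lemma lift_Gamma0_smeas dZ (Z : measurableType dZ) (z : Z) (f : Gamma0 -> Z) :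
  measurable_fun setT f -> smeas0 (lift_Gamma0 z f).
Proof.
move=> mf n _ B mB; rewrite setTI.
have mfB : measurable (f @^-1` B) by rewrite -[X in measurable X]setTI; exact: mf.
have -> : (fun t : n.-tuple Rd => lift_Gamma0 z f t) @^-1` B =
    @distinct R dim n (f @^-1` B) `|`
    (~` [set t : n.-tuple Rd | uniq t] `&` [set _ | B z]).
  apply/seteqP; split => t; rewrite /lift_Gamma0 /distinct /preimage /=.
    by case: ifPn => ut Bt; [left|right; split => //; exact/negP].
  by case=> [[-> ]//|[/negP/negbTE ->]].
apply: measurableU; first exact: mfB.
apply: measurableI; first by apply: measurableC; exact: measurable_uniq.
have [Bz|Bz] := pselect (B z).
  by rewrite (_ : [set _ | _] = setT)//; apply/seteqP; split.
by rewrite (_ : [set _ | _] = set0)//; apply/seteqP; split.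
Qed.

(** Measurability on [Gamma0] is tested on pairwise distinct tuples only, so it is enough to agree
    there with a measurable function of lists. *)
Lemma measurable_Gamma0_seq dZ (Z : measurableType dZ) (g : seq Rd -> Z)
    (f : Gamma0 -> Z) : smeas0 g ->
  (forall s, uniq s -> f (Gamma0_of_seq s) = g s) -> measurable_fun setT f.
Proof.
move=> mg fg _ B mB; rewrite setTI; apply/measurable_Gamma0P => n.
have -> : @distinct R dim n (f @^-1` B) = [set t : n.-tuple Rd | uniq t] `&`
    (fun t : n.-tuple Rd => g t) @^-1` B.
  by apply/seteqP; split => t [ut] h; split => //; move: h => /=;
    rewrite -[config t]/(Gamma0_of_seq t) fg.
apply: measurableI; first exact: measurable_uniq.
by rewrite -[X in measurable X]setTI; exact: mg.
Qed.

Local Open Scope ereal_scope.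

(** On the set [D] of n-point configurations the measure is the image of the product measure under
    [phi], which is [config] on distinct tuples and the empty configuration elsewhere. Restriction
    to [D] discards the latter: the empty configuration lies in [D] only for [n = 0], where the only
    tuple is distinct. *)
Lemma integral_n_point n (f : Gamma0 -> \bar R) : measurable_fun setT f ->
  (forall eta, 0 <= f eta) ->
  \int[@n_point_measure R dim n]_eta f eta = tint leb n (lift_Gamma0 0 f).
Proof.
move=> mf f0.
pose D : set Gamma0 := [set eta | #|` eta| = n].
pose phi (t : n.-tuple Rd) : Gamma0 := lift_Gamma0 (fset0 : Gamma0) id t.
have mphi : measurable_fun setT phi by exact: lift_Gamma0_smeas.
have phiE (t : n.-tuple Rd) : uniq t -> phi t = config t.
  by rewrite /phi /lift_Gamma0 => ->.
have Dconfig (t : n.-tuple Rd) : uniq t -> D (config t).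
  by move=> ut; rewrite /D /= (card_mkfset ut) size_tuple.
have DE m : @distinct R dim m D = if m == n then [set t : m.-tuple Rd | uniq t] else set0.
  apply/seteqP; split => t.
    by move=> [ut]; rewrite /D /= (card_mkfset ut) size_tuple => /eqP ->.
  by case: ifPn => // /eqP mn ut; split => //; rewrite /D /= (card_mkfset ut) size_tuple.
have mD : measurable D.
  by apply/measurable_Gamma0P => m; rewrite DE; case: ifPn => // _; exact: measurable_uniq.
have phiD : phi @^-1` D = [set t : n.-tuple Rd | uniq t].
  apply/seteqP; split => t /=; last by move=> ut; rewrite phiE//; exact: Dconfig.
  rewrite /phi /lift_Gamma0; case: ifPn => // ut; rewrite /D /= => n0.
  by move: ut; rewrite (size0nil (s := t))// size_tuple.
have DN : n_point_measure n (~` D) = 0.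
  rewrite /n_point_measure (_ : @distinct _ _ _ _ = set0) ?measure0//.
  by apply/seteqP; split => // t [ut]; apply; exact: Dconfig.
transitivity (\int[@n_point_measure R dim n]_(eta in D) f eta).
  rewrite (ge0_negligible_integral (measurableC mD) measurableT)//.
  by rewrite setTD setCK.
transitivity (\int[pushforward (tuple_measure leb n) phi]_(eta in D) f eta).
  apply: eq_measure_integral => A mA AD; rewrite /n_point_measure /pushforward.
  congr (tuple_measure leb n _); apply/seteqP; split => t.
    by move=> [ut At]; rewrite /= phiE.
  move=> At; have ut : uniq t.
    by have := AD _ At; rewrite -[D _]/((phi @^-1` D) t) phiD.
  by split => //; rewrite -phiE.
rewrite ge0_integral_pushforward//; last exact: measurable_funTS.
rewrite phiD integral_mkcond; apply: eq_integral => t _.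
rewrite patchE mem_setE unfold_in /lift_Gamma0; have [ut|//] := boolP (uniq t) => /=.
by rewrite -[LHS]/(f (phi t)) phiE.
Qed.

Lemma lebesgue_poisson_integral (c : R) (f : Gamma0 -> \bar R) : (0 < c)%R ->
  measurable_fun setT f -> (forall eta, 0 <= f eta) ->
  \int[lambda]_eta (f eta * (c ^+ #|` eta|)%:E) = wtint leb c (lift_Gamma0 0 f).
Proof.
move=> c0 mf f0; have mw := @measurable_weight R dim (PosNum c0).
have mfw : measurable_fun setT (fun eta : Gamma0 => f eta * (c ^+ #|` eta|)%:E).
  by apply: emeasurable_funM => //; apply/measurable_EFinP.
have fw0 eta : 0 <= f eta * (c ^+ #|` eta|)%:E.
  by rewrite mule_ge0// lee_fin exprn_ge0// ltW.
rewrite ge0_integral_measure_series//; apply: eq_eseriesr => n _.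
rewrite ge0_integral_mscale//= integral_n_point//.
have c0n : (0 <= c ^+ n)%R by rewrite exprn_ge0// ltW.
rewrite (@eq_tint _ _ _ _ n _ (fun s => (c ^+ n)%:E * lift_Gamma0 0 f s)).
  rewrite tintZl//.
  - by rewrite muleA -EFinM mulrC.
  - exact: lift_Gamma0_smeas.
  - by move=> s; rewrite /lift_Gamma0; case: ifP.
move=> s sn; rewrite /lift_Gamma0; case: ifPn => us; last by rewrite mule0.
by rewrite (card_mkfset us) sn muleC.
Qed.

End lebesgue_poisson_integral.

(** * Measurability of rates and of their kernels on finite configurations *)

Section rate_measurability.
Context (R : realType) (dim : nat).
Local Notation Rd := (dim.-tuple R).
Local Notation Gamma := (Gamma R dim).
Local Notation Gamma0 := (Gamma0 R dim).
Local Notation lambda := (@lebesgue_poisson R dim).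
Local Notation leb := (@leb R dim).

Lemma measurable_mem_tuple n :
  measurable [set p : Rd * n.-tuple Rd | p.1 \in val p.2].
Proof.
have -> : [set p : Rd * n.-tuple Rd | p.1 \in val p.2] =
    \bigcup_(i in [set: 'I_n]) \bigcap_(k in [set: 'I_dim])
      [set p : Rd * n.-tuple Rd | tnth p.1 k = tnth (tnth p.2 i) k].
  apply/seteqP; split => -[x t] /=.
    by move=> /tnthP[i ->]; exists i.
  move=> [i _ h]; apply/tnthP; exists i; apply: eq_from_tnth => k.
  exact: h.
apply: fin_bigcup_measurable => // i _; apply: fin_bigcap_measurable => // k _.
rewrite [X in measurable X](_ : _ = setT `&`
  (fun p : Rd * n.-tuple Rd => tnth p.1 k == tnth (tnth p.2 i) k)
    @^-1` [set true]); last first.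
  by rewrite setTI; apply/seteqP; split => t /= /eqP.
apply: measurable_fun_eqr => //.
  by apply: (measurableT_comp (@measurable_tnth _ _ dim k)); exact: measurable_fst.
apply: (measurableT_comp (@measurable_tnth _ _ dim k)).
by apply: (measurableT_comp (@measurable_tnth _ _ n i)); exact: measurable_snd.
Qed.

Definition card_in (L : set Rd) (s : seq Rd) : nat :=
  #|` mkfset [seq x <- s | `[< L x >]]|.

Lemma card_in_cons L x s :
  card_in L (x :: s) = ((`[< L x >] && (x \notin s)) + card_in L s)%N.
Proof.
rewrite /card_in /=; case: ifPn => //= Lx; rewrite !card_fseq /= mem_filter Lx /=.
by case: (x \in s).
Qed.

(** A new head raises the count by one exactly when it lies in [L] and does not occur in the tail,
    so the count is a sum of indicators of measurable sets. *)
Lemma measurable_card_in (L : set Rd) : measurable L ->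
  smeas0 (fun s => (card_in L s)%:R : R).
Proof.
move=> mL n; elim: n => [|n ih].
  rewrite (_ : (fun t => _) = fun _ => (card_in L [::])%:R).
    exact: measurable_cst.
  by apply/funext => t; rewrite (tuple0 t).
pose A : set (Rd * n.-tuple Rd) := [set p | L p.1] `\` [set p | p.1 \in val p.2].
have mA : measurable A.
  apply: measurableD; last exact: measurable_mem_tuple.
  rewrite (_ : [set p | L p.1] = setT `&` fst @^-1` L); last by rewrite setTI.
  exact: measurable_fst.
have h : measurable_fun setT (fun p : (unit * Rd) * n.-tuple Rd =>
    (card_in L (p.1.2 :: p.2))%:R : R).
  rewrite (_ : (fun p => _) = (fun p : (unit * Rd) * n.-tuple Rd =>
      \1_A (p.1.2, p.2) + (card_in L p.2)%:R)).
    apply: measurable_funD; last by apply: (measurableT_comp ih); exact: measurable_snd.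
    apply: (measurableT_comp (measurable_indic mA)); apply: measurable_fun_pair.
      by apply: (measurableT_comp measurable_snd measurable_fst).
    exact: measurable_snd.
  apply/funext => -[[_ x] t] /=; rewrite card_in_cons natrD; congr (_ + _).
  rewrite indicE; congr (_ %:R); congr nat_of_bool.
  apply/idP/idP.
    by move=> /andP[/asboolP Lx /negP xt]; apply/mem_set.
  by move=> /set_mem[/= Lx /negP xt]; apply/andP; split => //; apply/asboolP.
have mu := smeas1_uncons (f := fun (_ : unit) s => (card_in L s)%:R : R) h.
apply: (measurableT_comp mu (g := fun t => (tt, t))).
by apply: measurable_fun_pair; [exact: measurable_cst|exact: measurable_id].
Qed.

Lemma Gamma_of_seqI (s : seq Rd) (L : set Rd) :
  sval (Gamma_of_Gamma0 (Gamma0_of_seq s)) `&` L =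
  [set` mkfset [seq x <- s | `[< L x >]]].
Proof.
apply/seteqP; split => x /=; rewrite !in_mkfset mem_filter.
  by move=> [xs /asboolP ->].
by move=> /andP[/asboolP].
Qed.

(** The sigma-algebra of [Gamma] is generated by the counting maps, and these become [card_in] on
    lists. *)
Lemma measurable_Gamma_of_seq :
  smeas0 (fun s : seq Rd => Gamma_of_Gamma0 (Gamma0_of_seq s)).
Proof.
move=> n; apply: (@measurability _ _ _ _ _ _ (@Gamma_cylinders R dim)) => //.
move=> _ [_ [L [k [mL _ ->]] <-]]; rewrite setTI.
have := measurable_card_in mL (n := n) measurableT (measurable_set1 (k%:R : R)).
rewrite setTI; congr (measurable _); apply/seteqP; split => t /=; rewrite Gamma_of_seqI.
  by move=> /eqP; rewrite eqr_nat => /eqP tk; apply/card_eq_fsetP.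
by move=> /card_eq_fsetP tk; congr (_%:R).
Qed.

Lemma measurable_rate0 (r : rate R dim) :
  measurable_fun setT (fun p : Rd * Gamma => r p.1 p.2) ->
  smeas1 (fun x s => rate0 r x (Gamma0_of_seq s)).
Proof.
move=> mr n; apply: (measurableT_comp mr (g := fun p : Rd * n.-tuple Rd =>
  (p.1, Gamma_of_Gamma0 (Gamma0_of_seq p.2)))).
apply: measurable_fun_pair; first exact: measurable_fst.
by apply: (measurableT_comp (@measurable_Gamma_of_seq n)); exact: measurable_snd.
Qed.

Lemma measurable_cat_tuple n m :
  measurable_fun setT (fun p : n.-tuple Rd * m.-tuple Rd => [tuple of p.1 ++ p.2]).
Proof.
apply/measurable_fun_tnthP => i.
rewrite (_ : _ \o _ = fun p : n.-tuple Rd * m.-tuple Rd =>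
  match fintype.split i with inl j => tnth p.1 j | inr j => tnth p.2 j end).
  case: fintype.split => j.
    by apply: (measurableT_comp (@measurable_tnth _ _ n j)); exact: measurable_fst.
  by apply: (measurableT_comp (@measurable_tnth _ _ m j)); exact: measurable_snd.
apply/funext => -[t u] /=; rewrite -[in LHS](splitK i); case: (fintype.split i) => j /=.
  by rewrite tnth_lshift.
by rewrite tnth_rshift.
Qed.

Section one_rate.
Variable r : rate R dim.
Hypothesis mr : measurable_fun setT (fun p : Rd * Gamma => r p.1 p.2).

(** K^-1 r(x, . u xi) at zeta, with [u] listing xi and [v] listing zeta. The second half of a split
    is the complement in zeta, whose size gives the sign. *)
Definition Kinv_seq (x : Rd) (u v : seq Rd) : R :=
  \sum_(q <- splits v) (-1) ^+ size q.2 * fine (rate0 r x (Gamma0_of_seq (q.1 ++ u))).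

Lemma Kinv_rate_seq x u v : uniq v ->
  Kinv_rate r x (Gamma0_of_seq u) (Gamma0_of_seq v) = Kinv_seq x u v.
Proof.
move=> uv; rewrite /Kinv_rate /Kinv /Kinv_seq (@big_fpowerset_splits _ _ _ _
  (fun A B : {fset Rd} => (-1) ^+ #|` B| * fine (rate0 r x (A `|` Gamma0_of_seq u)%fset)))//.
rewrite big_seq [RHS]big_seq; apply: eq_bigr => q qv.
have [_ u2 _] := uniq_splits uv qv.
by rewrite (card_mkfset u2) /Gamma0_of_seq mkfset_cat.
Qed.

Lemma measurable_Kinv_seq dW (W : measurableType dW) n m (x : W -> Rd)
    (u : W -> n.-tuple Rd) (v : W -> m.-tuple Rd) :
  measurable_fun setT x -> measurable_fun setT u -> measurable_fun setT v ->
  measurable_fun setT (fun w => Kinv_seq (x w) (u w) (v w)).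
Proof.
move=> mx mu mv.
have H : smeas1 (fun (p : Rd * n.-tuple Rd) s => Kinv_seq p.1 p.2 s).
  apply: (@smeas1_splitsr _ _ _ _ _ (fun (p : Rd * n.-tuple Rd) a b =>
    (-1) ^+ size b * fine (rate0 r p.1 (Gamma0_of_seq (a ++ p.2))))) => i j.
  rewrite (_ : (fun p => _) = (fun p : Rd * n.-tuple Rd * i.-tuple Rd * j.-tuple Rd =>
    (-1) ^+ j * fine (rate0 r p.1.1.1 (Gamma0_of_seq [tuple of p.1.2 ++ p.1.1.2])))).
    apply: measurable_funM; first exact: measurable_cst.
    apply: measurableT_comp => //.
    apply: (measurableT_comp (measurable_rate0 mr (n := (i + n)%N))
      (g := fun p : Rd * n.-tuple Rd * i.-tuple Rd * j.-tuple Rd =>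
        (p.1.1.1, [tuple of p.1.2 ++ p.1.1.2]))).
    have m11 : measurable_fun setT
        (fun p : Rd * n.-tuple Rd * i.-tuple Rd * j.-tuple Rd => p.1.1).
      by apply: (measurableT_comp measurable_fst measurable_fst).
    apply: measurable_fun_pair; first exact: (measurableT_comp measurable_fst m11).
    apply: (measurableT_comp (@measurable_cat_tuple i n)
      (g := fun p : Rd * n.-tuple Rd * i.-tuple Rd * j.-tuple Rd => (p.1.2, p.1.1.2))).
    apply: measurable_fun_pair; last exact: (measurableT_comp measurable_snd m11).
    by apply: (measurableT_comp measurable_snd measurable_fst).
  by apply/funext => p; rewrite size_tuple.
apply: (measurableT_comp (H m) (g := fun w => ((x w, u w), v w))).
by apply: measurable_fun_pair => //; exact: measurable_fun_pair.
Qed.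

Definition death_seq (s : seq Rd) : R :=
  \sum_(q <- picks s) fine (rate0 r q.1 (Gamma0_of_seq q.2)).

Lemma death_total_seq s : uniq s -> death_total r (Gamma0_of_seq s) = death_seq s.
Proof.
by move=> us; rewrite /death_total
  (@big_mkfset_picks _ _ _ _ (fun x A => fine (rate0 r x A))).
Qed.

Lemma measurable_death_seq : smeas0 death_seq.
Proof.
apply: (smeas1_fix tt (f := fun=> death_seq)).
apply: (@smeas1_picksr _ _ _ _ _
  (fun (_ : unit) x s => fine (rate0 r x (Gamma0_of_seq s)))) => n.
apply: measurableT_comp => //; apply: (measurableT_comp (measurable_rate0 mr (n := n))
  (g := fun p : unit * Rd * n.-tuple Rd => (p.1.2, p.2))).
apply: measurable_fun_pair; last exact: measurable_snd.
by apply: (measurableT_comp measurable_snd measurable_fst).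
Qed.

Lemma measurable_death_total : measurable_fun setT (death_total r).
Proof. exact: measurable_Gamma0_seq measurable_death_seq death_total_seq. Qed.

Definition Kinv_sum_seq (u v : seq Rd) : R :=
  \sum_(q <- picks u) Kinv_seq q.1 q.2 v.

Lemma Kinv_sum_rate_seq u v : uniq u -> uniq v ->
  \sum_(x <- Gamma0_of_seq u) Kinv_rate r x (Gamma0_of_seq u `\ x)%fset
    (Gamma0_of_seq v) = Kinv_sum_seq u v.
Proof.
move=> uu uv; rewrite (@big_mkfset_picks _ _ _ _
  (fun x A => Kinv_rate r x A (Gamma0_of_seq v)))//.
by apply: eq_bigr => q _; rewrite Kinv_rate_seq.
Qed.

Lemma Kinv_sum_seq_nil u : Kinv_sum_seq u [::] = death_seq u.
Proof.
by apply: eq_bigr => q _; rewrite /Kinv_seq /= big_seq1/= expr0 mul1r.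
Qed.

Lemma measurable_Kinv_sum_seq dY (Y : measurableType dY) :
  smeas2 (fun _ : Y => Kinv_sum_seq).
Proof.
move=> n m.
have H : smeas1 (fun (v : m.-tuple Rd) u => Kinv_sum_seq u v).
  apply: (@smeas1_picksr _ _ _ _ _ (fun (v : m.-tuple Rd) x u => Kinv_seq x u v)) => k.
  apply: measurable_Kinv_seq.
  - by apply: (measurableT_comp measurable_snd measurable_fst).
  - exact: measurable_snd.
  - by apply: (measurableT_comp measurable_fst measurable_fst).
apply: (measurableT_comp (H n) (g := fun p : Y * n.-tuple Rd * m.-tuple Rd => (p.2, p.1.2))).
apply: measurable_fun_pair; first exact: measurable_snd.
by apply: (measurableT_comp measurable_snd measurable_fst).
Qed.

End one_rate.

End rate_measurability.

(** * Complex integrals *)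

Section complex_integral.
Context d (T : measurableType d) (R : realType).
Variable mu : {measure set T -> \bar R}.
Local Notation normc := ComplexField.Normc.normc.

Definition cintegrable (f : T -> R[i]) :=
  cmeasurable f /\ (\int[mu]_x (normc (f x))%:E < +oo)%E.

Lemma cintegrable_Re f : cintegrable f -> mu.-integrable setT (EFin \o (fun x => complex.Re (f x))).
Proof.
move=> [mf foo]; apply/integrableP; split; first exact/measurable_EFinP/mf.1.
apply: le_lt_trans foo; apply: ge0_le_integral => //.
- by do 2 apply: measurableT_comp => //; exact: mf.1.
- exact/measurable_EFinP/measurable_normc.
- by move=> x _; rewrite lee_fin ler_Re_norm.
Qed.

Lemma cintegrable_Im f : cintegrable f -> mu.-integrable setT (EFin \o (fun x => complex.Im (f x))).
Proof.
move=> [mf foo]; apply/integrableP; split; first exact/measurable_EFinP/mf.2.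
apply: le_lt_trans foo; apply: ge0_le_integral => //.
- by do 2 apply: measurableT_comp => //; exact: mf.2.
- exact/measurable_EFinP/measurable_normc.
- by move=> x _; rewrite lee_fin ler_Im_norm.
Qed.

Lemma RintegralZD (f g : T -> R) (a b : R) :
  mu.-integrable setT (EFin \o f) -> mu.-integrable setT (EFin \o g) ->
  \int[mu]_x (a * f x + b * g x) = a * \int[mu]_x f x + b * \int[mu]_x g x.
Proof.
move=> fi gi; rewrite RintegralD//.
- by rewrite !RintegralZl.
- by have := integrableZl measurableT a fi; apply: eq_integrable => // x _.
- by have := integrableZl measurableT b gi; apply: eq_integrable => // x _.
Qed.

(* With I the integral, |I|^2 = Re I \int Re f + Im I \int Im f <= |I| \int |f|. *)
Lemma normc_Cintegral_le f : cmeasurable f ->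
  ((normc (Cintegral mu f))%:E <= \int[mu]_x (normc (f x))%:E)%E.
Proof.
move=> mf; have I0 : (0 <= \int[mu]_x (normc (f x))%:E)%E.
  by apply: integral_ge0 => x _; rewrite lee_fin normc_ge0.
have [foo|] := boolP (\int[mu]_x (normc (f x))%:E < +oo)%E; last first.
  by rewrite -leNgt leye_eq => /eqP ->; rewrite leey.
have fR := cintegrable_Re (conj mf foo); have fI := cintegrable_Im (conj mf foo).
have fN : mu.-integrable setT (EFin \o (fun x => normc (f x))).
  apply/integrableP; split; first exact/measurable_EFinP/measurable_normc.
  by under eq_integral do rewrite /= ger0_norm ?normc_ge0//.
set I := Cintegral mu f; have [/eqP ->|n0] := boolP (normc I == 0); first by [].
have n_gt0 : 0 < normc I by rewrite lt_neqAle eq_sym n0 normc_ge0.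
rewrite -[leRHS]fineK ?ge0_fin_numE// lee_fin -(ler_pM2l n_gt0).
rewrite -[fine _]/(\int[mu]_x normc (f x)) -RintegralZl//.
have -> : normc I * normc I = \int[mu]_x (complex.Re I * complex.Re (f x) +
    complex.Im I * complex.Im (f x)).
  rewrite RintegralZD// -expr2 /I /= sqr_sqrtr ?addr_ge0 ?sqr_ge0//.
apply: le_Rintegral => //.
- have := integrableD measurableT (integrableZl measurableT (complex.Re I) fR)
    (integrableZl measurableT (complex.Im I) fI).
  by apply: eq_integrable => // x _.
- by have := integrableZl measurableT (normc I) fN; apply: eq_integrable => // x _.
- move=> x _; case: I {n0 n_gt0} => a b; case: (f x) => p q /=.
  apply: (le_trans (ler_norm _)); rewrite -sqrtr_sqr -sqrtrM ?addr_ge0 ?sqr_ge0//.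
  rewrite ler_wsqrtr// -subr_ge0.
  by rewrite [leRHS](_ : _ = (a * q - b * p) ^+ 2) ?sqr_ge0//; ring.
Qed.

Lemma CintegralZD (f g : T -> R[i]) (a : R[i]) : cintegrable f -> cintegrable g ->
  Cintegral mu (fun x => a * f x + g x) = a * Cintegral mu f + Cintegral mu g.
Proof.
move=> fi gi; have [fR fI] := (cintegrable_Re fi, cintegrable_Im fi).
have [gR gI] := (cintegrable_Re gi, cintegrable_Im gi).
case: a => p q; rewrite /Cintegral; apply/eqP; rewrite eq_complex /=.
have hZD (u v w : T -> R) (c c' : R) : mu.-integrable setT (EFin \o u) ->
    mu.-integrable setT (EFin \o v) -> mu.-integrable setT (EFin \o w) ->
    \int[mu]_x (c * u x + c' * v x + w x) =
    c * \int[mu]_x u x + c' * \int[mu]_x v x + \int[mu]_x w x.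
  move=> ui vi wi; rewrite RintegralD//; first by rewrite RintegralZD.
  have := integrableD measurableT (integrableZl measurableT c ui)
    (integrableZl measurableT c' vi).
  by apply: eq_integrable => // x _.
apply/andP; split; apply/eqP.
- have := hZD _ _ _ p (- q) fR fI gR; rewrite /= mulNr => <-.
  apply: eq_Rintegral => x _ /=; case: (f x) (g x) => [? ?] [? ?] /=.
  by rewrite mulNr.
- have := hZD _ _ _ q p fR fI gI; rewrite /= [X in _ = X + _]addrC => <-.
  apply: eq_Rintegral => x _ /=; case: (f x) (g x) => [? ?] [? ?] /=.
  by congr (_ + _); rewrite addrC.
Qed.

End complex_integral.

(** Positive and negative parts are treated separately by Tonelli, which covers the parameters at
    which the integral diverges. *)
Lemma measurable_Rintegral_param dY (Y : measurableType dY) dT (T : measurableType dT)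
    (R : realType) (mu : {sigma_finite_measure set T -> \bar R}) (f : Y * T -> R) :
  measurable_fun setT f -> measurable_fun setT (fun y => \int[mu]_x f (y, x)).
Proof.
move=> mf; apply: measurableT_comp => //.
under [X in measurable_fun _ X]funext do rewrite integralE.
have mEf : measurable_fun setT (EFin \o f) by exact/measurable_EFinP.
apply: emeasurable_funB.
- rewrite [X in measurable_fun _ X](_ : _ = fubini_F mu ((EFin \o f)^\+)%E); last first.
    by apply/funext => y; apply: eq_integral => x _; rewrite !funeposE.
  by apply: measurable_fun_fubini_tonelli_F => //; exact: measurable_funepos.
- rewrite [X in measurable_fun _ X](_ : _ = fubini_F mu ((EFin \o f)^\-)%E); last first.
    by apply/funext => y; apply: eq_integral => x _; rewrite !funenegE.
  by apply: measurable_fun_fubini_tonelli_F => //; exact: measurable_funeneg.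
Qed.

(** * Bounds on the perturbation *)

(** This is where a positive dimension enters: [y] lies in the hyperplane of points with the same
    first coordinate, and that hyperplane is null. *)
Lemma ae_neq_leb (R : realType) (dim : nat) (y : dim.-tuple R) : (0 < dim)%N ->
  {ae @leb R dim, forall x, x <> y}.
Proof.
case: dim y => // n y _.
pose N : set (n.+1.-tuple R) := [set x | tnth x ord0 = tnth y ord0].
have mN : measurable N.
  rewrite (_ : N = setT `&` (fun x => tnth x ord0) @^-1` [set tnth y ord0]).
    exact: (@measurable_tnth _ _ n.+1 ord0).
  by rewrite setTI; apply/seteqP; split.
exists N; split => //; last first.
  by move=> x /= /contrapT ->.
rewrite /leb /= /cons_measure /pushforward.
rewrite (_ : _ @^-1` N = [set tnth y ord0] `*` setT).
  rewrite product_measure1E//.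
  have N0 : @lebR R [set tnth y ord0] = 0%E by exact: lebesgue_measure_set1.
  exact: etrans (congr1 (fun z => z * _)%E N0) (mul0e _).
by apply/seteqP; split => -[x t] //= [].
Qed.

Lemma ae_notin_leb (R : realType) (dim : nat) (s : seq (dim.-tuple R)) :
  (0 < dim)%N -> {ae @leb R dim, forall x, x \notin s}.
Proof.
move=> dim0; elim: s => [|y s ih]; first by apply: aeW.
apply: filterS2 ih (ae_neq_leb y dim0) => x xs xy.
by rewrite inE negb_or xs andbT; apply/eqP.
Qed.

(** * Adding a point to a configuration *)

Section insertion.
Context (R : realType) (dim : nat).
Local Notation Rd := (dim.-tuple R).
Local Notation Gamma0 := (Gamma0 R dim).

Lemma Gamma0_seq_surj (eta : Gamma0) :
  exists2 s : seq Rd, uniq s & eta = Gamma0_of_seq s.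
Proof.
exists (enum_fset eta); first exact: fset_uniq.
by apply/fsetP => x; rewrite in_mkfset.
Qed.

(** The case [x \in s], where the union is [s] itself, makes the list version agree with the
    function at every [x] and not only at almost every one. *)
Definition insert_Gamma0 {Z : Type} (z : Z) (f : Gamma0 -> Z) (x : Rd) (s : seq Rd) : Z :=
  if x \in s then lift_Gamma0 z f s else lift_Gamma0 z f (x :: s).

Lemma insert_Gamma0E (Z : Type) (z : Z) (f : Gamma0 -> Z) x s : uniq s ->
  insert_Gamma0 z f x s = f (x |` Gamma0_of_seq s)%fset.
Proof.
move=> us; rewrite /insert_Gamma0 /lift_Gamma0 /= us.
case: ifPn => xs; rewrite /= ?xs /=; congr f; last exact: mkfset_cons.
by apply/esym/fsetUidPr; rewrite fsub1set in_mkfset.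
Qed.

Lemma smeas1_insert_Gamma0 dZ (Z : measurableType dZ) (z : Z) (f : Gamma0 -> Z) :
  measurable_fun setT f -> smeas1 (insert_Gamma0 z f).
Proof.
move=> mf n; have ml := lift_Gamma0_smeas z mf.
apply: measurable_fun_ifT.
- apply: (measurable_fun_bool true); rewrite setTI.
  rewrite (_ : _ @^-1` _ = [set p : Rd * n.-tuple Rd | p.1 \in val p.2]).
    exact: measurable_mem_tuple.
  by apply/seteqP; split.
- by apply: (measurableT_comp (ml n)); exact: measurable_snd.
- have h := smeas0_cons ml (n := n). exact: h.
Qed.

Lemma measurable_insert (f : Gamma0 -> R) (xi : Gamma0) : measurable_fun setT f ->
  measurable_fun setT (fun x : Rd => f (x |` xi)%fset).
Proof.
move=> mf; have [s us ->] := Gamma0_seq_surj xi.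
under [X in measurable_fun _ X]funext do rewrite -(insert_Gamma0E (0 : R))//.
have := smeas1_insert_Gamma0 (0 : R) mf (n := size s) => h.
apply: (measurableT_comp h (g := fun x => (x, in_tuple s))).
by apply: measurable_fun_pair; [exact: measurable_id|exact: measurable_cst].
Qed.

End insertion.

(** * Pointwise bounds for Lhat + D *)

Section Lhat.
Context (R : realType) (dim : nat).
Local Notation Rd := (dim.-tuple R).
Local Notation Gamma0 := (Gamma0 R dim).
Local Notation lambda := (@lebesgue_poisson R dim).
Local Notation leb := (@leb R dim).
Local Notation normc := ComplexField.Normc.normc.
Variables (d b : rate R dim).
Hypothesis db : admissible_rates d b.
Hypothesis dim_gt0 : (0 < dim)%N.
Let md := death_measurable db.
Let mb := birth_measurable db.

Lemma death_total_ge0 (eta : Gamma0) : 0 <= death_total d eta.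
Proof. by apply: sumr_ge0 => x _; apply: fine_ge0; exact: (death_ge0 db). Qed.

(** The death kernel with the term zeta = eta \ xi empty removed, as that term is the multiplication
    by the total death rate. *)
Definition offdiag (xi zeta : Gamma0) : R := if zeta == fset0 then 0 else
  \sum_(x <- xi) Kinv_rate d x (xi `\ x)%fset zeta.

Definition birth_integrand (G : Gamma0 -> R[i]) (xi zeta : Gamma0) (x : Rd) : R[i] :=
  G (x |` xi)%fset * ((Kinv_rate b x xi zeta)%:C)%C.

Lemma cmeasurable_birth_integrand G xi zeta : cmeasurable G ->
  cmeasurable (birth_integrand G xi zeta).
Proof.
move=> mG; have mK : measurable_fun setT (fun x : Rd => Kinv_rate b x xi zeta).
  have [u uu ->] := Gamma0_seq_surj xi; have [v uv ->] := Gamma0_seq_surj zeta.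
  under [X in measurable_fun _ X]funext do rewrite Kinv_rate_seq//.
  exact: (measurable_Kinv_seq mb (n := size u) (m := size v)
    (u := fun=> in_tuple u) (v := fun=> in_tuple v)).
split.
- rewrite (_ : (fun x => _) = (fun x => complex.Re (G (x |` xi)%fset) * Kinv_rate b x xi zeta)).
    by apply: measurable_funM => //; exact: measurable_insert mG.1.
  by apply/funext => x; rewrite /birth_integrand; case: (G _) => p q /=;
    rewrite mulr0 subr0.
- rewrite (_ : (fun x => _) = (fun x => complex.Im (G (x |` xi)%fset) * Kinv_rate b x xi zeta)).
    by apply: measurable_funM => //; exact: measurable_insert mG.2.
  by apply/funext => x; rewrite /birth_integrand; case: (G _) => p q /=;
    rewrite mulr0 add0r.
Qed.

Lemma normc_birth_integrand G xi zeta x : normc (birth_integrand G xi zeta x) =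
  normc (G (x |` xi)%fset) * `|Kinv_rate b x xi zeta|.
Proof. by rewrite ComplexField.Normc.normcM normc_real. Qed.

Definition death_bound (G : Gamma0 -> R[i]) (eta : Gamma0) : \bar R :=
  (\sum_(xi <- fpowerset eta) (normc (G xi) * `|offdiag xi (eta `\` xi)%fset|)%:E)%E.

(** The value is an extended real, as the integral over the added point may diverge at some
    configurations. *)
Definition birth_bound (G : Gamma0 -> R[i]) (eta : Gamma0) : \bar R :=
  (\sum_(xi <- fpowerset eta)
    \int[leb]_x (normc (birth_integrand G xi (eta `\` xi)%fset x))%:E)%E.

Lemma Kinv_rate0 (r : rate R dim) x (xi : Gamma0) :
  Kinv_rate r x xi (fset0 : Gamma0) = fine (rate0 r x xi).
Proof.
rewrite /Kinv_rate /Kinv fpowerset0 big_seq_fset1 fset0D cardfs0 expr0 mul1r.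
by rewrite fset0U.
Qed.

(** For xi = eta the inverse transform is evaluated at the empty set, where it returns the rate
    itself; the term is therefore -D(eta) G(eta) and is cancelled by the added one. *)
Lemma Lhat_offdiag G (eta : Gamma0) :
  Lhat d b G eta + ((death_total d eta)%:C)%C * G eta =
  - (\sum_(xi <- fpowerset eta) G xi * ((offdiag xi (eta `\` xi)%fset)%:C)%C) +
  \sum_(xi <- fpowerset eta) Cintegral leb (birth_integrand G xi (eta `\` xi)%fset).
Proof.
rewrite /Lhat addrAC; congr (_ + _).
have eP : eta \in fpowerset eta by rewrite fpowersetE fsubset_refl.
rewrite (big_fsetD1 eta eP) [in RHS](big_fsetD1 eta eP)/=.
rewrite fsetDv /offdiag eqxx mulr0 add0r.
rewrite (eq_bigr (fun x => fine (rate0 d x (eta `\ x)%fset))); last first.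
  by move=> x _; rewrite Kinv_rate0.
rewrite -/(death_total d eta) opprD [- _ + - _]addrC -addrA [G eta * _]mulrC addNr addr0.
congr (- _); rewrite big_seq [RHS]big_seq; apply: eq_bigr => xi.
rewrite in_fsetD1 fpowersetE => /andP[xieta xisub].
rewrite ifN//; apply: contra xieta; rewrite fsetD_eq0 => etaxi.
by rewrite eqEfsubset xisub.
Qed.

Lemma normc_sum (I : Type) (r : seq I) (F : I -> R[i]) :
  normc (\sum_(i <- r) F i) <= \sum_(i <- r) normc (F i).
Proof.
elim/big_ind2 : _ => //; first by rewrite ComplexField.Normc.normc0.
by move=> z p w q zp wq; apply: (le_trans (le_normcD _ _)); exact: lerD.
Qed.

Lemma Lhat_pointwise_bound G eta : cmeasurable G ->
  ((normc (Lhat d b G eta + ((death_total d eta)%:C)%C * G eta))%:E <=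
   death_bound G eta + birth_bound G eta)%E.
Proof.
move=> mG; rewrite Lhat_offdiag.
apply: (@le_trans _ _ ((normc (\sum_(xi <- fpowerset eta)
    G xi * ((offdiag xi (eta `\` xi)%fset)%:C)%C))%:E +
  (normc (\sum_(xi <- fpowerset eta)
    Cintegral leb (birth_integrand G xi (eta `\` xi)%fset)))%:E)%E).
  by rewrite -EFinD lee_fin; apply: (le_trans (le_normcD _ _)); rewrite normcN.
apply: leeD.
  rewrite /death_bound sumEFin lee_fin; apply: (le_trans (normc_sum _ _)).
  by apply: ler_sum => xi _; rewrite ComplexField.Normc.normcM normc_real.
apply: (@le_trans _ _ (\sum_(xi <- fpowerset eta)
    (normc (Cintegral leb (birth_integrand G xi (eta `\` xi)%fset)))%:E)%E).
  by rewrite sumEFin lee_fin; exact: normc_sum.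
apply: lee_sum => xi _; apply: normc_Cintegral_le.
exact: cmeasurable_birth_integrand.
Qed.

(** Additivity of the complex integrals needs convergence, which the finite birth bounds supply for
    every subset xi of eta. *)
Lemma Lhat_linear_pointwise a G H eta : cmeasurable G -> cmeasurable H ->
  (birth_bound G eta < +oo)%E -> (birth_bound H eta < +oo)%E ->
  Lhat d b (fun xi => a * G xi + H xi) eta = a * Lhat d b G eta + Lhat d b H eta.
Proof.
move=> mG mH Goo Hoo.
have term_oo F xi : xi \in fpowerset eta -> (birth_bound F eta < +oo)%E ->
    (\int[leb]_x (normc (birth_integrand F xi (eta `\` xi)%fset x))%:E < +oo)%E.
  move=> xip; apply: le_lt_trans.
  rewrite /birth_bound (big_fsetD1 xi xip)/= leeDl// sume_ge0// => *.
  by apply: integral_ge0 => x _; rewrite lee_fin normc_ge0.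
rewrite /Lhat mulrDr mulrN addrACA -opprD; congr (- _ + _).
  rewrite mulr_sumr -big_split/=; apply: eq_bigr => xi _.
  by rewrite mulrDl mulrA.
rewrite mulr_sumr -big_split/= big_seq [RHS]big_seq; apply: eq_bigr => xi xip.
rewrite -CintegralZD.
- by congr Cintegral; apply/funext => x; rewrite mulrDl mulrA.
- by split; [exact: cmeasurable_birth_integrand|exact: term_oo].
- by split; [exact: cmeasurable_birth_integrand|exact: term_oo].
Qed.

End Lhat.

Section list_weights.
Context dT (T : measurableType dT).

Lemma smeas2_l dY (Y : measurableType dY) dZ (Z : measurableType dZ) (f : seq T -> Z) :
  smeas0 f -> smeas2 (fun (_ : Y) u (_ : seq T) => f u).
Proof.
move=> mf n m; apply: (measurableT_comp (mf n)).
by apply: (measurableT_comp measurable_snd measurable_fst).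
Qed.

Lemma smeas2_r dY (Y : measurableType dY) dZ (Z : measurableType dZ) (f : seq T -> Z) :
  smeas0 f -> smeas2 (fun (_ : Y) (_ : seq T) v => f v).
Proof. by move=> mf n m; apply: (measurableT_comp (mf m)); exact: measurable_snd. Qed.

Lemma wtint_exchange (R : realType) (mu : {sigma_finite_measure set T -> \bar R}) (c : R)
    (f : T -> seq T -> \bar R) : 0 < c -> smeas1 f -> (forall x s, 0 <= f x s)%E ->
  wtint mu c (fun s => \int[mu]_x f x s)%E = (\int[mu]_x wtint mu c (f x))%E.
Proof.
move=> c0 mf f0; have w0 n := wt_ge0 c0 n.
rewrite integral_nneseries//; last 2 first.
- move=> n; apply: emeasurable_funM; first exact: measurable_cst.
  exact: measurable_tint.
- by move=> n x _; rewrite mule_ge0 ?lee_fin// tint_ge0.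
apply: eq_eseriesr => n _; rewrite ge0_integralZl ?lee_fin//.
- by rewrite tint_exchange.
- exact: measurable_tint.
- by move=> x _; exact: tint_ge0.
Qed.

End list_weights.

(** * Weighted L1 bounds for the death and birth parts *)

Section Lhat_integral_bounds.
Context (R : realType) (dim : nat).
Local Notation Rd := (dim.-tuple R).
Local Notation Gamma0 := (Gamma0 R dim).
Local Notation lambda := (@lebesgue_poisson R dim).
Local Notation leb := (@leb R dim).
Local Notation normc := ComplexField.Normc.normc.
Variables (d b : rate R dim) (C : {posnum R}).
Hypothesis db : admissible_rates d b.
Hypothesis dim_gt0 : (0 < dim)%N.
Let md := death_measurable db.
Let mb := birth_measurable db.
Let C0 : 0 < C%:num := gt0 C.
Local Notation wint := (wtint leb C%:num).

Definition uniqR (s : seq Rd) : R := (uniq s)%:R.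

Lemma uniqR_ge0 s : 0 <= uniqR s. Proof. exact: ler0n. Qed.

Lemma measurable_uniqR : smeas0 uniqR.
Proof.
move=> n; rewrite (_ : (fun t => _) = \1_[set t : n.-tuple Rd | uniq t]); last first.
  by apply/funext => t; rewrite indicE mem_setE unfold_in.
by apply: measurable_indic; exact: measurable_uniq.
Qed.

(** Discards the splits with empty second half, the list form of passing to [offdiag]. *)
Definition nonnilR (s : seq Rd) : R := (s != [::])%:R.

Lemma measurable_nonnilR : smeas0 nonnilR.
Proof.
move=> n; rewrite (_ : (fun t => _) = fun=> (n != 0%N)%:R); first exact: measurable_cst.
apply/funext => t; rewrite /nonnilR -[X in _ = (X != _)%:R](size_tuple t).
by rewrite size_eq0.
Qed.

Section one_kernel.
Variable r : rate R dim.
Hypothesis mr : measurable_fun setT (fun p : Rd * Gamma R dim => r p.1 p.2).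

(** One summand of [Kinv_total], the integral of |K^-1 r(x, . u xi)| against C^|eta| dlambda(eta),
    with [u] listing xi. *)
Definition kernel_mass (x : Rd) (u : seq Rd) : \bar R :=
  wint (fun v => (uniqR v * `|Kinv_seq r x u v|)%:E).

Lemma kernel_mass_ge0 x u : (0 <= kernel_mass x u)%E.
Proof. by apply: wtint_ge0 => // v; rewrite lee_fin mulr_ge0// uniqR_ge0. Qed.

Lemma smeas2_kernel : smeas2 (fun (x : Rd) u v => (uniqR v * `|Kinv_seq r x u v|)%:E).
Proof.
move=> n m; apply/measurable_EFinP; apply: measurable_funM.
  by apply: (measurableT_comp (@measurable_uniqR m)); exact: measurable_snd.
apply: measurableT_comp => //; apply: measurable_Kinv_seq => //.
- by apply: (measurableT_comp measurable_fst measurable_fst).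
- by apply: (measurableT_comp measurable_snd measurable_fst).
Qed.

Lemma smeas1_kernel_mass : smeas1 kernel_mass.
Proof.
have h := @smeas1_wtint _ _ _ leb _ C0 _ _ _ smeas2_kernel.
by apply: h => x u v; rewrite lee_fin mulr_ge0// uniqR_ge0.
Qed.

Lemma Kinv_total_seq u : uniq u ->
  Kinv_total r C%:num (Gamma0_of_seq u) = (\sum_(q <- picks u) kernel_mass q.1 q.2)%E.
Proof.
move=> uu; rewrite /Kinv_total (@big_mkfset_picks _ _ _ _ (fun (x : Rd) (A : Gamma0) =>
  \int[lambda]_eta (`|Kinv_rate r x A eta| * C%:num ^+ #|` eta|)%:E)%E)//.
apply: eq_bigr => q _.
have mK : measurable_fun setT
    (fun eta : Gamma0 => `|Kinv_rate r q.1 (Gamma0_of_seq q.2) eta|%:E).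
  apply/measurable_EFinP; apply: measurableT_comp => //.
  apply: (@measurable_Gamma0_seq _ _ _ _ (Kinv_seq r q.1 q.2)) => [n|s us].
    exact: (measurable_Kinv_seq mr (x := fun=> q.1) (u := fun=> in_tuple q.2)).
  exact: Kinv_rate_seq.
rewrite (eq_integral (fun eta : Gamma0 =>
  `|Kinv_rate r q.1 (Gamma0_of_seq q.2) eta|%:E * (C%:num ^+ #|` eta|)%:E)%E)//.
rewrite lebesgue_poisson_integral//; apply: eq_wtint => v.
rewrite /lift_Gamma0 /uniqR; case: ifPn => uv; last by rewrite mul0r.
by rewrite mul1r Kinv_rate_seq.
Qed.

End one_kernel.

Variable G : Gamma0 -> R[i].
Hypothesis mG : cmeasurable G.

Let nG (eta : Gamma0) : R := normc (G eta).
Let LG (s : seq Rd) : R := lift_Gamma0 0 nG s.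

Let mnG : measurable_fun setT nG. Proof. exact: measurable_normc. Qed.

Let nG_ge0 eta : 0 <= nG eta. Proof. exact: normc_ge0. Qed.

Let LG_ge0 s : 0 <= LG s.
Proof. by rewrite /LG /lift_Gamma0; case: ifP. Qed.

Let mLG : smeas0 LG. Proof. exact: lift_Gamma0_smeas. Qed.

Let LG_uniq s : uniq s -> LG s = nG (Gamma0_of_seq s).
Proof. by rewrite /LG /lift_Gamma0 => ->. Qed.

Let death_kernel (u v : seq Rd) : R := nonnilR v * (uniqR v * `|Kinv_sum_seq d u v|).

Let death_kernel_ge0 u v : 0 <= death_kernel u v.
Proof. by rewrite !mulr_ge0. Qed.

Let smeas2_death_kernel dY (Y : measurableType dY) : smeas2 (fun _ : Y => death_kernel).
Proof.
move=> n m; apply: measurable_funM; first by have h := smeas2_r (Y := Y) measurable_nonnilR; exact: h.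
apply: measurable_funM; first by have h := smeas2_r (Y := Y) measurable_uniqR; exact: h.
apply: measurableT_comp => //; exact: measurable_Kinv_sum_seq.
Qed.

Let death_bound_seq s : uniq s -> death_bound d G (Gamma0_of_seq s) =
  (\sum_(q <- splits s) (LG q.1 * death_kernel q.1 q.2)%:E)%E.
Proof.
move=> us; rewrite /death_bound (@big_fpowerset_splits _ _ _ _
  (fun A B : Gamma0 => (nG A * `|offdiag d A B|)%:E))//.
rewrite big_seq [RHS]big_seq; apply: eq_bigr => q qs.
have [u1 u2 _] := uniq_splits us qs.
rewrite LG_uniq// /death_kernel /uniqR u2 mul1r; congr (_ * _)%:E.
rewrite /offdiag /nonnilR; have [->|q2] := eqVneq q.2 [::].
  by rewrite mkfset_nil eqxx normr0 mul0r.
rewrite ifN ?mul1r ?Kinv_sum_rate_seq//.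
apply: contra q2 => /eqP q20; rewrite -size_eq0 -(card_mkfset u2).
by rewrite [mkfset _]q20 cardfs0.
Qed.

Let smeas2_death : smeas2 (fun (_ : unit) u v => (LG u * death_kernel u v)%:E).
Proof.
move=> n m; apply/measurable_EFinP; apply: measurable_funM.
  by have h := smeas2_l (Y := unit) mLG; exact: h.
exact: smeas2_death_kernel.
Qed.

Lemma measurable_death_bound : measurable_fun setT (death_bound d G).
Proof.
apply: measurable_Gamma0_seq death_bound_seq.
apply: (smeas1_fix tt (f := fun _ s => (\sum_(q <- splits s) (LG q.1 * death_kernel q.1 q.2)%:E)%E)).
move=> n.
exact: (@smeas1_splits _ _ _ _ _ _ (fun _ u v => (LG u * death_kernel u v)%:E)).
Qed.

Lemma death_bound_ge0 eta : (0 <= death_bound d G eta)%E.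
Proof. by apply: sume_ge0 => xi _; rewrite lee_fin mulr_ge0// normc_ge0. Qed.

Local Notation normDG :=
  (fun eta : Gamma0 => (nG eta * death_total d eta)%:E).

(** The Minlos inequality decouples xi from zeta = eta \ xi. For fixed xi the kernel has mass at
    most a1 D(xi) over all zeta, of which the empty zeta takes exactly D(xi); the off-diagonal part
    keeps (a1 - 1) D(xi). *)
Lemma integral_death_bound (a1 : R) : 1 <= a1 ->
  (forall xi, Kinv_total d C%:num xi <= (a1 * death_total d xi)%:E)%E ->
  (\int[lambda]_eta (death_bound d G eta * (C%:num ^+ #|` eta|)%:E) <=
   (a1 - 1)%:E * \int[lambda]_eta (normDG eta * (C%:num ^+ #|` eta|)%:E))%E.
Proof.
move=> a1_ge1 hd; have mD := measurable_death_total md.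
have mnDG : measurable_fun setT normDG by apply/measurable_EFinP; exact: measurable_funM.
have nDG0 eta : (0 <= normDG eta)%E.
  by rewrite lee_fin mulr_ge0//; exact: death_total_ge0 db eta.
rewrite !lebesgue_poisson_integral//; last 2 first.
- exact: measurable_death_bound.
- exact: death_bound_ge0.
have mS : smeas0 (fun s => \sum_(q <- splits s) (LG q.1 * death_kernel q.1 q.2)%:E)%E.
  apply: (smeas1_fix tt (f := fun _ s => (\sum_(q <- splits s) (LG q.1 * death_kernel q.1 q.2)%:E)%E)).
  move=> n.
  exact: (@smeas1_splits _ _ _ _ _ _ (fun _ u v => (LG u * death_kernel u v)%:E)).
have a10 : 0 <= a1 - 1 by rewrite subr_ge0.
apply: (@le_trans _ _ (wint (fun s => \sum_(q <- splits s) (LG q.1 * death_kernel q.1 q.2)%:E)%E)).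
  apply: le_wtint => //.
  - by apply: lift_Gamma0_smeas; exact: measurable_death_bound.
  - by move=> s; rewrite /lift_Gamma0; case: ifP => // _; exact: death_bound_ge0.
  - by move=> s; apply: sume_ge0 => q _; rewrite lee_fin mulr_ge0.
  - move=> s; rewrite /lift_Gamma0; case: ifPn => us; first by rewrite death_bound_seq.
    by apply: sume_ge0 => q _; rewrite lee_fin mulr_ge0.
have minlos := @wtint_splits_le _ _ _ leb _ C0 _ smeas2_death.
apply: (le_trans (minlos _)); first by move=> u v; rewrite lee_fin mulr_ge0.
rewrite -wtintZl//; last 2 first.
- exact: lift_Gamma0_smeas.
- by move=> s; rewrite /lift_Gamma0; case: ifP.
have mdk u : smeas0 (fun v => (death_kernel u v)%:E).
  move=> m; apply/measurable_EFinP.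
  exact: (smeas1_fix (tt, in_tuple u) (smeas2_death_kernel (Y := unit) (n := size u))).
apply: le_wtint => //.
- apply: (smeas1_fix tt (f := fun _ u => wint (fun v => (LG u * death_kernel u v)%:E))).
  have h := @smeas1_wtint _ _ _ leb _ C0 _ _ _ smeas2_death.
  by apply: h => _ v w; rewrite lee_fin mulr_ge0.
- move=> n; apply: emeasurable_funM; first exact: measurable_cst.
  exact: lift_Gamma0_smeas.
- by move=> s; apply: wtint_ge0 => // v; rewrite lee_fin mulr_ge0.
- by move=> s; rewrite mule_ge0 ?lee_fin// /lift_Gamma0; case: ifP.
move=> u; under eq_fun do rewrite EFinM.
rewrite wtintZl//; last by move=> v; rewrite lee_fin.
rewrite /LG /lift_Gamma0; case: ifPn => uu; last by rewrite mul0e mule0.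
rewrite EFinM muleCA; apply: lee_wpmul2l; first by rewrite lee_fin.
have := hd (Gamma0_of_seq u); rewrite Kinv_total_seq//.
have mk (q : Rd * seq Rd) : smeas0 (fun v => (uniqR v * `|Kinv_seq d q.1 q.2 v|)%:E).
  exact: (smeas1_fix (q.1, in_tuple q.2) (smeas2_kernel md (n := size q.2))).
rewrite -wtint_sum//; last by move=> q v; rewrite lee_fin mulr_ge0.
have mKs : smeas0 (fun v => (uniqR v * `|Kinv_sum_seq d u v|)%:E).
  move=> m; apply/measurable_EFinP; apply: measurable_funM; first exact: measurable_uniqR.
  apply: measurableT_comp => //.
  exact: (smeas1_fix (tt, in_tuple u) (measurable_Kinv_sum_seq md (Y := unit) (n := size u))).
(* The hypothesis bounds the sum over x of absolute values, while the operator involves the absolute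
   value of the sum. *)
have h1 : (wint (fun v => (uniqR v * `|Kinv_sum_seq d u v|)%:E) <=
    wint (fun v => \sum_(q <- picks u) (uniqR v * `|Kinv_seq d q.1 q.2 v|)%:E))%E.
  apply: le_wtint => //.
  - exact: smeas0_sum.
  - by move=> v; rewrite lee_fin mulr_ge0.
  - by move=> v; apply: sume_ge0 => q _; rewrite lee_fin mulr_ge0.
  - move=> v; rewrite sumEFin lee_fin -mulr_sumr ler_wpM2l//.
    exact: ler_norm_sum.
(* The empty list contributes the total death rate at [u], the amount subtracted from [a1] times
   that rate. *)
move=> /(le_trans h1); rewrite wtint_split_nil//; last first.
  by move=> v; rewrite lee_fin mulr_ge0.
rewrite /uniqR/= mul1r Kinv_sum_seq_nil -death_total_seq//.
have D0 := death_total_ge0 db (Gamma0_of_seq u).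
rewrite ger0_norm// => h2; rewrite -[X in (_ <= X)%E]EFinM mulrBl mul1r EFinB.
rewrite leeBrDr// addeC; apply: le_trans h2; rewrite leeD2l//.
rewrite le_eqVlt; apply/orP; left; apply/eqP; apply: eq_wtint => -[|y v].
  by rewrite /death_kernel /nonnilR eqxx mul0r.
by rewrite /death_kernel /nonnilR /= mul1r.
Qed.

Let IG (x : Rd) (s : seq Rd) : R := insert_Gamma0 0 nG x s.

Let mIG : smeas1 IG. Proof. exact: smeas1_insert_Gamma0. Qed.

Let IG_ge0 x s : 0 <= IG x s.
Proof. by rewrite /IG /insert_Gamma0; case: ifP => _; exact: LG_ge0. Qed.

Let birth_kernel (x : Rd) (u v : seq Rd) : \bar R :=
  ((uniqR u * IG x u)%:E * (uniqR v * `|Kinv_seq b x u v|)%:E)%E.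

Let birth_kernel_ge0 x u v : (0 <= birth_kernel x u v)%E.
Proof. by rewrite mule_ge0// lee_fin mulr_ge0. Qed.

Let smeas2_birth_kernel : smeas2 birth_kernel.
Proof.
move=> n m; apply: emeasurable_funM; last first.
  by have h := smeas2_kernel mb; exact: h.
apply/measurable_EFinP; apply: measurable_funM.
  by have h := smeas2_l (Y := Rd) measurable_uniqR; exact: h.
have h := mIG (n := n); apply: (measurableT_comp h).
exact: measurable_fst.
Qed.

Let birth_int (u v : seq Rd) : \bar R := (\int[leb]_x birth_kernel x u v)%E.

Let birth_int_ge0 u v : (0 <= birth_int u v)%E.
Proof. exact: integral_ge0. Qed.

Let smeas2_birth_int : smeas2 (fun _ : unit => birth_int).
Proof.
move=> n m; apply: (@measurable_fun_fubini_tonelli_F _ _ _ _ _ leb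
  (fun p : (unit * n.-tuple Rd * m.-tuple Rd) * Rd => birth_kernel p.2 p.1.1.2 p.1.2)) => //.
have h0 := smeas2_birth_kernel; have h := h0 n m.
apply: (measurableT_comp h (g := fun p : (unit * n.-tuple Rd * m.-tuple Rd) * Rd =>
  ((p.2, p.1.1.2), p.1.2))).
have m11 : measurable_fun setT
    (fun p : (unit * n.-tuple Rd * m.-tuple Rd) * Rd => p.1.1).
  by apply: (measurableT_comp measurable_fst measurable_fst).
apply: measurable_fun_pair; last first.
  by apply: (measurableT_comp measurable_snd measurable_fst).
apply: measurable_fun_pair; first exact: measurable_snd.
by apply: (measurableT_comp measurable_snd m11).
Qed.

Let birth_bound_seq s : uniq s -> birth_bound b G (Gamma0_of_seq s) =
  (\sum_(q <- splits s) birth_int q.1 q.2)%E.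
Proof.
move=> us; rewrite /birth_bound (@big_fpowerset_splits _ _ _ _
  (fun A B : Gamma0 => \int[leb]_x (normc (birth_integrand b G A B x))%:E)%E)//.
rewrite big_seq [RHS]big_seq; apply: eq_bigr => q qs.
have [u1 u2 _] := uniq_splits us qs.
apply: eq_integral => x _; rewrite normc_birth_integrand /birth_kernel /uniqR u1 u2.
by rewrite !mul1r -EFinM /IG insert_Gamma0E// Kinv_rate_seq.
Qed.

Let smeas0_birth : smeas0 (fun s => \sum_(q <- splits s) birth_int q.1 q.2)%E.
Proof.
apply: (smeas1_fix tt (f := fun _ s => (\sum_(q <- splits s) birth_int q.1 q.2)%E)).
by move=> n; exact: (@smeas1_splits _ _ _ _ _ _ (fun=> birth_int)).
Qed.

Lemma measurable_birth_bound : measurable_fun setT (birth_bound b G).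
Proof. exact: measurable_Gamma0_seq smeas0_birth birth_bound_seq. Qed.

Lemma birth_bound_ge0 eta : (0 <= birth_bound b G eta)%E.
Proof.
by apply: sume_ge0 => xi _; apply: integral_ge0 => x _; rewrite lee_fin normc_ge0.
Qed.

(** Minlos separates xi and zeta, leaving integrals over xi, zeta and the added point x. Mecke, read
    backwards, absorbs x into xi: the integral over x becomes a sum over the points of the enlarged
    configuration, with a factor 1 / C, and |G| no longer depends on which point is distinguished.
    The hypothesis on the birth kernel then applies. *)
Lemma integral_birth_bound (a2 : R) : 0 < a2 ->
  (forall xi, Kinv_total b C%:num xi <= (a2 * death_total d xi)%:E)%E ->
  (\int[lambda]_eta (birth_bound b G eta * (C%:num ^+ #|` eta|)%:E) <=
   (a2 / C%:num)%:E * \int[lambda]_eta (normDG eta * (C%:num ^+ #|` eta|)%:E))%E.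
Proof.
move=> a2_gt0 hb; have mD := measurable_death_total md.
have mnDG : measurable_fun setT normDG by apply/measurable_EFinP; exact: measurable_funM.
have nDG0 eta : (0 <= normDG eta)%E.
  by rewrite lee_fin mulr_ge0//; exact: death_total_ge0 db eta.
rewrite !lebesgue_poisson_integral//; last 2 first.
- exact: measurable_birth_bound.
- exact: birth_bound_ge0.
apply: (@le_trans _ _ (wint (fun s => \sum_(q <- splits s) birth_int q.1 q.2)%E)).
  apply: le_wtint => //.
  - by apply: lift_Gamma0_smeas; exact: measurable_birth_bound.
  - by move=> s; rewrite /lift_Gamma0; case: ifP => // _; exact: birth_bound_ge0.
  - by move=> s; apply: sume_ge0.
  - move=> s; rewrite /lift_Gamma0; case: ifPn => us; first by rewrite birth_bound_seq.
    by apply: sume_ge0.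
have minlos := @wtint_splits_le _ _ _ leb _ C0 _ smeas2_birth_int.
apply: (le_trans (minlos birth_int_ge0)).
have mbk u : smeas1 (fun x v => birth_kernel x u v).
  move=> m; have h0 := smeas2_birth_kernel; have h := h0 (size u) m.
  apply: (measurableT_comp h (g := fun p : Rd * m.-tuple Rd => ((p.1, in_tuple u), p.2))).
  apply: measurable_fun_pair; last exact: measurable_snd.
  by apply: measurable_fun_pair; [exact: measurable_fst|exact: measurable_cst].
have mkm := smeas1_kernel_mass mb.
have mLGc : smeas1 (fun x u => LG (x :: u)) by exact: smeas0_cons.
(* [LG (x :: u)] replaces the inserted value: it vanishes when x already occurs in [u] and is
   symmetric in the whole list, as the passage to [picks] requires. *)
pose F (x : Rd) (u : seq Rd) := ((LG (x :: u))%:E * kernel_mass b x u)%E.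
have F0 x u : (0 <= F x u)%E by rewrite mule_ge0 ?lee_fin ?kernel_mass_ge0.
have mF : smeas1 F.
  move=> n; apply: emeasurable_funM; last exact: mkm.
  by apply/measurable_EFinP; exact: mLGc.
have -> : wint (fun u => wint (fun v => birth_int u v)) =
    wint (fun u => \int[leb]_x F x u)%E.
  apply: eq_wtint => u; rewrite /birth_int wtint_exchange//.
  have mku x : smeas0 (fun v => (uniqR v * `|Kinv_seq b x u v|)%:E).
    have h := smeas2_kernel mb (n := size u).
    exact: (smeas1_fix (x, in_tuple u) h).
  have wE x : wint (birth_kernel x u) = ((uniqR u * IG x u)%:E * kernel_mass b x u)%E.
    by rewrite wtintZl//; [move=> v; rewrite lee_fin mulr_ge0|rewrite mulr_ge0].
  apply: ge0_ae_eq_integral => //.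
  - exact: measurable_wtint.
  - apply: emeasurable_funM; last by exact: (smeas1_sect (n := size u)
      (g := fun=> in_tuple u) _ mkm).
    by apply/measurable_EFinP; exact: (smeas1_sect (n := size u)
      (g := fun=> in_tuple u) _ mLGc).
  - by move=> x _; exact: wtint_ge0.
  (* The two integrands can differ only when x is one of the points of [u], a null set of x. *)
  - apply: filterS (ae_notin_leb u dim_gt0) => x xu _; rewrite wE /F; congr (_%:E * _)%E.
    rewrite /IG /insert_Gamma0 ifN// /uniqR /LG /lift_Gamma0 /= xu /=.
    by case: (uniq u); rewrite ?mul1r ?mul0r.
have picksE : wint (fun s => \sum_(q <- picks s) F q.1 q.2)%E =
    (C%:num%:E * wint (fun u => \int[leb]_x F x u))%E by exact: wtint_picks.
have -> : wint (fun u => \int[leb]_x F x u)%E =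
    ((C%:num^-1)%:E * wint (fun s => \sum_(q <- picks s) F q.1 q.2))%E.
  by rewrite picksE muleA -EFinM mulVf ?mul1e// gt_eqF.
rewrite [(a2 / _)%R]mulrC EFinM -muleA.
apply: lee_wpmul2l; first by rewrite lee_fin invr_ge0 ltW.
rewrite -wtintZl//; last 3 first.
- exact: lift_Gamma0_smeas.
- by move=> s; rewrite /lift_Gamma0; case: ifP.
- exact: ltW.
(* By symmetry the value of G does not depend on which point was picked, so it factors out of the
   sum. *)
have LGp s (q : Rd * seq Rd) : q \in picks s -> LG (q.1 :: q.2) = LG s.
  move=> /mem_picks_perm pq; rewrite /LG /lift_Gamma0 (perm_uniq pq).
  by rewrite /Gamma0_of_seq (perm_mkfset pq).
have FE s : (\sum_(q <- picks s) F q.1 q.2 =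
    (LG s)%:E * \sum_(q <- picks s) kernel_mass b q.1 q.2)%E.
  rewrite ge0_sume_distrr; last by move=> q _; exact: kernel_mass_ge0.
  by rewrite big_seq [RHS]big_seq; apply: eq_bigr => q qs; rewrite /F (LGp s).
apply: le_wtint => //.
- apply: (smeas1_fix tt (f := fun _ s => (\sum_(q <- picks s) F q.1 q.2)%E)) => n.
  apply: (@smeas1_picks _ _ _ _ _ _ (fun=> F)) => m.
  have h := mF m; apply: (measurableT_comp h (g := fun p : unit * Rd * m.-tuple Rd =>
    (p.1.2, p.2))).
  apply: measurable_fun_pair; last exact: measurable_snd.
  by apply: (measurableT_comp measurable_snd measurable_fst).
- move=> n; apply: emeasurable_funM; first exact: measurable_cst.
  exact: lift_Gamma0_smeas.
- by move=> s; apply: sume_ge0.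
- by move=> s; rewrite mule_ge0 ?lee_fin ?(ltW a2_gt0)// /lift_Gamma0; case: ifP.
move=> s; rewrite FE /lift_Gamma0 /LG /lift_Gamma0; case: ifPn => us.
  rewrite -Kinv_total_seq// EFinM muleCA; apply: lee_wpmul2l; first by rewrite lee_fin.
  by rewrite -EFinM; exact: hb.
by rewrite mul0e mule0.
Qed.

End Lhat_integral_bounds.

(** * Lhat on functions: measurability, relative bound, compatibility with null sets *)

Section Lhat_operator.
Context (R : realType) (dim : nat).
Local Notation Rd := (dim.-tuple R).
Local Notation Gamma0 := (Gamma0 R dim).
Local Notation lambda := (@lebesgue_poisson R dim).
Local Notation leb := (@leb R dim).
Local Notation normc := ComplexField.Normc.normc.
Variables (d b : rate R dim) (C : {posnum R}).
Hypothesis db : admissible_rates d b.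
Hypothesis dim_gt0 : (0 < dim)%N.
Let md := death_measurable db.
Let mb := birth_measurable db.
Let C0 : 0 < C%:num := gt0 C.

(** The kernels are real, so the real and imaginary parts of [Lhat] come from the same real
    operator; measurability is proved once for both. *)
Definition Lhat_real (F : Gamma0 -> R) (eta : Gamma0) : R :=
  - (\sum_(xi <- fpowerset eta) F xi *
      \sum_(x <- xi) Kinv_rate d x (xi `\ x)%fset (eta `\` xi)%fset) +
  \sum_(xi <- fpowerset eta)
     \int[leb]_x (F (x |` xi)%fset * Kinv_rate b x xi (eta `\` xi)%fset).

Lemma measurable_Lhat_real F : measurable_fun setT F -> measurable_fun setT (Lhat_real F).
Proof.
move=> mF; pose LF := lift_Gamma0 0 F; pose IF := insert_Gamma0 0 F.
have mLF : smeas0 LF by exact: lift_Gamma0_smeas.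
have mIF : smeas1 IF by exact: smeas1_insert_Gamma0.
pose g (s : seq Rd) := - (\sum_(q <- splits s) LF q.1 * Kinv_sum_seq d q.1 q.2) +
  \sum_(q <- splits s) \int[leb]_x (IF x q.1 * Kinv_seq b x q.1 q.2).
apply: (@measurable_Gamma0_seq _ _ _ _ g); last first.
  move=> s us; rewrite /Lhat_real.
  rewrite (@big_fpowerset_splits _ _ _ _ (fun A B : Gamma0 => F A *
    \sum_(x <- A) Kinv_rate d x (A `\ x)%fset B))//.
  rewrite (@big_fpowerset_splits _ _ _ _ (fun A B : Gamma0 =>
    \int[leb]_x (F (x |` A)%fset * Kinv_rate b x A B)))//.
  congr (- _ + _); rewrite big_seq [RHS]big_seq; apply: eq_bigr => q qs;
    have [u1 u2 _] := uniq_splits us qs.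
    by rewrite -Kinv_sum_rate_seq// /LF /lift_Gamma0 u1.
  apply: eq_Rintegral => x _.
  by rewrite /IF insert_Gamma0E// Kinv_rate_seq.
move=> n; apply: measurable_funD.
  apply: measurableT_comp => //.
  apply: (smeas1_fix tt (f := fun _ s => \sum_(q <- splits s) LF q.1 * Kinv_sum_seq d q.1 q.2)).
  apply: (@smeas1_splitsr _ _ _ _ _ (fun _ u v => LF u * Kinv_sum_seq d u v)) => i j.
  apply: measurable_funM; first by have h := smeas2_l (Y := unit) mLF; exact: h.
  by have h := measurable_Kinv_sum_seq md (Y := unit); exact: h.
apply: (smeas1_fix tt (f := fun _ s =>
  \sum_(q <- splits s) \int[leb]_x (IF x q.1 * Kinv_seq b x q.1 q.2))).
apply: (@smeas1_splitsr _ _ _ _ _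
  (fun _ u v => \int[leb]_x (IF x u * Kinv_seq b x u v))) => i j.
apply: (@measurable_Rintegral_param _ _ _ _ _ leb
  (fun p : (unit * i.-tuple Rd * j.-tuple Rd) * Rd =>
     IF p.2 p.1.1.2 * Kinv_seq b p.2 p.1.1.2 p.1.2)).
have m112 : measurable_fun setT
    (fun p : (unit * i.-tuple Rd * j.-tuple Rd) * Rd => p.1.1.2).
  apply: (measurableT_comp measurable_snd).
  by apply: (measurableT_comp measurable_fst measurable_fst).
apply: measurable_funM.
  apply: (measurableT_comp (mIF i)
    (g := fun p : (unit * i.-tuple Rd * j.-tuple Rd) * Rd => (p.2, p.1.1.2))).
  by apply: measurable_fun_pair; first exact: measurable_snd.
have m12 : measurable_fun setT
    (fun p : (unit * i.-tuple Rd * j.-tuple Rd) * Rd => p.1.2).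
  by apply: (measurableT_comp measurable_snd measurable_fst).
have m2 : measurable_fun setT
    (fun p : (unit * i.-tuple Rd * j.-tuple Rd) * Rd => p.2).
  exact: measurable_snd.
have h := measurable_Kinv_seq mb m2 m112 m12; exact: h.
Qed.

Lemma cmeasurable_Lhat G : cmeasurable G -> cmeasurable (Lhat d b G).
Proof.
move=> [mR mI]; split.
- rewrite (_ : (fun x => _) = Lhat_real (fun xi => complex.Re (G xi))).
    exact: measurable_Lhat_real.
  apply/funext => eta; rewrite /Lhat /Lhat_real raddfD raddfN !raddf_sum /=.
  congr (_ + _); apply: eq_bigr => xi _ /=.
    by case: (G xi) => p q /=; rewrite mulr0 subr0.
  apply: eq_Rintegral => x _; case: (G _) => p q /=; by rewrite mulr0 subr0.
- rewrite (_ : (fun x => _) = Lhat_real (fun xi => complex.Im (G xi))).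
    exact: measurable_Lhat_real.
  apply/funext => eta; rewrite /Lhat /Lhat_real raddfD raddfN !raddf_sum /=.
  congr (_ + _); apply: eq_bigr => xi _ /=.
    by case: (G xi) => p q /=; rewrite mulr0 add0r.
  apply: eq_Rintegral => x _; case: (G _) => p q /=; by rewrite mulr0 add0r.
Qed.

Definition death_mul (G : Gamma0 -> R[i]) (eta : Gamma0) : R[i] :=
  ((death_total d eta)%:C)%C * G eta.

Lemma normc_death_mul G eta : normc (death_mul G eta) = death_total d eta * normc (G eta).
Proof.
by rewrite ComplexField.Normc.normcM normc_real ger0_norm//; exact: death_total_ge0 db eta.
Qed.

Lemma cmeasurable_mulr (f : Gamma0 -> R) (G : Gamma0 -> R[i]) :
  measurable_fun setT f -> cmeasurable G ->
  cmeasurable (fun eta => ((f eta)%:C)%C * G eta).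
Proof.
move=> mf [mR mI]; split.
- rewrite (_ : (fun x => _) = (fun x => f x * complex.Re (G x))).
    exact: measurable_funM.
  by apply/funext => x; case: (G x) => p q /=; rewrite mul0r subr0.
- rewrite (_ : (fun x => _) = (fun x => f x * complex.Im (G x))).
    exact: measurable_funM.
  by apply/funext => x; case: (G x) => p q /=; rewrite mul0r addr0.
Qed.

Lemma cmeasurable_death_mul G : cmeasurable G -> cmeasurable (death_mul G).
Proof. by move=> mG; apply: cmeasurable_mulr => //; exact: measurable_death_total md. Qed.

Lemma LC_norm_death_mul G : LC_norm C (death_mul G) =
  (\int[lambda]_eta ((normc (G eta) * death_total d eta)%:E *
    (C%:num ^+ #|` eta|)%:E))%E.
Proof.
apply: eq_integral => eta _; rewrite normc_death_mul -EFinM; congr (_ * _)%:E.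
exact: mulrC.
Qed.

Section bounds.
Variables a1 a2 : R.
Hypothesis a1_ge1 : 1 <= a1.
Hypothesis a2_gt0 : 0 < a2.
Hypothesis hd : forall xi : Gamma0,
  (Kinv_total d C%:num xi <= (a1 * death_total d xi)%:E)%E.
Hypothesis hb : forall xi : Gamma0,
  (Kinv_total b C%:num xi <= (a2 * death_total d xi)%:E)%E.

Lemma LC_norm_perturbation G : cmeasurable G ->
  (LC_norm C (fun eta => (Lhat d b G eta + death_mul G eta)%R) <=
   (a1 - 1 + a2 / C%:num)%:E * LC_norm C (death_mul G))%E.
Proof.
move=> mG; have mw := @measurable_weight R dim C.
have w0 (eta : Gamma0) : (0 <= (C%:num ^+ #|` eta|)%:E)%E by rewrite lee_fin exprn_ge0.
have mdb := measurable_death_bound db mG.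
have mbb := measurable_birth_bound db mG.
have db0 := death_bound_ge0 d G; have bb0 := birth_bound_ge0 b G.
apply: (@le_trans _ _ (\int[lambda]_eta (death_bound d G eta * (C%:num ^+ #|` eta|)%:E +
    birth_bound b G eta * (C%:num ^+ #|` eta|)%:E))%E).
  apply: ge0_le_integral => //.
  - move=> eta _; rewrite lee_fin mulr_ge0 ?normc_ge0 ?exprn_ge0//.
  - apply: measurable_LC_integrand.
    rewrite (_ : (fun eta => _) = fun eta => 1 * Lhat d b G eta + death_mul G eta).
      apply: cmeasurableZD; first exact: cmeasurable_Lhat.
      exact: cmeasurable_death_mul.
    by apply/funext => eta; rewrite mul1r.
  - apply: emeasurable_funD; apply: emeasurable_funM => //; exact/measurable_EFinP.
  - move=> eta _; rewrite EFinM -ge0_muleDl//; apply: lee_wpmul2r => //.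
    exact: Lhat_pointwise_bound.
rewrite ge0_integralD//; last 4 first.
- by move=> eta _; rewrite mule_ge0.
- by apply: emeasurable_funM => //; exact/measurable_EFinP.
- by move=> eta _; rewrite mule_ge0.
- by apply: emeasurable_funM => //; exact/measurable_EFinP.
rewrite LC_norm_death_mul EFinD ge0_muleDl ?lee_fin ?subr_ge0//; last first.
  by rewrite divr_ge0// ltW.
apply: leeD.
  exact: (integral_death_bound db mG a1_ge1 hd).
exact: (integral_birth_bound db dim_gt0 mG a2_gt0 hb).
Qed.

(** The integrated birth bound is finite as soon as D G is integrable, so the birth integrals
    converge at almost every configuration. This is what makes [Lhat] linear almost everywhere on
    its domain. *)
Lemma ae_birth_bound_lty G : cmeasurable G -> (LC_norm C (death_mul G) < +oo)%E ->
  {ae lambda, forall eta, birth_bound b G eta < +oo}%E.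
Proof.
move=> mG DG; have mw := @measurable_weight R dim C.
have w0 (eta : Gamma0) : 0 < C%:num ^+ #|` eta| by rewrite exprn_gt0.
have bb0 := birth_bound_ge0 b G.
have : {ae lambda, forall eta, birth_bound b G eta * (C%:num ^+ #|` eta|)%:E < +oo}%E.
  apply: ge0_integral_lty_ae.
  - apply: emeasurable_funM; last exact/measurable_EFinP.
    by have h := measurable_birth_bound db mG; exact: h.
  - by move=> eta; rewrite mule_ge0// lee_fin ltW.
  - apply: (le_lt_trans (integral_birth_bound db dim_gt0 mG a2_gt0 hb)).
    rewrite -LC_norm_death_mul lte_mul_pinfty// lee_fin divr_ge0// ltW//.
apply: filterS => eta h; rewrite ltNge leye_eq; apply/negP => /eqP bb.
by move: h; rewrite bb gt0_mulye// lte_fin.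
Qed.

Lemma Lhat_linear_ae a G H : cmeasurable G -> cmeasurable H ->
  (LC_norm C (death_mul G) < +oo)%E -> (LC_norm C (death_mul H) < +oo)%E ->
  {ae lambda, forall eta,
    Lhat d b (fun xi => a * G xi + H xi) eta = a * Lhat d b G eta + Lhat d b H eta}.
Proof.
move=> mG mH DG DH.
apply: filterS2 (ae_birth_bound_lty mG DG) (ae_birth_bound_lty mH DH) => eta hG hH.
exact: Lhat_linear_pointwise.
Qed.

Lemma LC_norm_eq0_ae G : cmeasurable G -> LC_norm C G = 0%E ->
  {ae lambda, forall eta, G eta = 0}.
Proof.
move=> mG G0; have mI := measurable_LC_integrand C mG.
have : (\int[lambda]_eta `|(normc (G eta) * C%:num ^+ #|` eta|)%:E| = 0)%E.
  rewrite -[RHS]G0; apply: eq_integral => eta _; rewrite gee0_abs//.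
  by rewrite lee_fin mulr_ge0 ?exprn_ge0// normc_ge0.
move/(ae_eq_integral_abs _ measurableT mI); apply: filterS => eta /= /(_ I).
move=> [] /eqP; rewrite mulf_eq0 expf_eq0 (gt_eqF C0) andbF orbF => /eqP.
exact: ComplexField.Normc.eq0_normc.
Qed.

Lemma LC_norm_ae G H : cmeasurable G -> cmeasurable H ->
  {ae lambda, forall eta, G eta = H eta} -> LC_norm C G = LC_norm C H.
Proof.
move=> mG mH GH; apply: ae_eq_integral => //; try exact: measurable_LC_integrand.
by apply: filterS GH => eta /= -> _.
Qed.

(** For the null difference [K] the function D K has norm zero, so the relative bound forces Lhat K
    + D K to vanish almost everywhere. Linearity then compares G and H. *)
Lemma Lhat_ae G H : cmeasurable G -> cmeasurable H ->
  (LC_norm C (death_mul G) < +oo)%E -> (LC_norm C (death_mul H) < +oo)%E ->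
  {ae lambda, forall eta, G eta = H eta} ->
  {ae lambda, forall eta, Lhat d b G eta = Lhat d b H eta}.
Proof.
move=> mG mH DG DH GH.
pose K eta := -1 * H eta + G eta; have mK : cmeasurable K by exact: cmeasurableZD.
have K0 : {ae lambda, forall eta, K eta = 0}.
  by apply: filterS GH => eta e; rewrite /K e mulN1r addNr.
have DK : LC_norm C (death_mul K) = 0%E.
  rewrite -(LC_norm0 dim C); apply: LC_norm_ae.
  - exact: cmeasurable_death_mul.
  - exact: cmeasurable0.
  - by apply: filterS K0 => eta; rewrite /death_mul => ->; rewrite mulr0.
have LK0 : LC_norm C (fun eta => Lhat d b K eta + death_mul K eta) = 0%E.
  apply/eqP; rewrite eq_le LC_norm_ge0 andbT.
  by apply: (le_trans (LC_norm_perturbation mK)); rewrite DK mule0.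
have mLK : cmeasurable (fun eta => Lhat d b K eta + death_mul K eta).
  rewrite (_ : (fun eta => _) = fun eta => 1 * Lhat d b K eta + death_mul K eta).
    apply: cmeasurableZD; first exact: cmeasurable_Lhat.
    exact: cmeasurable_death_mul.
  by apply/funext => eta; rewrite mul1r.
have H1 := LC_norm_eq0_ae mLK LK0.
have H2 := Lhat_linear_ae (-1) mH mG DH DG.
apply: filterS3 H1 H2 K0 => eta /= e1 e2 e3.
move: e1; rewrite /death_mul e3 mulr0 addr0 /K e2 mulN1r addrC => /eqP.
by rewrite subr_eq0 => /eqP.
Qed.

End bounds.

End Lhat_operator.

(** * The generator *)

Section to_LC.
Context (R : realType) (dim : nat) (C : {posnum R}).
Local Notation Gamma0 := (Gamma0 R dim).
Local Notation lambda := (@lebesgue_poisson R dim).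
Local Notation normc := ComplexField.Normc.normc.
Local Notation LC := (LC dim C).

(** Total, with value 0 off the space, so that unbounded operators can be written as plain functions
    on [LC]. *)
Definition to_LC (F : Gamma0 -> R[i]) : LC :=
  if pselect (F \in in_LC C) is left h then LC_class (PreLC h) else 0.

Lemma to_LCE F (h : F \in in_LC C) : to_LC F = LC_class (PreLC h).
Proof.
rewrite /to_LC; case: pselect => // h'.
by congr LC_class; apply: val_inj.
Qed.

Lemma to_LCK (g : LC) : to_LC (LC_fun g) = g.
Proof.
rewrite (to_LCE (valP (LC_fun g))) -[RHS]LC_funK; congr LC_class.
exact: val_inj.
Qed.

Lemma LC_fun_to_LC F : F \in in_LC C -> {ae lambda, forall eta, LC_fun (to_LC F) eta = F eta}.
Proof. by move=> h; rewrite (to_LCE h); exact: (LC_fun_class (PreLC h)). Qed.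

Lemma rnorm_to_LC F : F \in in_LC C -> (rnorm (to_LC F))%:E = LC_norm C F.
Proof. by move=> h; rewrite (to_LCE h) rnorm_LC_classE. Qed.

Lemma eq_to_LC (F F' : Gamma0 -> R[i]) : F \in in_LC C -> F' \in in_LC C ->
  {ae lambda, forall eta, F eta = F' eta} -> to_LC F = to_LC F'.
Proof.
by move=> h h' FF'; rewrite (to_LCE h) (to_LCE h'); apply/LC_class_eq.
Qed.

Lemma in_LC_linear a (F F' : Gamma0 -> R[i]) : F \in in_LC C -> F' \in in_LC C ->
  (fun eta => a * F eta + F' eta) \in in_LC C.
Proof.
by move=> h h'; have [_ cl] := in_LC_submod dim C; have := cl a F F' h h'.
Qed.

Lemma to_LC_linear a (F F' : Gamma0 -> R[i]) : F \in in_LC C -> F' \in in_LC C ->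
  to_LC (fun eta => a * F eta + F' eta) = a *: to_LC F + to_LC F'.
Proof.
move=> h h'; rewrite (to_LCE (in_LC_linear a h h')) (to_LCE h) (to_LCE h').
by rewrite -LC_classZ -LC_classD; congr LC_class; apply: val_inj.
Qed.

Lemma in_LC_ae (F F' : Gamma0 -> R[i]) : cmeasurable F -> F' \in in_LC C ->
  {ae lambda, forall eta, F eta = F' eta} -> F \in in_LC C.
Proof.
move=> mF /in_LCP[mF' F'oo] FF'; apply/in_LCP; split => //.
by rewrite (LC_norm_ae _ mF mF').
Qed.

Lemma LC_norm_le (F F' : Gamma0 -> R[i]) : cmeasurable F -> cmeasurable F' ->
  (forall eta, normc (F eta) <= normc (F' eta)) -> (LC_norm C F <= LC_norm C F')%E.
Proof.
move=> mF mF' FF'; apply: ge0_le_integral => //.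
- by move=> eta _; rewrite lee_fin mulr_ge0 ?normc_ge0 ?exprn_ge0.
- exact: measurable_LC_integrand.
- exact: measurable_LC_integrand.
- by move=> eta _; rewrite lee_fin ler_wpM2r// exprn_ge0.
Qed.

Lemma LC_fun_linear a (g h : LC) : {ae lambda, forall eta,
  LC_fun (a *: g + h) eta = a * LC_fun g eta + LC_fun h eta}.
Proof.
have gin := valP (LC_fun g); have hin := valP (LC_fun h).
apply: filterS (LC_fun_to_LC (in_LC_linear a gin hin)) => eta.
by rewrite to_LC_linear// !to_LCK.
Qed.

End to_LC.

(** * The death multiplication and its perturbation as operators on classes *)

Section Lhat_generator.
Context (R : realType) (dim : nat).
Local Notation Gamma0 := (Gamma0 R dim).
Local Notation lambda := (@lebesgue_poisson R dim).
Local Notation normc := ComplexField.Normc.normc.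
Variables (d b : rate R dim) (C : {posnum R}).
Hypothesis db : admissible_rates d b.
Hypothesis dim_gt0 : (0 < dim)%N.
Local Notation LC := (LC dim C).
Local Notation Dom := (Lhat_dom d (C := C)).
Let md := death_measurable db.

Let D_ge0 eta : 0 <= death_total d eta := death_total_ge0 db eta.
Let mD : measurable_fun setT (death_total d) := measurable_death_total md.

Let mfun (g : LC) : cmeasurable (LC_fun g) := (preLCP (LC_fun g)).1.

(** [Lhat_dom] is phrased with a chosen representative; any other measurable representative decides
    membership equally well. *)
Lemma Lhat_domP (g : LC) (F : Gamma0 -> R[i]) : cmeasurable F ->
  {ae lambda, forall eta, LC_fun g eta = F eta} ->
  Dom g <-> death_mul d F \in in_LC C.
Proof.
move=> mF gF; have aeD : {ae lambda, forall eta, death_mul d (LC_fun g) eta = death_mul d F eta}.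
  by apply: filterS gF => eta; rewrite /death_mul => ->.
split => h.
  apply: (in_LC_ae (cmeasurable_death_mul db mF) h).
  by apply: filterS aeD => eta e; exact: esym e.
exact: (in_LC_ae (cmeasurable_death_mul db (mfun g)) h).
Qed.

Lemma death_mul_linear a (F G : Gamma0 -> R[i]) eta :
  death_mul d (fun xi => a * F xi + G xi) eta = a * death_mul d F eta + death_mul d G eta.
Proof. by rewrite /death_mul; ring. Qed.

Lemma Lhat_dom_linear a (g h : LC) : Dom g -> Dom h -> Dom (a *: g + h).
Proof.
move=> Dg Dh; apply/(Lhat_domP _ (LC_fun_linear a g h)).
  exact: cmeasurableZD.
rewrite (_ : death_mul _ _ = fun eta => a * death_mul d (LC_fun g) eta +
  death_mul d (LC_fun h) eta); first exact: in_LC_linear.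
by apply/funext => eta; exact: death_mul_linear.
Qed.

Lemma Lhat_dom0 : Dom 0.
Proof.
apply/(@Lhat_domP _ (fun=> 0)); first exact: cmeasurable0.
  have z : (0 : Gamma0 -> R[i]) \in in_LC C by exact: (in_LC_submod dim C).1.
  have := LC_fun_to_LC z; rewrite (_ : to_LC C 0 = 0)//.
  have := @to_LC_linear _ _ C (-1) 0 0 z z; rewrite scaleN1r addNr => <-.
  by congr to_LC; apply/funext => eta; rewrite mulr0 addr0.
rewrite (_ : death_mul _ _ = 0); first exact: (in_LC_submod dim C).1.
by apply/funext => eta; rewrite /death_mul mulr0.
Qed.

Definition death_op (g : LC) : LC := to_LC C (death_mul d (LC_fun g)).

Lemma death_op_linear a (g h : LC) : Dom g -> Dom h ->
  death_op (a *: g + h) = a *: death_op g + death_op h.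
Proof.
move=> Dg Dh; rewrite /death_op -to_LC_linear//.
apply: eq_to_LC; first exact: Lhat_dom_linear.
  exact: in_LC_linear.
apply: filterS (LC_fun_linear a g h) => eta e.
by rewrite -death_mul_linear /death_mul e.
Qed.

(** On the cone Re z is at least |z| / 2; this is the origin of the 1/2 with which [w] is
    compared. *)
Lemma ler_normc_1D (z : R[i]) (r : R) : cone z -> 0 <= r ->
  1 + normc z / 2 * r <= normc (1 + z * (r%:C)%C).
Proof.
move=> Kz r0; apply: le_trans (ler_Re_normc _).
case: z Kz => p q; rewrite /cone /= => Kz; rewrite mulr0 subr0 lerD2l ler_wpM2r//.
lra.
Qed.

(** Re z is nonnegative on the cone, so adding 1 to z r can only increase the modulus. The constant
    1 here makes [w] itself the contraction factor in [perturbation_surj]. *)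
Lemma ler_normc_1M (z : R[i]) (r : R) : cone z -> 0 <= r ->
  normc z * r <= normc (1 + z * (r%:C)%C).
Proof.
move=> Kz r0; rewrite -{1}[r]ger0_norm// -normc_real -ComplexField.Normc.normcM.
case: z Kz => p q Kz /=; rewrite ler_wsqrtr// !mulr0 subr0 !add0r.
have p0 : 0 <= p.
  have := normc_ge0 (p +i* q)%C; move: Kz; rewrite /cone [complex.Re _]/=; lra.
have := mulr_ge0 p0 r0; nra.
Qed.

Lemma death_op_sumE (z : R[i]) (g : LC) : Dom g -> g + z *: death_op g =
  to_LC C (fun eta => (1 + z * ((death_total d eta)%:C)%C) * LC_fun g eta).
Proof.
move=> Dg; rewrite addrC -[X in _ + X]to_LCK /death_op -to_LC_linear//; last exact: valP.
by congr to_LC; apply/funext => eta; rewrite /death_mul; ring.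
Qed.

Lemma in_LC_death_sum (z : R[i]) (g : LC) : Dom g ->
  (fun eta => (1 + z * ((death_total d eta)%:C)%C) * LC_fun g eta) \in in_LC C.
Proof.
move=> Dg; rewrite (_ : (fun eta => _) = fun eta =>
    z * death_mul d (LC_fun g) eta + LC_fun g eta).
  exact: in_LC_linear Dg (valP _).
by apply/funext => eta; rewrite /death_mul; ring.
Qed.

Lemma rnormLC_fun (g : LC) : (rnorm g)%:E = LC_norm C (LC_fun g).
Proof. by rewrite -{1}[g]LC_funK rnorm_LC_classE. Qed.

Lemma rnorm_death_op (g : LC) : Dom g ->
  (rnorm (death_op g))%:E = LC_norm C (death_mul d (LC_fun g)).
Proof. by move=> Dg; apply: rnorm_to_LC. Qed.

Lemma death_op_diss (z : R[i]) (g : LC) : cone z -> Dom g ->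
  rnorm g + normc z / 2 * rnorm (death_op g) <= rnorm (g + z *: death_op g).
Proof.
move=> Kz Dg; have Sg := in_LC_death_sum z Dg; rewrite death_op_sumE//.
suff : (LC_norm C (LC_fun g) + (normc z / 2)%:E * LC_norm C (death_mul d (LC_fun g)) <=
    LC_norm C (fun eta => ((1 + z * ((death_total d eta)%:C)%C) * LC_fun g eta)%R))%E.
  by rewrite -(rnormLC_fun g) -(rnorm_death_op Dg) -(rnorm_to_LC Sg) -EFinM -EFinD lee_fin.
have [mg _] := preLCP (LC_fun g); have mDg := cmeasurable_death_mul db mg.
have mI := measurable_LC_integrand C mDg; have mIg := measurable_LC_integrand C mg.
have mw := @measurable_weight R dim C.
have w0 (eta : Gamma0) : 0 <= C%:num ^+ #|` eta| by rewrite exprn_ge0.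
have I0 (F : Gamma0 -> R[i]) eta : (0 <= (normc (F eta) * C%:num ^+ #|` eta|)%:E)%E.
  by rewrite lee_fin mulr_ge0// normc_ge0.
have nz : (0 <= (normc z / 2)%:E)%E by rewrite lee_fin divr_ge0// normc_ge0.
have kI0 eta : (0 <= (normc z / 2)%:E *
    (normc (death_mul d (LC_fun g) eta) * C%:num ^+ #|` eta|)%:E)%E by rewrite mule_ge0.
have mkI : measurable_fun setT (fun eta : Gamma0 => (normc z / 2)%:E *
    (normc (death_mul d (LC_fun g) eta) * C%:num ^+ #|` eta|)%:E)%E.
  by apply: emeasurable_funM => //; exact: measurable_cst.
rewrite /LC_norm -ge0_integralZl// -ge0_integralD//.
apply: ge0_le_integral => //.
- by move=> eta _; rewrite adde_ge0.
- exact: emeasurable_funD.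
- by apply: measurable_LC_integrand; have /in_LCP[] := Sg.
move=> eta _; rewrite -EFinM -EFinD lee_fin mulrA -mulrDl ler_wpM2r//.
rewrite (normc_death_mul db) ComplexField.Normc.normcM mulrA -{1}[normc (LC_fun g eta)]mul1r -mulrDl.
by rewrite ler_wpM2r ?normc_ge0//; exact: ler_normc_1D.
Qed.

Lemma death_op_bnd (z : R[i]) (g : LC) : cone z -> Dom g ->
  normc z * rnorm (death_op g) <= rnorm (g + z *: death_op g).
Proof.
move=> Kz Dg; have Sg := in_LC_death_sum z Dg; rewrite death_op_sumE//.
suff : ((normc z)%:E * LC_norm C (death_mul d (LC_fun g)) <=
    LC_norm C (fun eta => ((1 + z * ((death_total d eta)%:C)%C) * LC_fun g eta)%R))%E.
  by rewrite -(rnorm_death_op Dg) -(rnorm_to_LC Sg) -EFinM lee_fin.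
have [mg _] := preLCP (LC_fun g); have mDg := cmeasurable_death_mul db mg.
rewrite -LC_normZ//; apply: LC_norm_le.
- rewrite (_ : _ *: _ = fun eta => z * death_mul d (LC_fun g) eta + 0).
    exact: cmeasurableZD mDg (cmeasurable0 _ _).
  by apply/funext => eta; rewrite addr0.
- by have /in_LCP[] := Sg.
move=> eta; rewrite -[(_ *: _) eta]/(z * death_mul d (LC_fun g) eta).
rewrite !ComplexField.Normc.normcM -ComplexField.Normc.normcM (normc_death_mul db) mulrA.
by rewrite ler_wpM2r ?normc_ge0//; exact: ler_normc_1M.
Qed.

Lemma cmeasurableM dT (T : measurableType dT) (f g : T -> R[i]) :
  cmeasurable f -> cmeasurable g -> cmeasurable (fun x => f x * g x).
Proof.
move=> [fR fI] [gR gI]; split.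
- rewrite (_ : (fun x => _) = (fun x => complex.Re (f x) * complex.Re (g x) -
    complex.Im (f x) * complex.Im (g x))).
    by apply: measurable_funB; exact: measurable_funM.
  by apply/funext => x; case: (f x) (g x) => [? ?] [? ?].
- rewrite (_ : (fun x => _) = (fun x => complex.Re (f x) * complex.Im (g x) +
    complex.Im (f x) * complex.Re (g x))).
    by apply: measurable_funD; exact: measurable_funM.
  by apply/funext => x; case: (f x) (g x) => [? ?] [? ?].
Qed.

Lemma cmeasurable_inv_1D (z : R[i]) : cone z ->
  cmeasurable (fun eta => (1 + z * ((death_total d eta)%:C)%C)^-1).
Proof.
case: z => p q Kz.
have p0 : 0 <= p.
  have := normc_ge0 (p +i* q)%C; move: Kz; rewrite /cone [complex.Re _]/=; lra.
(* Real and imaginary parts of the inverse are written through [|r|] in place of [r]: the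
   denominator [n2] is then positive on the whole line, so both are continuous functions of [r], and
   nothing changes at the nonnegative values taken by D. *)
pose u (r : R) := 1 + p * `|r|; pose v (r : R) := q * `|r|.
pose n2 r := u r ^+ 2 + v r ^+ 2.
have n20 r : n2 r != 0.
  have u1 : 1 <= u r by rewrite lerDl mulr_ge0.
  by rewrite gt_eqF// ltr_wpDr ?sqr_ge0// exprn_gt0// (lt_le_trans ltr01).
have cu : continuous u.
  move=> r; apply: cvgD; first exact: cvg_cst.
  by apply: cvgM; [exact: cvg_cst|exact: norm_continuous].
have cv : continuous v.
  by move=> r; apply: cvgM; [exact: cvg_cst|exact: norm_continuous].
have cn : continuous n2.
  by move=> r; apply: cvgD; apply: cvgM; do ?[exact: cu|exact: cv].
have cni : continuous (fun r => (n2 r)^-1) by move=> r; apply: cvgV => //; exact: cn.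
have wE eta : (1 + (p +i* q)%C * ((death_total d eta)%:C)%C)^-1 =
    ((u (death_total d eta) * (n2 (death_total d eta))^-1) +i*
     (- v (death_total d eta) * (n2 (death_total d eta))^-1))%C.
  rewrite /n2 /u /v (ger0_norm (D_ge0 eta)).
  move: (death_total d eta) => r.
  have -> : 1 + (p +i* q)%C * (r%:C)%C = ((1 + p * r) +i* (q * r))%C.
    by apply/eqP; rewrite eq_complex /= !mulr0 subr0 !add0r !eqxx.
  by rewrite mulNr.
split.
- rewrite (_ : (fun x => _) = (fun r => u r * (n2 r)^-1) \o death_total d).
    apply: measurableT_comp => //; apply: continuous_measurable_fun => r.
    by apply: cvgM; [exact: cu|exact: cni].
  by apply/funext => eta; rewrite wE.
- rewrite (_ : (fun x => _) = (fun r => - v r * (n2 r)^-1) \o death_total d).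
    apply: measurableT_comp => //; apply: continuous_measurable_fun => r.
    by apply: cvgM; [apply: cvgN; exact: cv|exact: cni].
  by apply/funext => eta; rewrite wE.
Qed.

Lemma death_op_surj (z : R[i]) (f : LC) : cone z -> z != 0 ->
  exists2 g, Dom g & g + z *: death_op g = f.
Proof.
move=> Kz z0.
pose w eta : R[i] := 1 + z * ((death_total d eta)%:C)%C.
have w1 eta : 1 <= normc (w eta).
  apply: le_trans (ler_normc_1D Kz (D_ge0 eta)).
  by rewrite lerDl mulr_ge0// divr_ge0// normc_ge0.
have w0 eta : w eta != 0.
  apply/eqP => w0; have := w1 eta; rewrite w0 ComplexField.Normc.normc0; lra.
pose F eta := (w eta)^-1 * LC_fun f eta.
have mf := mfun f.
have mF : cmeasurable F by apply: cmeasurableM => //; exact: cmeasurable_inv_1D.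
have Fin : F \in in_LC C.
  apply/in_LCP; split => //; apply: le_lt_trans (preLCP (LC_fun f)).2.
  apply: LC_norm_le => // eta.
  rewrite ComplexField.Normc.normcM ComplexField.Normc.normcV.
  by rewrite ler_piMl ?normc_ge0// invf_le1// (lt_le_trans ltr01).
(* As D = (w - 1) / z, the product D F is (f - F) / z, a combination of integrable functions; hence
   F lies in the domain. *)
have DFE : death_mul d F = fun eta => z^-1 * LC_fun f eta + (- z^-1) * F eta.
  apply/funext => eta; rewrite /death_mul /F.
  have wE : ((death_total d eta)%:C)%C = z^-1 * (w eta - 1).
    by rewrite /w addrC addKr mulrA mulVf// mul1r.
  by rewrite wE; move: (w eta) (w0 eta) => u u0; field; rewrite z0 u0.
have DFin : death_mul d F \in in_LC C.
  rewrite DFE; apply: in_LC_linear; first exact: valP.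
  rewrite (_ : (fun eta => _) = fun eta => (- z^-1) * F eta + 0).
    exact: in_LC_linear Fin (in_LC_submod dim C).1.
  by apply/funext => eta; rewrite addr0.
have aeF := LC_fun_to_LC Fin.
have DomF : Dom (to_LC C F) by apply/(Lhat_domP mF aeF).
exists (to_LC C F) => //; rewrite death_op_sumE// -[RHS]to_LCK.
apply: eq_to_LC; first exact: in_LC_death_sum.
  exact: valP.
by apply: filterS aeF => eta ->; rewrite -/(w eta) /F mulrA mulfV ?mul1r.
Qed.

(** Cutting g off outside {D <= n} makes D g integrable, and dominated convergence removes the
    cut-off, since D is finite at every configuration. *)
Lemma Lhat_dom_dense (g : LC) (e : R) : 0 < e ->
  exists2 h, Dom h & rnorm (h - g) <= e.
Proof.
move=> e0; pose G := LC_fun g; have mG := mfun g.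
pose f n (eta : Gamma0) : R := \1_[set eta | death_total d eta <= n%:R] eta.
have mf n : measurable_fun setT (f n).
  apply: measurable_indic; rewrite (_ : [set eta | _] =
    setT `&` death_total d @^-1` [set` `]-oo, n%:R]]).
    exact: (mD measurableT).
  by rewrite setTI; apply/seteqP; split => eta /=; rewrite in_itv.
have f01 n eta : f n eta = (death_total d eta <= n%:R)%R%:R.
  by rewrite /f indicE; congr (_%:R); congr nat_of_bool; apply/idP/idP => [/set_mem|/mem_set].
pose F n eta := ((f n eta)%:C)%C * G eta.
have mF n : cmeasurable (F n) by exact: cmeasurable_mulr.
have mDF n := cmeasurable_death_mul db (mF n).
have Fin n : F n \in in_LC C.
  apply/in_LCP; split => //; apply: le_lt_trans (preLCP (LC_fun g)).2.
  apply: LC_norm_le => // eta; rewrite ComplexField.Normc.normcM normc_real f01 normr_nat.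
  by rewrite ler_piMl ?normc_ge0// lern1 leq_b1.
have DFin n : death_mul d (F n) \in in_LC C.
  apply/in_LCP; split; first exact: mDF.
  have mnG : cmeasurable ((n%:R : R[i]) *: (G : Gamma0 -> R[i])).
    rewrite (_ : _ *: _ = fun eta => n%:R * G eta + 0).
      exact: cmeasurableZD mG (cmeasurable0 _ _).
    by apply/funext => eta; rewrite addr0.
  apply: (@le_lt_trans _ _ (LC_norm C ((n%:R : R[i]) *: (G : Gamma0 -> R[i])))).
    apply: LC_norm_le => // eta; rewrite (normc_death_mul db) !ComplexField.Normc.normcM normc_real f01.
    rewrite normr_nat mulrA ler_wpM2r ?normc_ge0//.
    rewrite -(rmorph_nat (real_complex R)) normc_real normr_nat.
    case: (boolP (death_total d eta <= n%:R)) => Dn; last by rewrite mulr0 ler0n.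
    by rewrite mulr1.
  rewrite LC_normZ// lte_mul_pinfty//; first by rewrite lee_fin normc_ge0.
  exact: (preLCP (LC_fun g)).2.
have mI := measurable_LC_integrand C mG.
have I0 eta : 0 <= normc (G eta) * C%:num ^+ #|` eta| by rewrite mulr_ge0 ?normc_ge0 ?exprn_ge0.
have cv : (fun n => LC_norm C (fun eta => F n eta - G eta)) @ \oo --> 0%E.
  rewrite -[X in _ --> X](@integral0 _ _ _ lambda setT).
  apply: (@dominated_cvg _ _ _ lambda setT measurableT _ _
    (fun eta => (normc (G eta) * C%:num ^+ #|` eta|)%:E)) => //.
  - by move=> n; exact: measurable_LC_integrand (cmeasurableB _ _).
  (* For a fixed configuration the cut-off is inactive as soon as [n] exceeds its total death
     rate. *)
  - move=> eta _; apply: cvg_near_cst; near=> n.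
    suff -> : F n eta - G eta = 0 by rewrite ComplexField.Normc.normc0 mul0r.
    rewrite /F f01 (_ : (death_total d eta <= n%:R)) ?mul1r ?subrr//.
    by near: n; exact: nbhs_infty_ger.
  - apply/integrableP; split; first exact: mI.
    apply: le_lt_trans (preLCP (LC_fun g)).2; rewrite /LC_norm.
    by under eq_integral do rewrite gee0_abs ?lee_fin ?I0//.
  - move=> n eta _; rewrite gee0_abs ?lee_fin ?mulr_ge0 ?normc_ge0 ?exprn_ge0//.
    rewrite ler_wpM2r ?exprn_ge0// /F f01; case: (boolP (death_total d eta <= _)) => _ /=.
      by rewrite mul1r subrr ComplexField.Normc.normc0 normc_ge0.
    by rewrite mul0r sub0r normcN.
have /fine_cvgP[_ /cvgrPdist_le/(_ _ e0)[n _ /(_ n (leqnn n)) hn]] := cv.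
have aeF := LC_fun_to_LC (Fin n).
exists (to_LC C (F n)); first by apply/(Lhat_domP (mF n) aeF).
have -> : to_LC C (F n) - g = to_LC C (fun eta => -1 * G eta + F n eta).
  by rewrite to_LC_linear ?to_LCK ?scaleN1r 1?addrC//; exact: valP.
have E : (fun eta => -1 * G eta + F n eta) = (fun eta => F n eta - G eta).
  by apply/funext => eta; rewrite mulN1r addrC.
have h : (fun eta => F n eta - G eta) \in in_LC C.
  by rewrite -E; apply: in_LC_linear => //; exact: valP.
rewrite E; suff : (LC_norm C (fun eta => (F n eta - G eta)%R) <= e%:E)%E.
  by rewrite -(rnorm_to_LC h) lee_fin.
have fn : LC_norm C (fun eta => F n eta - G eta) \is a fin_num by exact: LC_norm_fin (PreLC h).
rewrite -(fineK fn) lee_fin; apply: le_trans hn.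
by rewrite sub0r normrN ler_norm.
Unshelve. all: by end_near. Qed.

Section relative_bound.
Variables a1 a2 : R.
Hypothesis a1_ge1 : 1 <= a1.
Hypothesis a2_gt0 : 0 < a2.
Hypothesis hd : forall xi : Gamma0,
  (Kinv_total d C%:num xi <= (a1 * death_total d xi)%:E)%E.
Hypothesis hb : forall xi : Gamma0,
  (Kinv_total b C%:num xi <= (a2 * death_total d xi)%:E)%E.

Definition perturbation_fun (G : Gamma0 -> R[i]) (eta : Gamma0) : R[i] :=
  Lhat d b G eta + death_mul d G eta.

Definition perturbation_op (g : LC) : LC := to_LC C (perturbation_fun (LC_fun g)).

Lemma cmeasurable_perturbation G : cmeasurable G -> cmeasurable (perturbation_fun G).
Proof.
move=> mG; rewrite (_ : perturbation_fun G = fun eta => 1 * Lhat d b G eta + death_mul d G eta).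
  apply: cmeasurableZD; first exact: (cmeasurable_Lhat db mG).
  exact: (cmeasurable_death_mul db mG).
by apply/funext => eta; rewrite mul1r.
Qed.

Lemma in_LC_perturbation (g : LC) : Dom g -> perturbation_fun (LC_fun g) \in in_LC C.
Proof.
move=> /in_LCP[_ Dg]; have mg := mfun g.
apply/in_LCP; split; first exact: cmeasurable_perturbation.
have le := LC_norm_perturbation db dim_gt0 a1_ge1 a2_gt0 hd hb mg.
apply: (le_lt_trans le); rewrite lte_mul_pinfty// lee_fin addr_ge0 ?subr_ge0//.
by rewrite divr_ge0// ltW.
Qed.

Lemma perturbation_op_bnd (g : LC) : Dom g ->
  rnorm (perturbation_op g) <= (a1 - 1 + a2 / C%:num) * rnorm (death_op g).
Proof.
move=> Dg; have le := LC_norm_perturbation db dim_gt0 a1_ge1 a2_gt0 hd hb (mfun g).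
move: le; rewrite -/(perturbation_fun (LC_fun g)) -(rnorm_to_LC (in_LC_perturbation Dg)).
by rewrite -(rnorm_death_op Dg) -EFinM lee_fin.
Qed.

(** The representative of [a *: g + h] equals the combination of those of [g] and [h] only almost
    everywhere; [Lhat_ae] allows the replacement inside [Lhat]. *)
Lemma Lhat_linear_class a (g h : LC) : Dom g -> Dom h -> {ae lambda, forall eta,
  Lhat d b (LC_fun (a *: g + h)) eta =
  a * Lhat d b (LC_fun g) eta + Lhat d b (LC_fun h) eta}.
Proof.
move=> Dg Dh; have /in_LCP[_ Dg'] := Dg; have /in_LCP[_ Dh'] := Dh.
have /in_LCP[_ Dgh'] := Lhat_dom_linear a Dg Dh.
have mgh := cmeasurableZD a (mfun g) (mfun h).
have /in_LCP[_ DL] : death_mul d (fun xi => a * LC_fun g xi + LC_fun h xi) \in in_LC C.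
  rewrite (_ : death_mul _ _ = fun eta => a * death_mul d (LC_fun g) eta +
    death_mul d (LC_fun h) eta); first exact: in_LC_linear.
  by apply/funext => eta; exact: death_mul_linear.
have H1 := Lhat_ae db dim_gt0 a1_ge1 a2_gt0 hd hb (mfun (a *: g + h)) mgh Dgh' DL
  (LC_fun_linear a g h).
have H2 := Lhat_linear_ae db dim_gt0 a2_gt0 hb a (mfun g) (mfun h) Dg' Dh'.
by apply: filterS2 H1 H2 => eta -> ->.
Qed.

Lemma perturbation_op_linear a (g h : LC) : Dom g -> Dom h ->
  perturbation_op (a *: g + h) = a *: perturbation_op g + perturbation_op h.
Proof.
move=> Dg Dh; have [Bg Bh] := (in_LC_perturbation Dg, in_LC_perturbation Dh).
rewrite /perturbation_op -to_LC_linear//.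
apply: eq_to_LC; first exact/in_LC_perturbation/Lhat_dom_linear.
  exact: in_LC_linear.
apply: filterS2 (Lhat_linear_class a Dg Dh) (LC_fun_linear a g h) => eta e1 e2.
by rewrite /perturbation_fun e1 /death_mul e2; ring.
Qed.

Lemma generator_opE (g : LC) : Dom g -> {ae lambda, forall eta,
  LC_fun (perturbation_op g - death_op g) eta = Lhat d b (LC_fun g) eta}.
Proof.
move=> Dg; have Bg := in_LC_perturbation Dg.
have h := in_LC_linear (-1) Dg Bg.
apply: filterS (LC_fun_to_LC h) => eta.
rewrite to_LC_linear// scaleN1r [- _ + _]addrC -/(perturbation_op g) => ->.
by rewrite /perturbation_fun /death_mul; ring.
Qed.

End relative_bound.

End Lhat_generator.

Theorem theorem3p7 (R : realType) (dim : nat) (dim_gt0 : (0 < dim)%N)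
    (d b : rate R dim) (db : admissible_rates d b) (C : {posnum R})
    (a1 a2 : R) (a1_ge1 : 1 <= a1) (a2_gt0 : 0 < a2)
    (hd : forall xi : Gamma0 R dim,
       (Kinv_total d C%:num xi <= (a1 * death_total d xi)%:E)%E)
    (hb : forall xi : Gamma0 R dim,
       (Kinv_total b C%:num xi <= (a2 * death_total d xi)%:E)%E)
    (ha : a1 + a2 / C%:num < 3 / 2) :
  exists T : R -> LC dim C -> LC dim C,
    [/\ holomorphic_semigroup T,
        generator_dom T = Lhat_dom d (C := C) &
        forall g, Lhat_dom d g ->
          {ae @lebesgue_poisson R dim, forall eta,
            LC_fun (generator T g) eta = Lhat d b (LC_fun g) eta}].
Proof.
(* The relative bound of the perturbation, [a1 - 1] from the off-diagonal deaths and [a2 / C] from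
   the births; the 3/2 in the hypothesis says that it is below 1/2. *)
have w_bnd : 0 <= a1 - 1 + a2 / C%:num < 1 / 2.
  have a2C : 0 <= a2 / C%:num by rewrite divr_ge0// ltW.
  by apply/andP; split; lra.
have [T [hT domT genT]] := perturbation_holomorphic (@LC_complete R dim C) w_bnd
  (Lhat_dom0 C db) (Lhat_dom_linear db) (death_op_linear db)
  (perturbation_op_linear db dim_gt0 a1_ge1 a2_gt0 hd hb)
  (Lhat_dom_dense db) (death_op_surj db) (death_op_diss db) (death_op_bnd db)
  (perturbation_op_bnd db dim_gt0 a1_ge1 a2_gt0 hd hb).
exists T; split => // g Dg; rewrite genT//.
exact: (generator_opE db dim_gt0 a1_ge1 a2_gt0 hd hb Dg).
Qed.
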